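(* Let $N\ge 3$, $0<\alpha<N$ and $p>\frac{N+\alpha}{N}$. If $u$ is a ground state solution of $$-\operatorname{div}\left(\frac{\nabla u}{\sqrt{1-|\nabla u|^2}}\right)+u=\big(I_\alpha*|u|^p\big)|u|^{p-2}u\ \text{ in }\mathbb R^N,\qquad u(x)\to0\ \text{ as }|x|\to+\infty,$$ then either $u>0$ on $\mathbb R^N$ or $u<0$ on $\mathbb R^N$. Moreover, $u$ is radially symmetric and decays monotonically to zero: there exist $x_0\in\mathbb R^N$ and a monotone function $v:(0,+\infty)\to\mathbb R$ with $v(\rho)\to0$ as $\rho\to+\infty$ such that $u(x)=v(|x-x_0|)$ for all $x\in\mathbb R^N\setminus\{x_0\}$.
   Context: All functions are real valued. $I_\alpha(x)=C_{N,\alpha}|x|^{-(N-\alpha)}$ is the Riesz potential ($C_{N,\alpha}>0$ its normalizing constant). $2^*=\frac{2N}{N-2}$, and $r>\max\{2^*,N\}$ is fixed. $X_1$ is the completion of $C_0^\infty(\mathbb R^N)$ with respect to $\|u\|_{X_1}=\big(\|u\|_2^2+\|\nabla u\|_2^2+\|\nabla u\|_r^2\big)^{1/2}$, where $\|\cdot\|_q$ is the $L^q(\mathbb R^N)$ norm. Elements of $X_1$ are identified with their continuous representatives. For $u\in X_1$ put $\Psi_0(u)=\int_{\mathbb R^N}\big(1-\sqrt{1-|\nabla u|^2}\big)\,dx$ if $|\nabla u|\le1$ a.e., and $\Psi_0(u)=+\infty$ otherwise; $D(\Psi_0)=\{u\in X_1:|\nabla u|\le1\text{ a.e. on }\mathbb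 R^N\}$. Put $\mathcal F_{\alpha,p}(u)=\int_{\mathbb R^N}(I_\alpha*|u|^p)|u|^p\,dx$, $$\mathcal I(u)=\Psi_0(u)+\tfrac12\|u\|_2^2-\tfrac1{2p}\mathcal F_{\alpha,p}(u),\qquad \mathcal P_1(u)=N\Psi_0(u)+\tfrac{N+2}{2}\|u\|_2^2-\tfrac{N+\alpha+2p}{2p}\mathcal F_{\alpha,p}(u),$$ $\mathcal M_1=\{u\in D(\Psi_0)\setminus\{0\}:\mathcal P_1(u)=0\}$ and $c_1=\inf_{u\in\mathcal M_1}\mathcal I(u)$. A weak solution of the equation is $u\in D(\Psi_0)$ with $|\nabla u|<1$ a.e., $\frac{\nabla u}{\sqrt{1-|\nabla u|^2}}\in L^1_{loc}$, and $\int\frac{\nabla u\cdot\nabla\varphi}{\sqrt{1-|\nabla u|^2}}dx+\int u\varphi\,dx=\int(I_\alpha*|u|^p)|u|^{p-2}u\varphi\,dx$ for all $\varphi\in C_0^\infty(\mathbb R^N)$. A ground state solution is a weak solution $u\in\mathcal M_1$ with $\mathcal I(u)=c_1$. *)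

(* Defs.v *)
From HB Require Import structures.
From mathcomp Require Import all_boot all_order all_algebra.
From mathcomp Require Import all_classical all_reals all_analysis.

Set Implicit Arguments.
Unset Strict Implicit.
Unset Printing Implicit Defensive.

Import Order.TTheory GRing.Theory Num.Theory.
Import numFieldNormedType.Exports.

Local Open Scope classical_set_scope.
Local Open Scope ring_scope.

(* The space R^n is 'rV[R]_n. The sigma-algebra generated by the coordinates
   is the Borel sigma-algebra of its topology. *)

Definition rV_display : measure_display. Proof. exact: default_measure_display. Qed.

Section measurable_rV.
Context {R : realType} {n : nat}.

Definition rV_coord (i : 'I_n) (x : 'rV[R]_n) : measurableTypeR R := x ord0 i.

Let rV_set0 : g_sigma_preimage rV_coord set0.
Proof. exact: sigma_algebra0. Qed.

Let rV_setC A : g_sigma_preimage rV_coord A -> g_sigma_preimage rV_coord (~` A).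
Proof. exact: sigma_algebraC. Qed.

Let rV_bigcup (F : _^nat) : (forall i, g_sigma_preimage rV_coord (F i)) ->
  g_sigma_preimage rV_coord (\bigcup_i (F i)).
Proof. exact: sigma_algebra_bigcup. Qed.

HB.instance Definition _ := @isMeasurable.Build rV_display
  'rV[R]_n (g_sigma_preimage rV_coord) rV_set0 rV_setC rV_bigcup.

Lemma measurable_rV_coord (i : 'I_n) : measurable_fun [set: 'rV[R]_n] (rV_coord i).
Proof.
move=> _ Y mY; rewrite setTI; apply: sub_sigma_algebra => /=.
rewrite -bigcup_seq/=; exists i => /=; first by rewrite mem_index_enum.
by exists Y => //; rewrite setTI.
Qed.

Lemma measurable_fun_rV d (T : measurableType d) (f : T -> 'rV[R]_n) :
  (forall i, measurable_fun [set: T] (rV_coord i \o f)) ->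
  measurable_fun [set: T] f.
Proof.
move=> mf _ Y mY; rewrite setTI.
pose G := [set A : set 'rV[R]_n | measurable (f @^-1` A)].
suff : (measurable : set (set 'rV[R]_n)) `<=` G by apply.
apply: smallest_sub => [|A].
  split.
  - by rewrite /G/= preimage_set0.
  - by move=> A GA; rewrite /G/= setTD preimage_setC; exact: measurableC.
  - by move=> F GF; rewrite /G/= preimage_bigcup; apply: bigcup_measurable => k _; exact: GF.
rewrite -bigcup_seq => -[i _ [B mB <-]]; rewrite /G/= setTI -comp_preimage.
by rewrite -[X in measurable X]setTI; exact: mf.
Qed.

End measurable_rV.

Section lebesgue_step.
Context {R : realType} {n : nat}.

Definition rV_cons (tx : measurableTypeR R * 'rV[R]_n) : 'rV[R]_n.+1 :=
  \row_i (if unlift ord0 i is Some j then tx.2 ord0 j else tx.1).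

Definition rV_uncons (y : 'rV[R]_n.+1) : measurableTypeR R * 'rV[R]_n :=
  (y ord0 ord0, \row_j y ord0 (lift ord0 j)).

Lemma rV_cons0 tx : rV_cons tx ord0 ord0 = tx.1.
Proof. by rewrite mxE unlift_none. Qed.

Lemma rV_consS tx j : rV_cons tx ord0 (lift ord0 j) = tx.2 ord0 j.
Proof. by rewrite mxE liftK. Qed.

Lemma rV_consK : cancel rV_cons rV_uncons.
Proof.
move=> [t x]; rewrite /rV_uncons rV_cons0; congr pair.
by apply/rowP => j; rewrite mxE rV_consS.
Qed.

Lemma measurable_rV_cons : measurable_fun setT rV_cons.
Proof.
apply: measurable_fun_rV => i.
case: (unliftP ord0 i) => [j ->|->].
  rewrite (_ : _ \o _ = rV_coord j \o snd).
    by apply: measurableT_comp; [exact: measurable_rV_coord|exact: measurable_snd].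
  by apply/funext => tx; exact: rV_consS.
rewrite (_ : _ \o _ = fst); first exact: measurable_fst.
by apply/funext => tx; exact: rV_cons0.
Qed.

Lemma measurable_rV_uncons : measurable_fun setT rV_uncons.
Proof.
apply: measurable_fun_pair.
  exact: (@measurable_rV_coord R n.+1 ord0).
apply: measurable_fun_rV => j.
rewrite (_ : _ \o _ = rV_coord (lift ord0 j)).
  exact: measurable_rV_coord.
by apply/funext => y; rewrite /rV_coord /= mxE.
Qed.

Variable m : {sigma_finite_measure set 'rV[R]_n -> \bar R}.

Definition leb_step : set 'rV[R]_n.+1 -> \bar R :=
  pushforward (@lebesgue_measure R \x m)%E rV_cons.

Let leb_step0 : leb_step set0 = 0%E.
Proof. by rewrite /leb_step /pushforward preimage_set0 measure0. Qed.

Let leb_step_ge0 A : (0 <= leb_step A)%E.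
Proof. by rewrite /leb_step /pushforward; exact: measure_ge0. Qed.

Let leb_step_sigma_additive : semi_sigma_additive leb_step.
Proof.
have mcons := measurable_rV_cons.
move=> F mF tF mUF; rewrite /leb_step /pushforward preimage_bigcup.
apply: measure_semi_sigma_additive.
- by move=> k; rewrite -[X in measurable X]setTI; exact: mcons.
- apply/trivIsetP => /= i j _ _ ij; rewrite -preimage_setI.
  by move/trivIsetP : tF => /(_ _ _ _ _ ij) ->//; rewrite preimage_set0.
- by rewrite -preimage_bigcup -[X in measurable X]setTI; exact: mcons.
Qed.

HB.instance Definition _ := isMeasure.Build _ _ _ leb_step
  leb_step0 leb_step_ge0 leb_step_sigma_additive.

Let leb_step_sigma_finite : sigma_finite setT leb_step.
Proof.
have /sigma_finiteP[F [TF ndF Foo]] := sigma_finiteT (@lebesgue_measure R).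
have /sigma_finiteP[G [TG ndG Goo]] := sigma_finiteT m.
exists (fun k => rV_uncons @^-1` (F k `*` G k)) => [|k].
  apply/seteqP; split => // y _.
  have [k _ Fk] : (\bigcup_k F k) (rV_uncons y).1 by rewrite -TF.
  have [l _ Gl] : (\bigcup_k G k) (rV_uncons y).2 by rewrite -TG.
  exists (maxn k l) => //; split.
  - by move: Fk; exact/subsetPset/ndF/leq_maxl.
  - by move: Gl; exact/subsetPset/ndG/leq_maxr.
have [mF Fk] := Foo k; have [mG Gk] := Goo k; split.
  rewrite -[X in measurable X]setTI; apply: measurable_rV_uncons => //.
  exact: measurableX.
rewrite /leb_step /pushforward -comp_preimage.
rewrite (_ : _ \o _ = id); last by apply/funext => x; exact: rV_consK.
by rewrite product_measure1E// lte_mul_pinfty// ge0_fin_numE.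
Qed.

HB.instance Definition _ := Measure_isSigmaFinite.Build _ _ _ leb_step
  leb_step_sigma_finite.

End lebesgue_step.

(* n-dimensional Lebesgue measure as the n-fold product of lebesgue_measure *)
Fixpoint leb {R : realType} (n : nat) :
    {sigma_finite_measure set 'rV[R]_n -> \bar R} :=
  match n return {sigma_finite_measure set 'rV[R]_n -> \bar R} with
  | 0%N => (dirac (0 : 'rV[R]_0) : {sigma_finite_measure set 'rV[R]_0 -> \bar R})
  | k.+1 => (leb_step (leb k) : {sigma_finite_measure set 'rV[R]_k.+1 -> \bar R})
  end.

Lemma leb_box (R : realType) (n : nat) (A : 'I_n -> set R) :
  (forall i, measurable (A i)) ->
  leb n [set x : 'rV[R]_n | forall i, A i (x ord0 i)] =
  (\prod_(i < n) lebesgue_measure (A i))%E.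
Proof.
elim: n A => [|n IH] A mA.
  rewrite big_ord0 /= diracE mem_set //; by case.
rewrite big_ord_recl -IH; last by move=> i; exact: mA.
rewrite /= /leb_step /pushforward.
rewrite -product_measure1E; last 2 first.
  exact: (mA ord0).
  rewrite (_ : mkset _ = \bigcap_(i in [set: 'I_n])
      (rV_coord i @^-1` (A (lift ord0 i)))); last first.
    by apply/seteqP; split => x /= H i; [move=> _; exact: H | exact: (H i I)].
  apply: fin_bigcap_measurable => [|i _]; first exact: finite_finset.
  rewrite -[X in measurable X]setTI.
  by apply: measurable_rV_coord => //; exact: mA.
congr ((lebesgue_measure \x _)%E _); apply/seteqP; split => -[t x] /=.
  move=> H; split => [|i]; first by have := H ord0; rewrite rV_cons0.
  by have := H (lift ord0 i); rewrite rV_consS.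
move=> [At Ax] i.
case: (unliftP ord0 i) => [j ->|->]; first by rewrite rV_consS.
by rewrite rV_cons0.
Qed.

(* The library's norm on 'rV[R]_n is the sup norm. *)
Definition enorm {R : realType} {n : nat} (x : 'rV[R]_n) : R :=
  Num.sqrt (\sum_(i < n) x ord0 i ^+ 2).

Definition dotv {R : realType} {n : nat} (x y : 'rV[R]_n) : R :=
  \sum_(i < n) x ord0 i * y ord0 i.

Definition partial {R : realType} {n : nat} (i : 'I_n) (f : 'rV[R]_n -> R) :
    'rV[R]_n -> R :=
  fun x => 'D_(delta_mx ord0 i) f x.

Definition grad {R : realType} {n : nat} (f : 'rV[R]_n -> R) :
    'rV[R]_n -> 'rV[R]_n :=
  fun x => \row_i partial i f x.

Definition smooth {R : realType} {n : nat} (f : 'rV[R]_n -> R) : Prop :=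
  forall s : seq 'I_n,
    continuous (foldr partial f s) /\
    forall (i : 'I_n) (x : 'rV[R]_n),
      derivable (foldr partial f s) x (delta_mx ord0 i).

Definition test_fun {R : realType} {n : nat} (f : 'rV[R]_n -> R) : Prop :=
  smooth f /\ compact (closure [set x | f x != 0]).

Definition L1loc {R : realType} {n : nat} (f : 'rV[R]_n -> R) : Prop :=
  measurable_fun [set: 'rV[R]_n] f /\
  forall K : set 'rV[R]_n, compact K ->
    (\int[leb n]_(x in K) `|f x|%:E < +oo)%E.

Definition is_weak_grad {R : realType} {n : nat}
    (u : 'rV[R]_n -> R) (G : 'rV[R]_n -> 'rV[R]_n) : Prop :=
  [/\ L1loc u,
      forall i : 'I_n, L1loc (fun x => G x ord0 i) &
      forall (phi : 'rV[R]_n -> R) (i : 'I_n), test_fun phi ->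
        \int[leb n]_x (u x * partial i phi x) =
        - \int[leb n]_x (G x ord0 i * phi x)].

(* A weak gradient is unique up to a null set, so the choice of
   representative does not matter; the value is junk if there is none. *)
Definition nabla {R : realType} {n : nat} (u : 'rV[R]_n -> R) :
    'rV[R]_n -> 'rV[R]_n :=
  xget (fun=> 0) [set G | is_weak_grad u G].

Section functionals.
Context {R : realType} (N : nat).

Notation mu := (@leb R N).

Local Open Scope ereal_scope.

Definition X1norm (r : R) (u : 'rV[R]_N -> R) : \bar R :=
  ('N[mu]_(2%:E)[EFin \o u] ^+ 2
   + 'N[mu]_(2%:E)[EFin \o (@enorm R N \o nabla u)] ^+ 2
   + 'N[mu]_(r%:E)[EFin \o (@enorm R N \o nabla u)] ^+ 2) `^ (2^-1).

(* The completion of C_0^oo for X1norm, realized as a space of functions: the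
   functions that are X1norm-limits of test functions, each given by its
   continuous representative. *)
Definition X1 (r : R) : set ('rV[R]_N -> R) :=
  [set u | [/\ continuous u, exists G, is_weak_grad u G &
    exists phi : nat -> 'rV[R]_N -> R, (forall k, test_fun (phi k)) /\
      X1norm r (fun x => (u x - phi k x)%R) @[k --> \oo] --> 0]].

Definition DPsi0 (r : R) : set ('rV[R]_N -> R) :=
  [set u | X1 r u /\ {ae mu, forall x, (enorm (nabla u x) <= 1)%R}].

Definition Psi0 (u : 'rV[R]_N -> R) : \bar R :=
  if `[< {ae mu, forall x, (enorm (nabla u x) <= 1)%R} >] then
    \int[mu]_x (1 - Num.sqrt (1 - enorm (nabla u x) ^+ 2))%:E
  else +oo.

Definition Gamma (s : R) : R :=
  (\int[lebesgue_measure]_(t in `]0%R, +oo[) (t `^ (s - 1) * expR (- t)))%R.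

(* The normalization for which I_alpha * I_beta = I_(alpha + beta). *)
Definition riesz_const (alpha : R) : R :=
  (Gamma ((N%:R - alpha) / 2) /
   (Gamma (alpha / 2) * pi `^ (N%:R / 2) * 2 `^ alpha))%R.

(* At the origin powR gives 0 rather than +oo, which no integral sees. *)
Definition riesz (alpha : R) (x : 'rV[R]_N) : R :=
  (riesz_const alpha * enorm x `^ (- (N%:R - alpha)))%R.

(* I_alpha * |u|^p *)
Definition riesz_conv (alpha p : R) (u : 'rV[R]_N -> R) (x : 'rV[R]_N) : \bar R :=
  \int[mu]_y (riesz alpha (x - y)%R * `|u y| `^ p)%:E.

Definition Falp (alpha p : R) (u : 'rV[R]_N -> R) : \bar R :=
  \int[mu]_x (riesz_conv alpha p u x * (`|u x| `^ p)%:E).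

Definition energy (alpha p : R) (u : 'rV[R]_N -> R) : \bar R :=
  Psi0 u + (2^-1)%:E * 'N[mu]_(2%:E)[EFin \o u] ^+ 2
  - ((2 * p)^-1)%:E * Falp alpha p u.

Definition P1 (alpha p : R) (u : 'rV[R]_N -> R) : \bar R :=
  N%:R%:E * Psi0 u + ((N%:R + 2) / 2)%:E * 'N[mu]_(2%:E)[EFin \o u] ^+ 2
  - ((N%:R + alpha + 2 * p) / (2 * p))%:E * Falp alpha p u.

Definition M1 (r alpha p : R) : set ('rV[R]_N -> R) :=
  [set u | [/\ DPsi0 r u, u <> (fun=> 0%R) & P1 alpha p u = 0]].

Definition c1 (r alpha p : R) : \bar R :=
  ereal_inf (energy alpha p @` M1 r alpha p).

(* Junk where |nabla u| >= 1, which is null for a weak solution. *)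
Definition flux (u : 'rV[R]_N -> R) (x : 'rV[R]_N) : 'rV[R]_N :=
  ((Num.sqrt (1 - enorm (nabla u x) ^+ 2))^-1 *: nabla u x)%R.

Definition weak_solution (r alpha p : R) (u : 'rV[R]_N -> R) : Prop :=
  [/\ DPsi0 r u,
      {ae mu, forall x, (enorm (nabla u x) < 1)%R},
      forall i : 'I_N, L1loc (fun x => flux u x ord0 i) &
      forall phi : 'rV[R]_N -> R, test_fun phi ->
        \int[mu]_x (dotv (flux u x) (grad phi x))%:E
        + \int[mu]_x (u x * phi x)%:E =
        \int[mu]_x (riesz_conv alpha p u x *
                    (`|u x| `^ (p - 2) * u x * phi x)%:E)].

Definition ground_state (r alpha p : R) (u : 'rV[R]_N -> R) : Prop :=
  [/\ weak_solution r alpha p u, M1 r alpha p u &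
      energy alpha p u = c1 r alpha p].

End functionals.

Definition vanishes_at_infinity {R : realType} {n : nat} (u : 'rV[R]_n -> R) :
    Prop :=
  forall e : R, 0 < e -> exists M : R, forall x, M < enorm x -> `|u x| < e.

(* Main.v *)
Require Import Defs.
From HB Require Import structures.
From mathcomp Require Import all_boot all_order all_algebra.
From mathcomp Require Import all_classical all_reals all_analysis.
From mathcomp Require Import measurable_realfun ring lra.

Set Implicit Arguments.
Unset Strict Implicit.
Unset Printing Implicit Defensive.

Import Order.TTheory GRing.Theory Num.Theory.
Import numFieldNormedType.Exports.

Local Open Scope classical_set_scope.
Local Open Scope ring_scope.

(**
Write f = |u|, let sigma be the reflection in a hyperplane and let f^H be the
two-point rearrangement of f, which on each orbit {x, sigma x} puts the larger
value on a fixed side H.  The Riesz kernel decreases with the distance, so the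
interaction F does not decrease when f is replaced by f^H, and it increases
strictly unless f >= f o sigma on all of H or f <= f o sigma on all of H
([lt_dint_polarized]): for x, y in H the orbit sums of the two double integrals
differ by a positive multiple of k(x - y) - k(x - sigma y), which is positive.

A strict increase is impossible.  Suppose that w has no larger Born-Infeld
energy and no larger L^2 norm than u but F(w) > F(u).  Then P1(w) < 0, while
P1(t w) >= 0 for small t since F is homogeneous of degree 2 p > 2; so
P1(t w) = 0 for some t < 1 and t w is admissible for c_1.  On P1 = 0 the energy
is (1 - N/D) Psi_0 + (1/2) (1 - (N + 2)/D) |.|_2^2 with D = N + alpha + 2 p, both
coefficients being positive, hence t w has less energy than u
([no_better_competitor]).

The natural competitor w = f^H is only Lipschitz.  To stay among limits of test
functions, where the chain rule is elementary, both |.| in its definition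
(f = |u|, and the |f - f o sigma| that polarizes) are replaced by a smooth even
function [softabs d] with slope at most one that vanishes near zero.  At x and
at sigma x the gradient of the competitor is then a convex combination of the
two values of the gradient of u (one of them reflected), with exchanged
weights; so convexity gives Psi_0(w) <= Psi_0(u), and likewise for the L^2 norm
([born_polar_le], [sqr_polar_le]).  As d tends to zero the competitors tend
pointwise to f^H, and Fatou's lemma gives F(w) > F(u) for small d
([exists_better_interaction]).  That F(w) is finite follows from F(u) being
finite, which forces local integrability of the kernel
([riesz_loc_integrable], [Falp_lty]).  In the same way the normalizing constant
of the kernel is positive because F(u) is not zero.

So for every hyperplane f dominates its reflection on one side or the other
([ground_state_polarized]).  Moving a hyperplane of given direction from one
end of space to the other, the dominating side changes at a plane of symmetry
([symmetry_plane]).  The planes orthogonal to the coordinate axes meet in a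
point x0, about which f is therefore point symmetric; a plane of symmetry
missing x0 would come with a parallel one and make f periodic, although f
vanishes at infinity.  Hence all planes of symmetry pass through x0, f is radial
about x0, and comparison with the other hyperplanes makes it radially
nonincreasing ([radially_decreasing]).

Finally u has no zero.  Along segments from x0 the modulus can only decrease,
so u has constant sign ([constant_sign]), and its support is the whole space or
a ball.  If it is a ball of radius rho, test the equation with +-g(x_1) where
g(t) = exp(-1/(t - sigma)) for t > sigma, with sigma slightly below rho
(coordinates centred at x0).  The right-hand side is nonnegative.  Since |u|
decreases in x_1 there, and the factor 1/sqrt(1 - |grad u|^2) is at least one,
the left-hand side is at most the integral of |u| (g - g''), which is negative
because g'' > g close to sigma ([no_compact_support]).
*)

(** * Lebesgue measure on R^n under translations and involutions *)

Section measure.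
Context {R : realType}.

Lemma measurable_coord n (i : 'I_n) :
  measurable_fun [set: 'rV[R]_n] (fun x => x ord0 i : measurableTypeR R).
Proof. exact: (@measurable_rV_coord R n i). Qed.

Lemma measurable_coord_comp d (T : measurableType d) n (f : T -> 'rV[R]_n) (i : 'I_n) :
  measurable_fun setT f -> measurable_fun setT (fun x => f x ord0 i : measurableTypeR R).
Proof.
move=> mf.
exact: (measurableT_comp (measurable_coord i) mf).
Qed.

Lemma rV_ballE n (x y : 'rV[R]_n) (e : R) : 0 < e ->
  ball x e y <-> forall i, `|x ord0 i - y ord0 i| < e.
Proof.
move=> e0; split=> [[_ H] i|H]; first exact: (H ord0 i).
by split=> // i j; rewrite (ord1 i); exact: H.
Qed.

Lemma measurable_rV_ball n (x : 'rV[R]_n) (e : R) : measurable (ball x e).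
Proof.
have [e0|e0] := ltP 0 e; last first.
  rewrite (_ : ball x e = set0) //; apply/seteqP; split=> // y [].
  by rewrite ltNge e0.
rewrite (_ : ball x e = \bigcap_(i in [set: 'I_n])
   (fun y : 'rV[R]_n => y ord0 i) @^-1` (ball (x ord0 i) e)); last first.
  apply/seteqP; split=> y.
    by move=> /(rV_ballE _ _ e0) H i _; exact: H.
  by move=> H; apply/(rV_ballE _ _ e0) => i; exact: (H i I).
apply: fin_bigcap_measurable => [|i _]; first exact: finite_finset.
rewrite -[X in measurable X]setTI; apply: measurable_coord => //.
exact: measurable_ball.
Qed.

Lemma ratr_row_approx n (x : 'rV[R]_n) (e : R) : 0 < e ->
  exists q : 'rV[rat]_n, ball x e (\row_i (ratr (q ord0 i) : R)).
Proof.
move=> e0.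
have H i : exists q : rat, `|x ord0 i - ratr q| < e.
  have /rat_in_itvoo[q] : x ord0 i - e < x ord0 i + e by rewrite ltrD2l gtrN.
  rewrite in_itv/= => /andP[q1 q2]; exists q; rewrite ltr_norml; apply/andP; split; lra.
have [q qP] := choice H.
exists (\row_i q i); apply/(rV_ballE _ _ e0) => i; rewrite !mxE; exact: qP.
Qed.

(** The Borel sets of the product topology belong to the coordinate
    sigma-algebra because the topology has a countable base of balls. *)
Lemma open_measurable_rV n (U : set 'rV[R]_n) : open U -> measurable U.
Proof.
move=> oU.
pose c (q : 'rV[rat]_n) : 'rV[R]_n := \row_i (ratr (q ord0 i) : R).
pose F (qk : 'rV[rat]_n * nat) : set 'rV[R]_n :=
  if `[< ball (c qk.1) (qk.2.+1%:R^-1) `<=` U >]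
  then ball (c qk.1) (qk.2.+1%:R^-1) else set0.
rewrite (_ : U = \bigcup_qk F qk); last first.
  apply/seteqP; split=> [x Ux|x [qk _]]; last first.
    by rewrite /F; case: asboolP => // H; exact: H.
  have /nbhs_ballP[e /= e0 He] : nbhs x U by exact: open_nbhs_nbhs.
  pose k := Num.truncn (2 / e).
  have k0 : (0 : R) < k.+1%:R^-1 by rewrite invr_gt0.
  have ke : k.+1%:R^-1 + k.+1%:R^-1 <= e.
    rewrite -mulr2n -[_^-1 *+ 2]mulr_natl ler_pdivrMr// mulrC -ler_pdivrMr//.
    exact: (ltW (truncnS_gt _)).
  have [q qx] := ratr_row_approx x k0.
  exists (q, k) => //; rewrite /F /=; case: asboolP => [_|[]].
    exact: ball_sym.
  move=> y qy; apply: He; apply: (le_ball ke).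
  exact: (ball_triangle qx qy).
apply: countable_bigcupT_measurable => [|qk]; first exact: countableP.
rewrite /F; case: asboolP => // _; exact: measurable_rV_ball.
Qed.

Lemma closed_measurable_rV n (U : set 'rV[R]_n) : closed U -> measurable U.
Proof.
by move=> cU; rewrite -(setCK U); apply: measurableC; apply: open_measurable_rV;
  exact: closed_openC.
Qed.

Lemma continuous_measurable_rV n (f : 'rV[R]_n -> R) :
  continuous f -> measurable_fun setT f.
Proof.
move=> /continuousP cf; apply: (measurability _ (RGenOpens.measurableE R)).
move=> _ [_ [a [b ->] <-]]; rewrite setTI; apply: open_measurable_rV.
exact/cf/interval_open.
Qed.

Lemma measurable_rV_add d (T : measurableType d) n (f g : T -> 'rV[R]_n) :
  measurable_fun setT f -> measurable_fun setT g ->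
  measurable_fun setT (fun x => f x + g x).
Proof.
move=> mf mg; apply: measurable_fun_rV => i.
rewrite (_ : _ \o _ = (fun x => f x ord0 i : measurableTypeR R) \+ (fun x => g x ord0 i)).
  apply: measurable_funD; exact: measurable_coord_comp.
by apply/funext => x; rewrite /rV_coord /= mxE.
Qed.

Lemma measurable_rV_scale d (T : measurableType d) n (h : T -> R) (g : T -> 'rV[R]_n) :
  measurable_fun setT h -> measurable_fun setT g ->
  measurable_fun setT (fun x => h x *: g x).
Proof.
move=> mf mg; apply: measurable_fun_rV => i.
rewrite (_ : _ \o _ = h \* (fun x => g x ord0 i)).
  apply: measurable_funM => //; exact: measurable_coord_comp.
by apply/funext => x; rewrite /rV_coord /= mxE.
Qed.

Lemma measurable_rV_opp d (T : measurableType d) n (g : T -> 'rV[R]_n) :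
  measurable_fun setT g ->
  measurable_fun setT (fun x => - g x).
Proof.
move=> mg; rewrite (_ : (fun x => - g x) = (fun x => (cst (-1) x) *: g x)).
  by apply: measurable_rV_scale.
by apply/funext => x; rewrite scaleN1r.
Qed.

Lemma measurable_rV_sub d (T : measurableType d) n (f g : T -> 'rV[R]_n) :
  measurable_fun setT f -> measurable_fun setT g ->
  measurable_fun setT (fun x => f x - g x).
Proof. by move=> mf mg; apply: measurable_rV_add => //; exact: measurable_rV_opp. Qed.

Lemma measurable_enorm d (T : measurableType d) n (g : T -> 'rV[R]_n) :
  measurable_fun setT g -> measurable_fun setT (fun x => enorm (g x)).
Proof.
move=> mg; apply: (@measurableT_comp _ _ _ _ _ _ (@Num.sqrt R)).
  apply: continuous_measurable_fun; exact: sqrt_continuous.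
apply: measurable_sum => i; apply: measurable_funX.
exact: measurable_coord_comp.
Qed.

Lemma measurable_dotv d (T : measurableType d) n (f g : T -> 'rV[R]_n) :
  measurable_fun setT f -> measurable_fun setT g ->
  measurable_fun setT (fun x => dotv (f x) (g x)).
Proof.
move=> mf mg; apply: measurable_sum => i; apply: measurable_funM;
exact: measurable_coord_comp.
Qed.

Lemma lebesgue_measure_shift (a : R) (A : set R) : measurable A ->
  lebesgue_measure ((fun x => x + a) @^-1` A) = lebesgue_measure A.
Proof.
have ms : measurable_fun setT (fun x : R => x + a : measurableTypeR R).
  exact: measurable_funD.
move=> mA; apply/esym.
pose m := pushforward (@lebesgue_measure R) (fun x : R => x + a : measurableTypeR R).
have -> : lebesgue_measure ((fun x => x + a) @^-1` A) = m A by [].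
pose mp := isMeasurableFun.Build _ _ _ _ _ ms.
pose f : {mfun _ >-> _} := HB.pack (fun x : R => x + a : measurableTypeR R) mp.
rewrite (_ : m = pushforward (@lebesgue_measure R) f)//.
apply: lebesgue_measure_unique => //= _ [[b c]] _ <-.
rewrite /pushforward.
rewrite (_ : f @^-1` _ = `]b - a, c - a]%classic); last first.
  by apply/seteqP; split=> x /=; rewrite !in_itv/= => /andP[h1 h2]; apply/andP; split; lra.
rewrite !lebesgue_measure_itv/= !lte_fin ltrD2r; case: ifP => // _.
by rewrite -!EFinB; congr EFin; lra.
Qed.

Lemma measurable_preimage d d' (T : measurableType d) (U : measurableType d')
  (f : T -> U) (A : set U) : measurable_fun setT f -> measurable A ->
  measurable (f @^-1` A).
Proof. by move=> mf mA; rewrite -[X in measurable X]setTI; exact: mf. Qed.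

(** Tonelli slices the translate in the first coordinate. *)
Lemma leb_shift n (a : 'rV[R]_n) (A : set 'rV[R]_n) : measurable A ->
  leb n ((fun x => x + a) @^-1` A) = leb n A.
Proof.
elim: n a A => [|n IH] a A mA.
  rewrite (_ : _ @^-1` _ = A)//; apply/seteqP; split=> x;
    by rewrite /= (_ : x + a = x)//; apply/rowP; case.
have ms : measurable_fun setT (fun x : 'rV[R]_n.+1 => x + a).
  by apply: measurable_rV_add => //; exact: measurable_cst.
have mB := measurable_preimage ms mA.
rewrite /= /leb_step /pushforward.
have mc := @measurable_rV_cons R n.
set C := rV_cons @^-1` A.
have mC : measurable C by exact: measurable_preimage.
set D := rV_cons @^-1` _.
have DE : D = (fun z : measurableTypeR R * 'rV[R]_n => (z.1 + a ord0 ord0, z.2 + \row_j a ord0 (lift ord0 j))) @^-1` C.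
  apply/seteqP; split=> -[t x]; rewrite /D /C /=;
  (rewrite (_ : rV_cons (t, x) + a = rV_cons (t + a ord0 ord0, x + \row_j a ord0 (lift ord0 j)))//);
  apply/rowP => i; rewrite mxE; case: (unliftP ord0 i) => [j ->|->];
  by rewrite ?rV_consS ?rV_cons0//= !mxE.
have mD : measurable D by exact: measurable_preimage.
rewrite /product_measure1.
pose h (x : R) := leb n (xsection C x).
have mh : measurable_fun setT h by exact: measurable_fun_xsection.
have mst : measurable_fun [set: measurableTypeR R] (fun x : measurableTypeR R => (x : R) + a ord0 ord0 : measurableTypeR R).
  exact: measurable_funD.
transitivity (\int[@lebesgue_measure R]_x (h ((x : R) + a ord0 ord0)%R))%E.
  apply: eq_integral => x _; rewrite /= /h.
  rewrite -[RHS](IH (\row_j a ord0 (lift ord0 j))); last exact: measurable_xsection.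
  by congr (leb n _); apply/seteqP; split=> y /=; rewrite /xsection /= !inE DE.
transitivity (\int[pushforward (@lebesgue_measure R) (fun x : measurableTypeR R => ((x : R) + a ord0 ord0)%R : measurableTypeR R)]_x (h x))%E.
  by rewrite ge0_integral_pushforward.
apply: eq_measure_integral => B mB' _.
exact: lebesgue_measure_shift.
Qed.

Lemma measurable_indic_comp d d' (T : measurableType d) (U : measurableType d')
  (f : T -> U) (A : set U) : measurable_fun setT f -> measurable A ->
  measurable_fun setT (fun x => (\1_A (f x) : R)%:E).
Proof. by move=> mf mA; apply/measurable_EFinP; exact: measurableT_comp. Qed.

Lemma integral_indic_comp d d' (T : measurableType d) (U : measurableType d')
  (mu : {measure set T -> \bar R}) (f : T -> U) (A : set U) :
  measurable_fun setT f -> measurable A ->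
  (\int[mu]_x (\1_A (f x))%:E = mu (f @^-1` A))%E.
Proof.
move=> mf mA; have mfA := measurable_preimage mf mA.
by have := @integral_indic _ _ _ mu setT measurableT _ mfA; rewrite setIT.
Qed.

(** The pushforward under a map commuting with translations is again
    translation invariant, so it is a multiple of Lebesgue measure: evaluate
    [\int\int 1_A (x + y) 1_B y] in both orders, with [B] the unit cube. *)
Lemma leb_pushforward_scale n (T : 'rV[R]_n -> 'rV[R]_n) :
  measurable_fun setT T ->
  (forall b, exists c, forall x, T (x + c) = T x + b) ->
  exists c : \bar R, (0 <= c)%E /\ forall A, measurable A ->
    leb n (T @^-1` A) = (c * leb n A)%E.
Proof.
move=> mT shT.
pose nu A := leb n (T @^-1` A).
have nuE A : nu A = leb n (T @^-1` A) by [].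
have nush (a : 'rV[R]_n) (A : set 'rV[R]_n) : measurable A -> nu ((fun x => x + a) @^-1` A) = nu A.
  move=> mA; rewrite !nuE; have [c Hc] := shT a.
  have mTA := measurable_preimage mT mA.
  rewrite -[RHS](leb_shift c)//.
  by congr (leb n _); apply/seteqP; split=> x /=; rewrite Hc.
pose B : set 'rV[R]_n := [set x | forall i, `[0, 1]%classic (x ord0 i)].
have mB : measurable B.
  rewrite (_ : B = \bigcap_(i in [set: 'I_n])
   (fun y : 'rV[R]_n => y ord0 i) @^-1` `[0, 1]%classic); last first.
    by apply/seteqP; split=> y H i; [move=> _; exact: H|exact: (H i I)].
  apply: fin_bigcap_measurable => [|i _]; first exact: finite_finset.
  by apply: measurable_preimage => //; exact: measurable_coord.
have lB : leb n B = 1%E.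
  rewrite /B (leb_box (A := fun=> `[0, 1]%classic))// big1// => i _.
  by rewrite lebesgue_measure_itv/= lte_fin ltr01 sube0.
have mN : measurable_fun setT (fun x : 'rV[R]_n => - x) by exact: measurable_rV_opp.
exists (nu ((fun x => - x) @^-1` B)); split => [|A mA]; first exact: measure_ge0.
rewrite -nuE.
pose V := 'rV[R]_n.
pose f (z : V * V) : \bar R := (\1_A (T z.1 + z.2) * \1_B z.2)%:E.
have mf : measurable_fun setT f.
  apply/measurable_EFinP; apply: measurable_funM.
    apply: measurableT_comp => //; apply: measurable_rV_add => //.
    exact: measurableT_comp.
  exact: measurableT_comp.
have f0 z : (0 <= f z)%E by rewrite lee_fin mulr_ge0.
have := @fubini_tonelli _ _ _ _ _ (leb n) (leb n) f mf f0.
rewrite [X in _ = X -> _](_ : _ = nu A); last first.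
  transitivity (\int[leb n]_y (nu A * (\1_B y)%:E))%E.
    apply: eq_integral => y _; rewrite /f /=.
    under eq_integral do rewrite EFinM muleC.
    have mTy : measurable_fun setT (fun x : V => T x + y).
      by apply: measurable_rV_add => //; exact: measurable_cst.
    have mi := measurable_indic_comp mTy mA.
    rewrite ge0_integralZl ?lee_fin// integral_indic_comp// muleC.
    by congr (_ * _)%E; rewrite -[RHS](nush y).
  have mi (C : set V) : measurable C -> measurable_fun setT (fun x => (\1_C x : R)%:E).
    by move=> mC; apply: measurable_indic_comp.
  rewrite ge0_integralZl//; last exact: mi.
  by rewrite integral_indic// setIT [X in (_ * X)%E](_ : _ = 1%E) ?mule1.
move=> <-.
pose g (z : V * V) : \bar R := (\1_A z.2 * \1_B (z.2 - T z.1))%:E.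
have mg : measurable_fun setT g.
  apply/measurable_EFinP; apply: measurable_funM.
    exact: measurableT_comp.
  apply: measurableT_comp => //; apply: measurable_rV_sub => //.
  exact: measurableT_comp.
have g0 z : (0 <= g z)%E by rewrite lee_fin mulr_ge0.
transitivity (\int[leb n]_x \int[leb n]_y g (x, y))%E.
  apply: eq_integral => x _.
  have mC : measurable (A `&` (fun y : V => y - T x) @^-1` B).
    apply: measurableI => //; apply: measurable_preimage => //.
    by apply: measurable_rV_sub => //; exact: measurable_cst.
  have ms : measurable_fun setT (fun y : V => y + T x).
    by apply: measurable_rV_add => //; exact: measurable_cst.
  transitivity (leb n ((fun y => y + T x) @^-1` (A `&` (fun y : V => y - T x) @^-1` B))).
    rewrite -integral_indic_comp//; apply: eq_integral => y _.
    rewrite /f indicI/= [y + T x]addrC; congr (_ * _)%:E.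
    by change (\1_B y = \1_B (T x + y - T x) :> R); rewrite addrC addKr.
  rewrite leb_shift//.
  have := @integral_indic_comp _ _ _ _ (leb n) id _ (@measurable_id _ _ setT) mC.
  rewrite preimage_id => <-; apply: eq_integral => y _.
  by rewrite /g indicI/=.
rewrite (@fubini_tonelli _ _ _ _ _ (leb n) (leb n) g mg g0).
transitivity (\int[leb n]_y (nu ((fun x : V => - x)%R @^-1` B) * (\1_A y)%:E))%E; last first.
  have mi (C : set V) : measurable C -> measurable_fun setT (fun x => (\1_C x : R)%:E).
    by move=> mC; apply: measurable_indic_comp.
  rewrite ge0_integralZl//; last exact: mi.
  by rewrite integral_indic// setIT.
apply: eq_integral => y _; rewrite /g /=.
have mTy : measurable_fun setT (fun x : V => y - T x).
  by apply: measurable_rV_sub => //; exact: measurable_cst.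
have mi := measurable_indic_comp mTy mB.
under eq_integral do rewrite EFinM.
rewrite ge0_integralZl ?lee_fin// integral_indic_comp// muleC.
congr (_ * _)%E.
rewrite -[RHS](nush (- y)); last exact: measurable_preimage.
rewrite nuE; congr (leb n _).
by apply/seteqP; split=> x /=; rewrite opprD opprK addrC.
Qed.

(** For an involution the scaling factor squares to one. *)
Lemma leb_involution n (T : 'rV[R]_n -> 'rV[R]_n) :
  measurable_fun setT T ->
  (forall b, exists c, forall x, T (x + c) = T x + b) ->
  involutive T ->
  forall A, measurable A -> leb n (T @^-1` A) = leb n A.
Proof.
move=> mT shT TT.
have TTA A : T @^-1` (T @^-1` A) = A by apply/seteqP; split=> x /=; rewrite TT.
have [c [c0 Hc]] := leb_pushforward_scale mT shT.
suff c1 : c = 1%E by move=> A mA; rewrite Hc// c1 mul1e.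
pose B : set 'rV[R]_n := [set x | forall i, `[0, 1]%classic (x ord0 i)].
have mB : measurable B.
  rewrite (_ : B = \bigcap_(i in [set: 'I_n])
   (fun y : 'rV[R]_n => y ord0 i) @^-1` `[0, 1]%classic); last first.
    by apply/seteqP; split=> y H i; [move=> _; exact: H|exact: (H i I)].
  apply: fin_bigcap_measurable => [|i _]; first exact: finite_finset.
  by apply: measurable_preimage => //; exact: measurable_coord.
have lB : leb n B = 1%E.
  rewrite /B (leb_box (A := fun=> `[0, 1]%classic))// big1// => i _.
  by rewrite lebesgue_measure_itv/= lte_fin ltr01 sube0.
have : (c * c = 1)%E.
  have := Hc _ (measurable_preimage mT mB).
  by rewrite TTA Hc// lB mule1.
case: c c0 {Hc} => [c| |]//=.
rewrite lee_fin => c0 /eqP; rewrite -EFinM eqe => /eqP cc.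
by congr EFin; nra.
Qed.

End measure.

(** * Smooth functions of several variables *)

Section calculus.
Context {R : realType} {n : nat}.
Notation V := 'rV[R]_n.
Notation e_ i := (delta_mx ord0 i : V).
Implicit Types (f g : V -> R) (x y v : V).

Lemma line_growth f x v t :
  (fun h : R => h^-1 *: (((fun s : R => f (s *: v + x)) \o shift t) (h *: 1) -
    f (t *: v + x))) =
  (fun h : R => h^-1 *: ((f \o shift (t *: v + x)) (h *: v) - f (t *: v + x))).
Proof. by apply/funext => h /=; rewrite [h *: 1]mulr1 scalerDl addrA. Qed.

Lemma line_derivable f x v t :
  derivable (fun s : R => f (s *: v + x)) t 1 <-> derivable f (t *: v + x) v.
Proof. by rewrite /derivable line_growth. Qed.

Lemma line_derive f x v t :
  'D_1 (fun s : R => f (s *: v + x)) t = 'D_v f (t *: v + x).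
Proof. by rewrite /derive line_growth. Qed.

Lemma mvt_line f x v (s : R) : (forall t : R, derivable f (t *: v + x) v) ->
  exists2 xi : R, `|xi| <= `|s| & f (s *: v + x) - f x = s * 'D_v f (xi *: v + x).
Proof.
move=> df; pose g (t : R) := f (t *: v + x).
have dg (t : R) : is_derive t 1 g ('D_v f (t *: v + x)).
  by rewrite -line_derive; apply: derivableP; apply/line_derivable.
have cg (i : interval R) : {within [set` i], continuous g}.
  by apply: derivable_within_continuous => t _; apply/line_derivable.
have g0 : g 0 = f x by rewrite /g scale0r add0r.
have [s0|s0] := leP 0 s.
  have [c] := MVT_segment s0 (fun t _ => dg t) (@cg _).
  rewrite in_itv/= subr0 g0 => /andP[c0 cs] E; exists c; first by rewrite !ger0_norm.
  by rewrite mulrC -E.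
have [c] := MVT_segment (ltW s0) (fun t _ => dg t) (@cg _).
rewrite in_itv/= sub0r g0 => /andP[c0 cs] E; exists c.
  by rewrite !ler0_norm ?(ltW s0)// lerN2.
by apply: oppr_inj; rewrite opprB -mulNr mulrC -E.
Qed.

Lemma chain_rule (j : R -> R) f x v :
  derivable f x v -> derivable j (f x) 1 ->
  derivable (j \o f) x v /\ 'D_v (j \o f) x = j^`()%classic (f x) * 'D_v f x.
Proof.
move=> df dj; pose g (t : R) := f (t *: v + x).
have E : x = 0 *: v + x by rewrite scale0r add0r.
have dg : derivable g 0 1 by apply/line_derivable; rewrite -E.
have dj' : derivable j (g 0) 1 by rewrite /g -E.
have djg : derivable (j \o g) 0 1.
  have d1 := (derivable1_diffP _ _).1 dg; have d2 := (derivable1_diffP _ _).1 dj'.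
  exact: ((derivable1_diffP _ _).2 (differentiable_comp d1 d2)).
split; first by have := (line_derivable (j \o f) x v 0).1 djg; rewrite -E.
have := line_derive (j \o f) x v 0; rewrite -E => <-.
change ('D_1 (j \o g) 0 = j^`()%classic (f x) * 'D_v f x).
have h2 : g^`()%classic 0 = 'D_v f x.
  by rewrite derive1E; have := line_derive f x v 0; rewrite -E.
have h3 : g 0 = f x by rewrite /g -E.
by rewrite -derive1E (derive1_comp dg dj') h2 h3.
Qed.

(** For a C^1 function, directional derivatives add up: move along the
    coordinate direction last and apply the mean value theorem there. *)
Lemma derive_add_coord f x v (c : R) (i : 'I_n) (L : R) :
  is_derive x v f L -> (forall y, derivable f y (e_ i)) ->
  {for x, continuous (partial i f)} ->
  is_derive x (v + c *: e_ i) f (L + c * partial i f x).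
Proof.
move=> dfv dfi cfi.
pose G (h : R) := h^-1 *: ((f \o shift x) (h *: v) - f x).
pose H (h : R) := h^-1 *: ((f \o shift x) (h *: (v + c *: e_ i)) - (f \o shift x) (h *: v)).
have GL : G @ 0^' --> L.
  by have [d <-] := dfv; exact: d.
have HL : H @ 0^' --> c * partial i f x.
  apply/cvgrPdist_le => eps eps0.
  have c1 : 0 < `|c| + 1 by rewrite ltr_wpDl.
  have := cfi; move=> /cvgrPdist_le/(_ (eps / (`|c| + 1))).
  rewrite divr_gt0// => /(_ isT)/nbhs_ballP[d /= d0 Hd].
  pose M := `|v| + `|c *: e_ i| + 1.
  have M0 : 0 < M by rewrite /M ltr_wpDl// addr_ge0.
  near=> h.
  have hd : `|h| * M < d.
    rewrite -ltr_pdivlMr//; near: h.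
    apply: dnbhs0_lt; exact: divr_gt0.
  have h0 : h != 0 by near: h; exact: nbhs_dnbhs_neq.
  have [xi xile E] := @mvt_line f (h *: v + x) (e_ i) (h * c) (fun t => dfi _).
  have -> : H h = c * partial i f (xi *: e_ i + (h *: v + x)).
    rewrite /H /= [h *: (v + _)]scalerDr scalerA [h *: v + _ + x]addrAC [_ + (h * c) *: _]addrC E.
    by rewrite -[LHS]/(h^-1 * (_ * _)) -mulrA mulKf.
  rewrite -mulrBr normrM.
  have B : `|partial i f x - partial i f (xi *: e_ i + (h *: v + x))| <= eps / (`|c| + 1).
    apply: Hd; rewrite -ball_normE /=.
    rewrite addrA opprD addrCA subrr addr0 normrN.
    apply: le_lt_trans hd; apply: (le_trans (ler_normD _ _)).
    rewrite !normrZ /M !normrZ mulrDr mulr1 mulrDr.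
    apply: (@le_trans _ _ (`|h| * `|v| + `|h| * (`|c| * `|e_ i|))); last by rewrite lerDl.
    rewrite addrC lerD2l mulrA -normrM; exact: ler_wpM2r.
  apply: (le_trans (ler_wpM2l (normr_ge0 c) B)).
  by rewrite mulrA ler_pdivrMr// mulrC ler_pM2l// lerDl.
have GH : (fun h : R => h^-1 *: ((f \o shift x) (h *: (v + c *: e_ i)) - f x)) = G \+ H.
  by apply/funext => h; rewrite /G /H /= -scalerDr [in RHS]addrC [in RHS]addrA subrK.
have CV : (fun h : R => h^-1 *: ((f \o shift x) (h *: (v + c *: e_ i)) - f x)) @ 0^' --> L + c * partial i f x.
  by rewrite GH; apply: cvgD.
apply: DeriveDef; first by apply/cvg_ex; exists (L + c * partial i f x); exact: CV.
exact: cvg_lim CV.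
Unshelve. all: by end_near. Qed.

(** The increments along the coordinate directions are added one at a time. *)
Lemma derive_dir f x v :
  (forall i y, derivable f y (e_ i)) -> (forall i, continuous (partial i f)) ->
  is_derive x v f (\sum_i v ord0 i * partial i f x).
Proof.
move=> df cf.
suff H (s : seq 'I_n) : is_derive x (\sum_(i <- s) v ord0 i *: e_ i) f
    (\sum_(i <- s) v ord0 i * partial i f x).
  have := H (index_enum 'I_n).
  by rewrite -(row_sum_delta v).
elim: s => [|i s IH]; first by rewrite !big_nil; exact: is_derive0.
rewrite !big_cons addrC [X in is_derive _ _ _ X]addrC.
apply: derive_add_coord => //; exact: cf.
Qed.

(** Membership in C^k by induction on [k], the form in which closure
    properties can be proved without listing iterated partials. *)
Fixpoint Ck (k : nat) f : Prop :=
  match k with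
  | 0 => continuous f
  | k'.+1 => continuous f /\
      forall i, (forall x, derivable f x (e_ i)) /\ Ck k' (partial i f)
  end.

Lemma Ck_continuous k f : Ck k f -> continuous f.
Proof. by case: k => [//|k []]. Qed.

Lemma CkW k f : Ck k.+1 f -> Ck k f.
Proof.
elim: k f => [|k IH] f [cf H] //=.
by split=> // i; have [d Hk] := H i; split => //; exact: IH.
Qed.

Lemma smoothP f : smooth f <-> forall k, Ck k f.
Proof.
split=> [sf k|H s].
  suff : forall s, Ck k (foldr partial f s) by move=> /(_ [::]).
  elim: k => [|k IH] s; first by have [] := sf s.
  have [cs ds] := sf s; split=> // i; split; first exact: ds.
  exact: (IH (i :: s)).
have Hs : forall s k, Ck k (foldr partial f s).
  elim=> [//|i s' IH k] /=.
  by have [_ /(_ i)[]] := IH k.+1.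
have [cs ds] := Hs s 1%N; split => // i x.
by have [] := ds i.
Qed.

Lemma smooth_continuous f : smooth f -> continuous f.
Proof. by move=> /(_ [::])[]. Qed.

Lemma smooth_derivable f i x : smooth f -> derivable f x (e_ i).
Proof. by move=> /(_ [::])[_]. Qed.

Lemma smooth_partial f i : smooth f -> smooth (partial i f).
Proof. by move=> /smoothP H; apply/smoothP => k; have [_ /(_ i)[]] := H k.+1. Qed.

Lemma Ck_cst k (c : R) : Ck k (cst c : V -> R).
Proof.
elim: k c => [|k IH] c; first exact: cst_continuous.
split; first exact: cst_continuous.
move=> i; split => [x|]; first exact: derivable_cst.
rewrite (_ : partial i _ = cst 0)//; apply/funext => x; exact: derive_cst.
Qed.

Lemma CkD k f g : Ck k f -> Ck k g -> Ck k (fun x => f x + g x).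
Proof.
elim: k f g => [|k IH] f g Hf Hg.
  by move=> x; apply: continuousD; [exact: Hf|exact: Hg].
have [cf df] := Hf; have [cg dg] := Hg.
split; first by move=> x; apply: continuousD; [exact: cf|exact: cg].
move=> i; have [df1 df2] := df i; have [dg1 dg2] := dg i; split.
  by move=> x; apply: derivableD.
rewrite (_ : partial i _ = fun x => partial i f x + partial i g x); first exact: IH.
by apply/funext => x; exact: deriveD.
Qed.

Lemma CkM k f g : Ck k f -> Ck k g -> Ck k (fun x => f x * g x).
Proof.
elim: k f g => [|k IH] f g Hf Hg.
  by move=> x; apply: continuousM; [exact: Hf|exact: Hg].
have [cf df] := Hf; have [cg dg] := Hg.
split; first by move=> x; apply: continuousM; [exact: cf|exact: cg].
move=> i; have [df1 df2] := df i; have [dg1 dg2] := dg i; split.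
  by move=> x; apply: derivableM.
rewrite (_ : partial i _ = fun x => f x * partial i g x + g x * partial i f x).
  by apply: CkD; apply: IH => //; exact: CkW.
by apply/funext => x; exact: deriveM.
Qed.

Lemma CkZ k (c : R) f : Ck k f -> Ck k (fun x => c * f x).
Proof. by move=> Hf; apply: CkM => //; exact: Ck_cst. Qed.

Lemma CkN k f : Ck k f -> Ck k (fun x => - f x).
Proof.
move=> Hf; rewrite (_ : (fun x => - f x) = (fun x => (-1) * f x)); first exact: CkZ.
by apply/funext => x; rewrite mulN1r.
Qed.

Lemma Ck_sum k (I : Type) (s : seq I) (F : I -> V -> R) :
  (forall i, Ck k (F i)) -> Ck k (fun x => \sum_(i <- s) F i x).
Proof.
move=> H; elim: s => [|i s IH].
  rewrite (_ : (fun _ => _) = cst 0); first exact: Ck_cst.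
  by apply/funext => x; rewrite big_nil.
rewrite (_ : (fun _ => _) = fun x => F i x + \sum_(j <- s) F j x); first exact: CkD.
by apply/funext => x; rewrite big_cons.
Qed.

(** The analogue of [Ck] for functions of one variable. *)
Fixpoint C1k (k : nat) (j : R -> R) : Prop :=
  match k with
  | 0 => continuous j
  | k'.+1 => (forall t, derivable j t 1) /\ C1k k' j^`()%classic
  end.

Lemma C1k_continuous k j : C1k k j -> continuous j.
Proof.
case: k => [//|k [d _]] t.
by apply: differentiable_continuous; apply/derivable1_diffP; exact: d.
Qed.

Lemma C1kW k j : C1k k.+1 j -> C1k k j.
Proof.
elim: k j => [|k IH] j H; first exact: C1k_continuous H.
by have [d Hj] := H; split => //; exact: IH.
Qed.

Lemma Ck_comp k (j : R -> R) f : C1k k j -> Ck k f -> Ck k (j \o f).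
Proof.
elim: k j f => [|k IH] j f Hj Hf.
  by move=> x; apply: continuous_comp; [exact: Hf|exact: Hj].
have [cf df] := Hf; split.
  by move=> x; apply: continuous_comp; [exact: cf|exact: (C1k_continuous Hj)].
have [dj Hj'] := Hj.
move=> i; have [d Hd] := df i; split=> [x|].
  by have [] := chain_rule (d x) (dj (f x)).
rewrite (_ : partial i _ = fun x => (j^`()%classic \o f) x * partial i f x); last first.
  by apply/funext => x; have [] := chain_rule (d x) (dj (f x)).
by apply: CkM => //; apply: IH => //; exact: CkW.
Qed.

(** Composition with a map that sends lines in coordinate directions to lines. *)
Lemma Ck_affine k (A : V -> V) (L : 'I_n -> V) f :
  continuous A -> (forall i (h : R) x, A (h *: e_ i + x) = h *: L i + A x) ->
  Ck k f -> Ck k (f \o A).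
Proof.
move=> cA HA; elim: k f => [|k IH] f Hf.
  by move=> x; apply: continuous_comp; [exact: cA|exact: Hf].
have [cf df] := Hf; split; first by move=> x; apply: continuous_comp; [exact: cA|exact: cf].
move=> i.
have dd x : is_derive (A x) (L i) f (\sum_j L i ord0 j * partial j f (A x)).
  apply: derive_dir => [j y|j]; have [d Hd] := df j => //; exact: Ck_continuous Hd.
have E x : (fun h : R => h^-1 *: (((f \o A) \o shift x) (h *: e_ i) - (f \o A) x)) =
    (fun h : R => h^-1 *: ((f \o shift (A x)) (h *: L i) - f (A x))).
  by apply/funext => h /=; rewrite HA.
split=> [x|].
  by rewrite /derivable E; have [] := dd x.
rewrite (_ : partial i _ = fun x => \sum_j L i ord0 j * (partial j f \o A) x).
  by apply: Ck_sum => j; apply: CkZ; apply: IH; have [] := df j.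
by apply/funext => x; rewrite /partial /derive E; have [_ <-] := dd x.
Qed.

Lemma near_eq_continuous f g x : {for x, continuous g} ->
  (\forall y \near x, f y = g y) -> {for x, continuous f}.
Proof.
move=> cg fg U; rewrite (nbhs_singleton fg) => /cg /=.
by apply: filterS2 fg => y /= ->.
Qed.

Lemma Ck_local k f :
  (forall x, exists g, Ck k g /\ \forall y \near x, f y = g y) -> Ck k f.
Proof.
elim: k f => [|k IH] f H.
  by move=> x; have [g [cg fg]] := H x; apply: near_eq_continuous fg; exact: cg.
split.
  move=> x; have [g [Hg fg]] := H x; apply: near_eq_continuous fg.
  exact: (Ck_continuous Hg).
move=> i; split.
  move=> x; have [g [[cg dg] fg]] := H x.
  apply: (near_eq_derivable (f := g)); last by have [] := dg i.
  by apply: filterS fg.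
apply: IH => x; have [g [[cg dg] fg]] := H x.
exists (partial i g); split; first by have [] := dg i.
have := nbhs_interior fg; apply: filterS => y fgy.
exact: near_eq_derive.
Qed.

Lemma smooth_cst (c : R) : smooth (cst c : V -> R).
Proof. by apply/smoothP => k; exact: Ck_cst. Qed.

Lemma smoothD f g : smooth f -> smooth g -> smooth (fun x => f x + g x).
Proof. by move=> /smoothP Hf /smoothP Hg; apply/smoothP => k; exact: CkD. Qed.

Lemma smoothM f g : smooth f -> smooth g -> smooth (fun x => f x * g x).
Proof. by move=> /smoothP Hf /smoothP Hg; apply/smoothP => k; exact: CkM. Qed.

Lemma smoothN f : smooth f -> smooth (fun x => - f x).
Proof. by move=> /smoothP Hf; apply/smoothP => k; exact: CkN. Qed.

Lemma smoothZ (c : R) f : smooth f -> smooth (fun x => c * f x).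
Proof. by move=> Hf; exact: smoothM (smooth_cst c) Hf. Qed.

Lemma smooth_comp (j : R -> R) f : (forall k, C1k k j) -> smooth f -> smooth (j \o f).
Proof. by move=> Hj /smoothP Hf; apply/smoothP => k; exact: Ck_comp. Qed.

Lemma smooth_prod (I : Type) (s : seq I) (F : I -> V -> R) :
  (forall i, smooth (F i)) -> smooth (fun x => \prod_(i <- s) F i x).
Proof.
move=> H; elim: s => [|i s IH].
  rewrite (_ : (fun _ => _) = cst 1); first exact: smooth_cst.
  by apply/funext => x; rewrite big_nil.
rewrite (_ : (fun _ => _) = fun x => F i x * \prod_(j <- s) F j x); first exact: smoothM.
by apply/funext => x; rewrite big_cons.
Qed.

Lemma partialD f g i x : smooth f -> smooth g ->
  partial i (fun x => f x + g x) x = partial i f x + partial i g x.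
Proof. by move=> sf sg; apply: deriveD; exact: smooth_derivable. Qed.

Lemma partialM f g i x : smooth f -> smooth g ->
  partial i (fun x => f x * g x) x = f x * partial i g x + g x * partial i f x.
Proof. by move=> sf sg; apply: deriveM; exact: smooth_derivable. Qed.

Lemma partialN f i x : smooth f ->
  partial i (fun x => - f x) x = - partial i f x.
Proof. by move=> sf; apply: deriveN; exact: smooth_derivable. Qed.

Lemma partialZ (c : R) f i x : smooth f ->
  partial i (fun x => c * f x) x = c * partial i f x.
Proof. by move=> sf; apply: deriveZ; exact: smooth_derivable. Qed.

Lemma partial_comp (j : R -> R) f i x : derivable j (f x) 1 -> smooth f ->
  partial i (j \o f) x = j^`()%classic (f x) * partial i f x.
Proof.
move=> dj sf.
by have [] := chain_rule (@smooth_derivable f i x sf) dj.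
Qed.

Lemma partial_local f g i x : (\forall y \near x, f y = g y) ->
  partial i f x = partial i g x.
Proof. exact: near_eq_derive. Qed.

Lemma smooth_dir f x v : smooth f ->
  is_derive x v f (\sum_i v ord0 i * partial i f x).
Proof.
move=> sf; apply: derive_dir => [i y|i]; first exact: smooth_derivable.
exact/smooth_continuous/smooth_partial.
Qed.

Lemma is_derive_coord i j (x : V) : is_derive x (e_ j) (fun x : V => x ord0 i) ((e_ j) ord0 i).
Proof.
have E : (fun h : R => h^-1 *: (((fun x : V => x ord0 i) \o shift x) (h *: e_ j) - x ord0 i)) @ 0^' --> (e_ j) ord0 i.
  apply: (@cvg_trans _ (cst ((e_ j) ord0 i) @ 0^')); last exact: cvg_cst.
  apply: near_eq_cvg; near=> h; rewrite /= !mxE addrK [RHS]mulrA mulVf ?mul1r//.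
  by near: h; exact: nbhs_dnbhs_neq.
apply: DeriveDef; first by apply/cvg_ex; exists ((e_ j) ord0 i).
exact: cvg_lim E.
Unshelve. all: by end_near. Qed.

Lemma partial_coord i j (x : V) : partial j (fun x : V => x ord0 i) x = (i == j)%:R.
Proof. by have [_ h] := is_derive_coord i j x; rewrite /partial h mxE eqxx. Qed.

Lemma Ck_coord k i : Ck k (fun x : V => x ord0 i).
Proof.
have c : continuous (fun x : V => x ord0 i) by exact: coord_continuous.
case: k => [//|k]; split => // j.
split; first by move=> x; have [] := is_derive_coord i j x.
rewrite (_ : partial j _ = cst ((e_ j) ord0 i)); first exact: Ck_cst.
by apply/funext => x; have [_ <-] := is_derive_coord i j x.
Qed.

Lemma smooth_coord i : smooth (fun x : V => x ord0 i).
Proof. by apply/smoothP => k; exact: Ck_coord. Qed.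

(** In finite dimension a set is relatively compact when it is bounded. *)
Lemma test_funP f : test_fun f <->
  smooth f /\ exists M : R, forall x, f x != 0 -> `|x| <= M.
Proof.
split=> [[sf cf]|[sf [M HM]]]; split => //.
  have [M [Mr HM]] := compact_bounded cf.
  exists (M + 1) => x fx; apply: (HM (M + 1)); first by rewrite ltrDl.
  by apply: subset_closure.
apply: bounded_closed_compact; last exact: closed_closure.
exists M; split; first exact: num_real.
move=> M' MM' x cx.
suff : closed [set y : V | `|y| <= M'].
  move=> /closure_id ->.
  by apply: closure_subset cx => y /HM /le_trans; apply; exact: ltW.
rewrite (_ : [set y : V | _] = (fun y : V => `|y|) @^-1` [set t | t <= M'])//.
apply: closed_comp; first by move=> y _; exact: norm_continuous.
exact: closed_le.
Qed.

End calculus.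

(** * Flat functions and a smoothed absolute value *)

Section flat.
Context {R : realType}.
Implicit Types (t s : R) (k m : nat) (i j : R -> R).

Lemma C1kD k i j : C1k k i -> C1k k j -> C1k k (fun t => i t + j t).
Proof.
elim: k i j => [|k IH] i j Hi Hj.
  by move=> x; apply: continuousD; [exact: Hi|exact: Hj].
have [di Hi'] := Hi; have [dj Hj'] := Hj.
split; first by move=> t; exact: derivableD.
rewrite (_ : derive1 _ = fun t => derive1 i t + derive1 j t); first exact: IH.
by apply/funext => t; rewrite !derive1E; exact: deriveD.
Qed.

Lemma C1kM k i j : C1k k i -> C1k k j -> C1k k (fun t => i t * j t).
Proof.
elim: k i j => [|k IH] i j Hi Hj.
  by move=> x; apply: continuousM; [exact: Hi|exact: Hj].
have [di Hi'] := Hi; have [dj Hj'] := Hj.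
split; first by move=> t; exact: derivableM.
rewrite (_ : derive1 _ = fun t => i t * derive1 j t + j t * derive1 i t).
  by apply: C1kD; apply: IH => //; exact: C1kW.
by apply/funext => t; rewrite !derive1E; exact: deriveM.
Qed.

Lemma C1k_cst k (c : R) : C1k k (cst c).
Proof.
elim: k c => [|k IH] c; first exact: cst_continuous.
split; first by move=> t; exact: derivable_cst.
rewrite (_ : derive1 _ = cst 0)//; apply/funext => x; rewrite derive1E; exact: derive_cst.
Qed.

Lemma C1kZ k (c : R) i : C1k k i -> C1k k (fun t => c * i t).
Proof. by move=> Hi; exact: C1kM (C1k_cst k c) Hi. Qed.

Lemma C1k_id k : C1k k (id : R -> R).
Proof.
case: k => [|k]; first by move=> t; exact: cvg_id.
split; first by move=> t; exact: derivable_id.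
rewrite (_ : derive1 _ = cst (1 : R)); first exact: C1k_cst.
by apply/funext => x; rewrite derive1_id.
Qed.

Lemma is_derive_aff (a b : R) t : is_derive t 1 (fun t => a * t + b) a.
Proof.
have H1 := @is_deriveZ R R R id a t 1 1 (is_derive_id t 1).
have H2 := is_deriveD H1 (@is_derive_cst R R R b t 1).
by move: H2; rewrite addr0 [a *: 1]mulr1.
Qed.

Lemma derive1_aff i (a b : R) t : derivable i (a * t + b) 1 ->
  derivable (fun t => i (a * t + b)) t 1 /\
  derive1 (fun t => i (a * t + b)) t = a * derive1 i (a * t + b).
Proof.
move=> di; have [d1 d2] := is_derive_aff a b t.
have e1 := (derivable1_diffP _ _).1 d1; have e2 := (derivable1_diffP _ _).1 di.
split; first exact: ((derivable1_diffP _ _).2 (differentiable_comp e1 e2)).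
by rewrite (derive1_comp d1 di) [X in _ * X]derive1E d2 mulrC.
Qed.

Lemma C1k_aff k i (a b : R) : C1k k i -> C1k k (fun t => i (a * t + b)).
Proof.
elim: k i => [|k IH] i Hi.
  move=> t; apply: (@continuous_comp _ _ _ (fun t => a * t + b)); last exact: Hi.
  have [d _] := is_derive_aff a b t.
  exact: (differentiable_continuous ((derivable1_diffP _ _).1 d)).
have [di Hi'] := Hi; split; first by move=> t; have [] := derive1_aff (di (a * t + b)).
rewrite (_ : derive1 _ = fun t => a * derive1 i (a * t + b)).
  by apply: C1kZ; exact: IH.
by apply/funext => t; have [] := derive1_aff (di (a * t + b)).
Qed.

(** [t^(-m) exp(-1/t)], extended by zero: the derivatives of [exp(-1/t)] are
    combinations of these functions, which therefore are all smooth. *)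
Definition flat m t : R := if 0 < t then t^-1 ^+ m * expR (- t^-1) else 0.

Lemma flat_ge0 m t : 0 <= flat m t.
Proof.
by rewrite /flat; case: ifP => // t0; rewrite mulr_ge0 ?expR_ge0// exprn_ge0// invr_ge0 ltW.
Qed.

Lemma flat_gt0 m t : 0 < t -> 0 < flat m t.
Proof. by move=> t0; rewrite /flat t0 mulr_gt0 ?expR_gt0// exprn_gt0// invr_gt0. Qed.

Lemma flat_le0 m t : t <= 0 -> flat m t = 0.
Proof. by rewrite /flat ltNge => ->. Qed.

(** [exp y >= y^k / k!] at [y = 1/t] bounds [flat m] by any power of [t]. *)
Lemma flat_bound m l t : 0 < t -> flat m t <= (m + l.+1)`!%:R * t ^+ l.+1.
Proof.
move=> t0; rewrite /flat t0.
have s0 : 0 < t^-1 by rewrite invr_gt0.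
have := @expR_ge1Dxn R t^-1 (m + l) (ltW s0).
rewrite -addnS => H.
have H2 : t^-1 ^+ (m + l.+1) / (m + l.+1)`!%:R <= expR t^-1.
  by apply: le_trans H; rewrite lerDr.
have F0 : (0 : R) < (m + l.+1)`!%:R by rewrite ltr0n fact_gt0.
rewrite expRN.
rewrite ler_pdivrMr ?expR_gt0// -ler_pdivrMl; last by rewrite mulr_gt0// exprn_gt0.
apply: le_trans H2; rewrite exprD !exprVn invfM.
by rewrite -[X in X <= _]mulrA [X in X <= _]mulrC [X in X * _ <= _]mulrC.
Qed.

Lemma flat_le1 t : flat 0 t <= 1.
Proof.
rewrite /flat; case: ifP => // t0; rewrite expr0 mul1r expR_le1 oppr_le0 invr_ge0.
exact: ltW.
Qed.

Lemma is_derive_flat m t :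
  is_derive t 1 (flat m) (flat m.+2 t - m%:R * flat m.+1 t).
Proof.
have [t0|t0|t0] := ltgtP t 0.
- rewrite !flat_le0 ?ltW// mulr0 subr0.
  apply: (@near_eq_is_derive _ _ _ (cst 0)).
  near=> s; rewrite flat_le0//; apply: ltW; near: s.
  exact: lt_nbhsl.
- have di : is_derive t 1 (fun t : R => t^-1) (- t^-1 ^+ 2).
    have tn0 : t != 0 by rewrite gt_eqF.
    have d0 : derivable (id : R -> R) t 1 by exact: derivable_id.
    have := @derivableV R R id t 1 tn0 d0.
    have := @deriveV R R id t 1 tn0 d0.
    rewrite derive_id [_ *: 1]mulr1 => E D; split; first exact: D.
    by rewrite exprVn; exact: E.
  pose h (s : R) := s ^+ m * expR (- s).
  have dh s : is_derive s 1 h (m%:R * s ^+ m.-1 * expR (- s) - s ^+ m * expR (- s)).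
    have d1 : is_derive s 1 (fun s : R => s ^+ m) (m%:R * s ^+ m.-1).
      split; first exact: exprn_derivable.
      by rewrite exp_derive [RHS]mulrC /GRing.scale/= mulr1 mulrC.
    have d2 : is_derive s 1 (fun s : R => expR (- s)) (- expR (- s)).
      have de : derivable (@expR R) (-1 * s + 0) 1 by exact: derivable_expR.
      have [e1 e2] := derive1_aff de.
      have E : (fun t : R => expR (-1 * t + 0)) = (fun s => expR (- s)).
        by apply/funext => z; rewrite addr0 mulN1r.
      move: e1 e2; rewrite E => e1 e2; split => //.
      have dE (z : R) : 'D_1 (@expR R) z = expR z.
        exact: (f_equal (fun F => F z) (@derive_expR R)).
      by rewrite -derive1E e2 derive1E dE addr0 !mulN1r.
    have H := is_deriveM d1 d2.
    have E : s ^+ m *: (- expR (- s)) + expR (- s) *: (m%:R * s ^+ m.-1) =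
      m%:R * s ^+ m.-1 * expR (- s) - s ^+ m * expR (- s).
      by rewrite /GRing.scale/= mulrN addrC [expR _ * _]mulrC.
    by rewrite E in H; exact: H.
  apply: (@near_eq_is_derive _ _ _ (h \o (fun t : R => t^-1))).
    near=> s; rewrite /flat /h /= (_ : 0 < s)//; near: s; exact: lt_nbhsr.
  have [d1 e1] := di; have [d2 e2] := dh t^-1.
  split.
    exact: ((derivable1_diffP _ _).2 (differentiable_comp ((derivable1_diffP _ _).1 d1) ((derivable1_diffP _ _).1 d2))).
  rewrite -derive1E (derive1_comp d1 d2) !derive1E e1 e2 /flat t0.
  case: m {h dh d2 e2} => [|m]; rewrite ?mul0r ?sub0r ?mul0r.
    by rewrite subr0 expr0 mul1r mulrNN mulrC.
  by rewrite /= !exprS; ring.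
- rewrite t0 !flat_le0// mulr0 subr0.
  have C : (fun h : R => h^-1 *: ((flat m \o shift 0) (h *: 1) - flat m 0)) @ 0^' --> (0 : R).
    apply/cvgr0Pnorm_le => eps eps0.
    pose C := (m + 2)`!%:R : R.
    have C0 : 0 < C by rewrite ltr0n fact_gt0.
    near=> h; rewrite /= [flat m 0]flat_le0// subr0 addr0 [h *: 1]mulr1.
    have h0 : h != 0 by near: h; exact: nbhs_dnbhs_neq.
    have hd : `|h| < eps / C by near: h; apply: dnbhs0_lt; exact: divr_gt0.
    rewrite normrM normfV.
    have [hp|hn] := ltP 0 h; last by rewrite flat_le0// normr0 mulr0 ltW.
    rewrite (ger0_norm (flat_ge0 _ _)) (gtr0_norm hp).
    rewrite ler_pdivrMl// (le_trans (flat_bound m 1 hp))//.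
    rewrite [h * eps]mulrC expr2 mulrA ler_pM2r// mulrC -ler_pdivlMr//; apply: ltW.
    by rewrite (gtr0_norm hp) in hd.
  split; first by apply/cvg_ex; exists 0.
  exact: cvg_lim C.
Unshelve. all: by end_near. Qed.

Lemma derive1_flat m t : derive1 (flat m) t = flat m.+2 t - m%:R * flat m.+1 t.
Proof. by rewrite derive1E; have [] := is_derive_flat m t. Qed.

Lemma C1k_flat k m : C1k k (flat m).
Proof.
elim: k m => [|k IH] m.
  move=> t; apply: (differentiable_continuous ((derivable1_diffP _ _).1 _)).
  by have [] := is_derive_flat m t.
split; first by move=> t; have [] := is_derive_flat m t.
rewrite (_ : derive1 _ = fun t => flat m.+2 t + (- m%:R) * flat m.+1 t).
  by apply: C1kD => //; exact: C1kZ.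
by apply/funext => t; rewrite derive1_flat mulNr.
Qed.

(** [t exp(-1/t)], flat at zero and with slope [(1 + 1/t) exp(-1/t) <= 1]. *)
Definition ramp t : R := t * flat 0 t.

Lemma C1k_ramp k : C1k k ramp.
Proof. exact: C1kM (C1k_id k) (C1k_flat k 0). Qed.

Lemma ramp_le0 t : t <= 0 -> ramp t = 0.
Proof. by move=> t0; rewrite /ramp flat_le0// mulr0. Qed.

Lemma derive1_ramp t : derive1 ramp t = flat 0 t + flat 1 t.
Proof.
have [d1 e1] := is_derive_flat 0 t.
have H := is_deriveM (is_derive_id t (1 : R)) (is_derive_flat 0 t).
rewrite derive1E; have [_ ->] := H.
rewrite mul0r subr0 /GRing.scale/= mulr1 addrC; congr (_ + _).
rewrite /flat; case: ifP => [t0|_]; last by rewrite mulr0.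
by rewrite mulrA expr2 mulrA divff ?gt_eqF// mul1r expr1.
Qed.

Lemma derive1_ramp_itv t : 0 <= derive1 ramp t <= 1.
Proof.
rewrite derive1_ramp addr_ge0 ?flat_ge0//=.
rewrite /flat; case: ifP => [t0|_]; last by rewrite addr0.
rewrite expr0 mul1r expr1 -{1}[expR _]mul1r -mulrDl expRN ler_pdivrMr ?expR_gt0// mul1r.
exact: expR_ge1Dx.
Qed.

(** The second derivative is [y^3 exp(-y) <= 3!] with [y = 1/t]. *)
Lemma derive1_ramp_lip s t : `|derive1 ramp s - derive1 ramp t| <= 6 * `|s - t|.
Proof.
wlog st : s t / t <= s.
  move=> H; have [st|/ltW st] := leP t s; first exact: H.
  by rewrite distrC [X in _ <= _ * X]distrC; exact: H.
have d (u : R) : is_derive u 1 (derive1 ramp) (flat 3 u).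
  have -> : derive1 ramp = flat 0 \+ flat 1.
    by apply/funext => z; rewrite derive1_ramp.
  have H := is_deriveD (is_derive_flat 0 u) (is_derive_flat 1 u).
  have E : flat 2 u - 0 * flat 1 u + (flat 3 u - 1 * flat 2 u) = flat 3 u by ring.
  by rewrite E in H; exact: H.
have c : {within `[t, s], continuous (derive1 ramp)}.
  by apply: derivable_within_continuous => u _; have [] := d u.
have [c0 _ ->] := MVT_segment st (fun u _ => d u) c.
rewrite normrM ler_wpM2r// ger0_norm ?flat_ge0//.
have [cp|cn] := ltP 0 c0; last by rewrite flat_le0.
have := @expR_ge1Dxn R c0^-1 2; rewrite invr_ge0 ltW// => /(_ isT) H.
rewrite /flat cp expRN ler_pdivrMr ?expR_gt0//.
have F : (3`!%:R : R) = 6 by [].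
rewrite F in H.
have := expR_gt0 c0^-1; lra.
Qed.

(** A smooth even function vanishing on [-d, d], below [|s|] and of slope at
    most one, that tends to [|s|] as [d] tends to zero. *)
Definition softabs (d : R) s : R := d * (ramp (d^-1 * s - 1) + ramp (- d^-1 * s - 1)).

Section softabs.
Variables (d : R) (d0 : 0 < d).

Lemma C1k_softabs k : C1k k (softabs d).
Proof.
apply: C1kZ; apply: C1kD; exact: (C1k_aff _ (-1) (C1k_ramp k)).
Qed.

Lemma softabsN s : softabs d (- s) = softabs d s.
Proof. by rewrite /softabs mulrNN mulrN -mulNr addrC. Qed.

Lemma softabs_eq0 s : `|s| <= d -> softabs d s = 0.
Proof.
rewrite ler_norml => /andP[s1 s2].
rewrite /softabs !ramp_le0 ?addr0 ?mulr0// subr_le0 mulrC.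
  by rewrite mulrN -mulNr ler_pdivrMr// mul1r lerNl.
by rewrite ler_pdivrMr// mul1r.
Qed.

Let softabs_pos s : 0 <= s -> softabs d s = d * ramp (d^-1 * s - 1).
Proof.
move=> s0; rewrite /softabs [X in _ + X]ramp_le0 ?addr0//.
rewrite subr_le0 mulNr (le_trans _ ler01)// oppr_le0 mulr_ge0// invr_ge0 ltW//.
Qed.

Lemma softabs_ge0 s : 0 <= softabs d s.
Proof.
have r t : 0 <= ramp t.
  have [t0|t0] := leP t 0; first by rewrite ramp_le0.
  by rewrite mulr_ge0 ?flat_ge0// ltW.
by rewrite /softabs mulr_ge0 ?addr_ge0// ltW.
Qed.

Lemma softabs_bounds s : `|s| - 2 * d <= softabs d s <= `|s|.
Proof.
wlog s0 : s / 0 <= s.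
  move=> H; have [s0|/ltW s0] := leP 0 s; first exact: H.
  by rewrite -softabsN -[in `|s|]normrN; apply: H; rewrite oppr_ge0.
rewrite ger0_norm//.
have [sd|sd] := leP s d.
  by rewrite softabs_eq0 ?ger0_norm// s0 andbT; lra.
rewrite softabs_pos//.
have t0 : 0 < d^-1 * s - 1 by rewrite subr_gt0 mulrC ltr_pdivlMr// mul1r.
set t := _ - 1 in t0 *.
have E : s = d * (t + 1) by rewrite /t subrK mulrA divff ?mul1r// gt_eqF.
have H1 := flat_le1 t.
have H2 : t - 1 <= ramp t.
  rewrite /ramp /flat t0 expr0 mul1r.
  have := expR_ge1Dx (- t^-1); rewrite -(ler_pM2l t0) mulrDr mulr1 mulrN divff ?gt_eqF//.
apply/andP; split; rewrite E; last by rewrite ler_pM2l// /ramp; nra.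
nra.
Qed.

Lemma derive1_softabs s : derive1 (softabs d) s =
  derive1 ramp (d^-1 * s - 1) - derive1 ramp (- d^-1 * s - 1).
Proof.
have dr t : derivable ramp t 1 by have [] := C1k_ramp 1.
have [d1 e1] := derive1_aff (dr (d^-1 * s - 1)).
have [d2 e2] := derive1_aff (dr (- d^-1 * s - 1)).
have D := derivableD d1 d2; have := deriveD d1 d2.
rewrite -!derive1E e1 e2 derive1E => E.
have := deriveZ d D; rewrite E => EZ; rewrite derive1E; etransitivity; first exact: EZ.
by rewrite /GRing.scale/= mulNr -mulrBr mulrA divff ?mul1r// gt_eqF.
Qed.

Lemma derive1_softabs_le1 s : `|derive1 (softabs d) s| <= 1.
Proof.
rewrite derive1_softabs.
have := derive1_ramp_itv (d^-1 * s - 1); have := derive1_ramp_itv (- d^-1 * s - 1).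
move: (derive1 _ _) (derive1 _ _) => a b.
by move=> /andP[? ?] /andP[? ?]; rewrite ler_norml; apply/andP; split; lra.
Qed.

Lemma derive1_softabs_lip s t :
  `|derive1 (softabs d) s - derive1 (softabs d) t| <= 12 / d * `|s - t|.
Proof.
rewrite !derive1_softabs.
have := derive1_ramp_lip (d^-1 * s - 1) (d^-1 * t - 1).
have := derive1_ramp_lip (- d^-1 * s - 1) (- d^-1 * t - 1).
have E1 : d^-1 * s - 1 - (d^-1 * t - 1) = d^-1 * (s - t) by ring.
have E2 : - d^-1 * s - 1 - (- d^-1 * t - 1) = - (d^-1 * (s - t)) by ring.
rewrite E1 E2 normrN normrM gtr0_norm ?invr_gt0// => H1 H2.
set a := derive1 _ _ in H2 *; set b := derive1 _ _ in H1 *.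
set a' := derive1 _ _ in H2 *; set b' := derive1 _ _ in H1 *.
rewrite (_ : a - b - (a' - b') = (a - a') - (b - b')); last by ring.
apply: le_trans (ler_normB _ _) _; apply: le_trans (lerD H2 H1) _.
by rewrite le_eqVlt; apply/orP; left; apply/eqP; ring.
Qed.

End softabs.

End flat.

(** * Test functions and cut-offs *)

Section toolkit.
Context {R : realType}.

Lemma C1kV k (i : R -> R) : (forall t, i t != 0) -> C1k k i -> C1k k (fun t => (i t)^-1).
Proof.
move=> i0; elim: k => [|k IH] Hi.
  by move=> t; apply: continuousV; [exact: i0|exact: Hi].
have [di Hi'] := Hi; split; first by move=> t; apply: derivableV.
rewrite (_ : derive1 _ = fun t => - 1 * (derive1 i t * ((i t)^-1 * (i t)^-1))).
  by apply: C1kZ; apply: C1kM => //; apply: C1kM; apply: IH; exact: C1kW.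
apply/funext => t; rewrite derive1E; etransitivity; first exact: (deriveV (i0 t) (di t)).
by rewrite /GRing.scale/= derive1E -expr2 exprVn mulNr mul1r mulNr mulrC.
Qed.

(** A smooth step from 0 (for [t <= 0]) to 1 (for [1 <= t]). *)
Definition step (t : R) : R := flat 0 t * (flat 0 t + flat 0 (-1 * t + 1))^-1.

Let step_den t : 0 < flat 0 t + flat 0 (-1 * t + 1) :> R.
Proof.
have [t0|t0] := ltP 0 t; first by rewrite ltr_pwDl ?flat_gt0 ?flat_ge0.
by rewrite ltr_wpDl ?flat_ge0// flat_gt0// mulN1r; lra.
Qed.

Lemma C1k_step k : C1k k step.
Proof.
apply: C1kM; first exact: C1k_flat.
apply: C1kV; first by move=> t; rewrite gt_eqF.
by apply: C1kD; [exact: C1k_flat|exact: C1k_aff (C1k_flat _ _)].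
Qed.

Lemma step_itv t : 0 <= step t <= 1.
Proof.
rewrite /step mulr_ge0 ?flat_ge0 ?invr_ge0 ?(ltW (step_den _))//=.
by rewrite ler_pdivrMr// mul1r lerDl flat_ge0.
Qed.

Lemma step_le0 t : t <= 0 -> step t = 0.
Proof. by move=> t0; rewrite /step flat_le0// mul0r. Qed.

Lemma step_ge1 t : 1 <= t -> step t = 1.
Proof.
move=> t1; rewrite /step [X in _ + X]flat_le0 ?addr0; last by rewrite mulN1r; lra.
by rewrite divff// gt_eqF// flat_gt0//; lra.
Qed.

Context {n : nat}.
Notation V := 'rV[R]_n.
Notation mu := (@leb R n).
Notation e_ i := (delta_mx ord0 i : V).
Implicit Types (f g : V -> R) (x y v : V).

Lemma rV_norm_le x (M : R) : 0 <= M -> `|x| <= M <-> forall i, `|x ord0 i| <= M.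
Proof.
move=> M0; rewrite /Num.norm/= mx_normrE; split=> [/bigmax_leP[_ H] i|H].
  exact: (H (ord0, i)).
by apply/bigmax_leP; split=> // -[i j] _ /=; rewrite (ord1 i); exact: H.
Qed.

Lemma rV_coord_le x i : `|x ord0 i| <= `|x|.
Proof. exact: (rV_norm_le x (normr_ge0 _)).1. Qed.

Lemma norm_delta i : `|e_ i| <= 1.
Proof.
apply/(rV_norm_le _ ler01) => j; rewrite mxE eqxx/=; case: (_ == _); rewrite ?normr1 ?normr0//.
Qed.

Definition cube (M : R) : set V := [set x | `|x| <= M].

Lemma closed_cube M : closed (cube M).
Proof.
rewrite (_ : cube M = (fun y : V => `|y|) @^-1` [set t | t <= M])//.
by apply: closed_comp; [move=> y _; exact: norm_continuous|exact: closed_le].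
Qed.

Lemma compact_cube M : compact (cube M).
Proof.
apply: bounded_closed_compact; last exact: closed_cube.
exists M; split; first exact: num_real.
by move=> M' MM' x /le_trans; apply; exact: ltW.
Qed.

Arguments compact_cube M : clear implicits.

Lemma measurable_cube M : measurable (cube M).
Proof. by apply: closed_measurable_rV; exact: closed_cube. Qed.

Lemma leb_cube_lty M : (mu (cube M) < +oo)%E.
Proof.
have [M0|M0] := leP 0 M; last first.
  rewrite (_ : cube M = set0) ?measure0//; apply/seteqP; split=> // x; rewrite /cube /=.
  by move=> h; have := le_lt_trans h M0; rewrite normr_lt0.
have -> : cube M = [set x : V | forall i, `[-M, M]%classic (x ord0 i)].
  apply/seteqP; split=> x; rewrite /cube /=.
    by move=> /(rV_norm_le _ M0) H i; have := H i; rewrite in_itv/= ler_norml.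
  by move=> H; apply/(rV_norm_le _ M0) => i; have := H i; rewrite in_itv/= ler_norml.
rewrite (leb_box (A := fun=> `[-M, M]%classic))//.
suff : (0 <= \prod_(i < n) (lebesgue_measure `[(- M)%R, M]) < +oo)%E.
  by move=> /andP[].
elim/big_ind : _ => //.
- by rewrite lee01 ltry.
- move=> a b /andP[a0 ha] /andP[b0 hb]; rewrite mule_ge0//=.
  by apply: lte_mul_pinfty => //; rewrite ge0_fin_numE.
- move=> i _; rewrite measure_ge0 lebesgue_measure_itv/=; case: ifP => _; last by rewrite ltry.
  by rewrite -EFinB ltry.
Qed.

Lemma integrable_cube M : mu.-integrable setT (EFin \o \1_(cube M)).
Proof.
apply/integrableP; split.
  by apply/measurable_EFinP; apply: measurable_indic; exact: measurable_cube.
under eq_integral do rewrite /= ger0_norm//.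
rewrite integral_indic//; last exact: measurable_cube.
by rewrite setIT; exact: leb_cube_lty.
Qed.

Lemma integrable_bounded_support f (C M : R) : measurable_fun setT f ->
  (forall x, `|f x| <= C) -> (forall x, M < `|x| -> f x = 0) ->
  mu.-integrable setT (EFin \o f).
Proof.
move=> mf fC fM.
have C0 : 0 <= C by apply: le_trans (fC 0).
apply: (@le_integrable _ _ _ mu setT measurableT _ (EFin \o (fun x => C * \1_(cube M) x))).
- exact/measurable_EFinP.
- move=> x _; rewrite /= lee_fin [X in _ <= X]ger0_norm ?mulr_ge0// indicE.
  have [xM|xM] := leP `|x| M; last by rewrite fM// normr0 mulr_ge0.
  by rewrite mem_set// mulr1.
apply: (eq_integrable measurableT (fun x => C%:E * (\1_(cube M) x)%:E)%E); first by [].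
exact: integrableZl (integrable_cube M).
Qed.

Lemma bounded_on_cube f M : continuous f -> exists2 C, 0 <= C & forall x, `|x| <= M -> `|f x| <= C.
Proof.
move=> cf; have cc : compact ((fun x => `|f x|) @` cube M).
  apply: continuous_compact; last exact: compact_cube.
  apply: continuous_subspaceT => x.
  by apply: (@continuous_comp _ _ _ f (fun t => `|t|)); [exact: cf|exact: norm_continuous].
have [C [Cr HC]] := compact_bounded cc.
exists (`|C| + 1); first by rewrite addr_ge0.
move=> x xM; rewrite -[X in X <= _]normr_id; apply: HC; last by exists x.
by rewrite (le_lt_trans (ler_norm C))// ltrDl.
Qed.

Lemma test_smooth f : test_fun f -> smooth f.
Proof. by case. Qed.

Lemma test_continuous f : test_fun f -> continuous f.
Proof. by move=> /test_smooth/smooth_continuous. Qed.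

Lemma smooth_measurable f : smooth f -> measurable_fun setT f.
Proof. by move=> /smooth_continuous; exact: continuous_measurable_rV. Qed.

Lemma test_measurable f : test_fun f -> measurable_fun setT f.
Proof. by move=> /test_continuous; exact: continuous_measurable_rV. Qed.

Lemma test_support f : test_fun f -> exists2 M, 0 <= M & forall x, M < `|x| -> f x = 0.
Proof.
move=> /test_funP[_ [M HM]]; exists (Num.max M 0); first by rewrite le_max lexx orbT.
move=> x xM; apply/eqP; apply: contraTT xM => /HM xM.
by rewrite -leNgt le_max xM.
Qed.

Lemma test_intro f M : smooth f -> (forall x, M < `|x| -> f x = 0) -> test_fun f.
Proof.
move=> sf H; apply/test_funP; split=> //; exists M => x fx.
by rewrite leNgt; apply: contra fx => xM; rewrite H.
Qed.

Lemma test_bounded f : test_fun f -> exists2 C, 0 <= C & forall x, `|f x| <= C.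
Proof.
move=> tf; have [M M0 HM] := test_support tf.
have [C C0 HC] := bounded_on_cube M (test_continuous tf).
exists C => // x; have [xM|xM] := leP `|x| M; first exact: HC.
by rewrite HM// normr0.
Qed.

Lemma near_norm_gt x M : M < `|x| -> \forall y \near x, M < `|y|.
Proof.
move=> xM.
have : open ((fun y : V => `|y|) @^-1` [set t | M < t]).
  by apply: open_comp; [move=> y _; exact: norm_continuous|exact: open_gt].
move=> o; exact: (open_nbhs_nbhs (conj o xM)).
Qed.

Lemma partial_support f M i : (forall x, M < `|x| -> f x = 0) ->
  forall x, M < `|x| -> partial i f x = 0.
Proof.
move=> H x xM; rewrite (@partial_local _ _ f (cst 0)); first exact: derive_cst.
by apply: filterS (near_norm_gt xM) => y; exact: H.
Qed.

Lemma test_partial f i : test_fun f -> test_fun (partial i f).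
Proof.
move=> tf; have [M _ HM] := test_support tf.
apply: (test_intro (M := M)); last exact: partial_support.
exact/smooth_partial/test_smooth.
Qed.

Lemma testM f g : smooth f -> test_fun g -> test_fun (fun x => f x * g x).
Proof.
move=> sf tg; have [M _ HM] := test_support tg.
apply: (test_intro (M := M)); last by move=> x /HM ->; rewrite mulr0.
exact: smoothM sf (test_smooth tg).
Qed.

Lemma testZ (c : R) f : test_fun f -> test_fun (fun x => c * f x).
Proof. by move=> tf; exact: testM (smooth_cst c) tf. Qed.

(** A product of one-dimensional cut-offs in the coordinates. *)
Lemma plateau M : 0 <= M -> exists chi, [/\ test_fun chi,
  (forall x, 0 <= chi x <= 1) & forall x, `|x| <= M -> chi x = 1].
Proof.
move=> M0; pose P (t : R) := step (-1 * t + (M + 1)) * step (1 * t + (M + 1)).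
have sP k : C1k k P by apply: C1kM; exact: C1k_aff (C1k_step k).
have P01 t : 0 <= P t <= 1.
  have /andP[a0 a1] := step_itv (-1 * t + (M + 1)).
  have /andP[b0 b1] := step_itv (1 * t + (M + 1)).
  by rewrite /P mulr_ge0//= mulr_ile1.
exists (fun x : V => \prod_(i <- index_enum 'I_n) P (x ord0 i)); split.
- apply: (test_intro (M := M + 1)).
    by apply: smooth_prod => i; apply: (smooth_comp sP); exact: smooth_coord.
  move=> x xM.
  have [i xi] : exists i, M + 1 < `|x ord0 i|.
    apply: contrapT => H; move: xM; apply/negP; rewrite -leNgt.
    apply/rV_norm_le; first by rewrite addr_ge0.
    by move=> i; rewrite leNgt; apply/negP => Hi; apply: H; exists i.
  rewrite (bigD1 i)//=; rewrite (_ : P _ = 0) ?mul0r//.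
  rewrite /P; have [x0|x0] := leP 0 (x ord0 i).
    by rewrite [step (-1 * _ + _)]step_le0 ?mul0r// mulN1r; rewrite ger0_norm// in xi; lra.
  by rewrite [step (1 * _ + _)]step_le0 ?mulr0// mul1r; rewrite ltr0_norm// in xi; lra.
- move=> x; elim/big_ind : _ => //; first by rewrite ler01 lexx.
  by move=> a b /andP[? ?] /andP[? ?]; rewrite mulr_ge0//= mulr_ile1.
- move=> x /(rV_norm_le _ M0) H; rewrite big1// => i _.
  have := H i; rewrite ler_norml => /andP[? ?].
  by rewrite /P !step_ge1 ?mulr1// ?mulN1r ?mul1r; lra.
Qed.

Lemma integrable_test f : test_fun f -> mu.-integrable setT (EFin \o f).
Proof.
move=> tf; have [M _ HM] := test_support tf; have [C _ HC] := test_bounded tf.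
exact: integrable_bounded_support (test_measurable tf) HC HM.
Qed.

Lemma integrable_continuous_test f g : continuous f -> test_fun g ->
  mu.-integrable setT (EFin \o (fun x => f x * g x)).
Proof.
move=> cf tg; have [M _ HM] := test_support tg; have [C C0 HC] := test_bounded tg.
have [D D0 HD] := bounded_on_cube M cf.
apply: (@integrable_bounded_support _ (D * C) M).
- apply: measurable_funM; [exact: continuous_measurable_rV|exact: test_measurable].
- move=> x; have [xM|xM] := leP `|x| M; last by rewrite HM// mulr0 normr0 mulr_ge0.
  by rewrite normrM ler_pM// HD.
- by move=> x /HM ->; rewrite mulr0.
Qed.

Lemma integrable_L1loc_test f g : L1loc f -> test_fun g ->
  mu.-integrable setT (EFin \o (fun x => f x * g x)).
Proof.
move=> [mf fl] tg; have [M _ HM] := test_support tg; have [C C0 HC] := test_bounded tg.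
have i1 : mu.-integrable (cube M) (EFin \o f).
  apply/integrableP; split.
    by apply/measurable_EFinP; apply: measurable_funS mf.
  have h := fl _ (compact_cube M).
  exact: h.
have i2 : mu.-integrable setT ((EFin \o f) \_ (cube M)).
  exact: ((integrable_mkcond _ (measurable_cube M)).1 i1).
have i3 := integrableZl measurableT C i2.
apply: (le_integrable measurableT _ _ i3).
  by apply/measurable_EFinP; apply: measurable_funM => //; exact: test_measurable.
move=> x _ /=; rewrite patchE.
have [xM|xM] := leP `|x| M; last by rewrite HM// mulr0 normr0 abse_ge0.
rewrite (mem_set (xM : cube M x)) /= lee_fin !normrM mulrC ler_wpM2r// (le_trans (HC _))//.
exact: ler_norm.
Qed.

Lemma L1loc_continuous f : continuous f -> L1loc f.
Proof.
move=> cf; split; first exact: continuous_measurable_rV.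
move=> K cK; have [M [Mr HM]] := compact_bounded cK.
have [C C0 HC] := bounded_on_cube (M + 1) cf.
have mK : measurable K by apply: closed_measurable_rV; apply: compact_closed => //; exact: norm_hausdorff.
have KM : K `<=` cube (M + 1) by move=> x Kx; apply: (HM (M + 1)) => //; rewrite ltrDl.
have H : (\int[mu]_(x in K) `|f x|%:E <= \int[mu]_(x in K) (cst C%:E) x)%E.
  apply: ge0_le_integral => //.
    apply/measurable_EFinP; apply: measurableT_comp => //.
    by apply: measurable_funTS; exact: continuous_measurable_rV.
  by move=> x Kx; rewrite lee_fin; apply: HC; exact: KM.
apply: (le_lt_trans H); rewrite integral_cst//.
apply: lte_mul_pinfty => //; apply: le_lt_trans (leb_cube_lty (M + 1)).
by apply: le_measure => //; rewrite inE//; exact: measurable_cube.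
Qed.

Lemma integral_mpres (T : V -> V) (f : V -> \bar R) : measurable_fun setT T ->
  (forall A, measurable A -> mu (T @^-1` A) = mu A) -> measurable_fun setT f ->
  (\int[mu]_x f (T x) = \int[mu]_x f x)%E.
Proof.
move=> mT HT mf.
have H (g : V -> \bar R) : measurable_fun setT g -> (forall x, (0 <= g x)%E) ->
    (\int[mu]_x g (T x) = \int[mu]_x g x)%E.
  move=> mg g0.
  transitivity (\int[pushforward mu T]_x g x)%E.
    by rewrite ge0_integral_pushforward.
  by apply: eq_measure_integral => A mA _; exact: HT.
rewrite integralE [RHS]integralE; congr (_ - _)%E.
  have mp : measurable_fun setT (f^\+)%E by exact: measurable_funepos.
  have p0 x : (0 <= f^\+ x)%E by exact: funepos_ge0.
  by rewrite -(H _ mp p0); apply: eq_integral => x _; rewrite !funeposE.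
have mp : measurable_fun setT (f^\-)%E by exact: measurable_funeneg.
have p0 x : (0 <= f^\- x)%E by exact: funeneg_ge0.
by rewrite -(H _ mp p0); apply: eq_integral => x _; rewrite !funenegE.
Qed.

Lemma integral_shift (a : V) (f : V -> \bar R) : measurable_fun setT f ->
  (\int[mu]_x f (x + a)%R = \int[mu]_x f x)%E.
Proof.
move=> mf; apply: (integral_mpres (T := fun x => x + a)) => //.
  by apply: measurable_rV_add => //; exact: measurable_cst.
by move=> A mA; exact: leb_shift.
Qed.

End toolkit.

(** * Weak gradients *)

Section weak_gradients.
Context {R : realType}.

Section dominated.
Context d (T : measurableType d) (mu : {measure set T -> \bar R}).

Lemma Rintegral_dominated_cvg (F : nat -> T -> R) (f g : T -> R) :
  (forall k, measurable_fun setT (F k)) ->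
  (forall x, F k x @[k --> \oo] --> f x) ->
  mu.-integrable setT (EFin \o g) ->
  (forall k x, `|F k x| <= g x) ->
  \int[mu]_x F k x @[k --> \oo] --> \int[mu]_x f x.
Proof.
move=> mF Ff ig Fg.
have mF' k : measurable_fun setT (EFin \o F k) by exact/measurable_EFinP.
have Ff' x : setT x -> (EFin \o F k) x @[k --> \oo] --> (EFin \o f) x.
  by move=> _; apply: cvg_EFin; [near=> k|exact: Ff].
have Fg' k x : setT x -> (`|(EFin \o F k) x| <= (EFin \o g) x)%E by move=> _; rewrite lee_fin.
have mf : measurable_fun setT (EFin \o f).
  by apply: (emeasurable_fun_cvg (fun k => EFin \o F k)).
have if' : mu.-integrable setT (EFin \o f).
  apply: (le_integrable measurableT mf _ ig) => x _ /=.
  rewrite lee_fin (le_trans _ (ler_norm _))//.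
  have c : `|F k x| @[k --> \oo] --> `|f x| by apply: cvg_norm; exact: Ff.
  rewrite -(cvg_lim _ c)//; apply: limr_le; first by apply/cvg_ex; exists `|f x|.
  by near=> k; exact: Fg.
have := @dominated_cvg _ _ _ mu setT measurableT _ (EFin \o f) (EFin \o g) mF' Ff' _ ig Fg'.
move=> /(_ (fun=> fun=> isT)) H.
apply: fine_cvg; rewrite fineK; first exact: H.
exact: (integrable_fin_num measurableT if').
Unshelve. all: by end_near. Qed.

Lemma integral_small (F : nat -> T -> R) (g : T -> R) (e : R) : 0 < e ->
  (forall k, measurable_fun setT (F k)) ->
  (forall x, F k x @[k --> \oo] --> 0) ->
  mu.-integrable setT (EFin \o g) ->
  (forall k x, 0 <= F k x <= g x) ->
  exists k, (\int[mu]_x (F k x)%:E < e%:E)%E.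
Proof.
move=> e0 mF F0 ig Fg.
have := @Rintegral_dominated_cvg F (cst 0) g mF F0 ig.
have Fn k x : `|F k x| <= g x by have /andP[? ?] := Fg k x; rewrite ger0_norm.
move=> /(_ Fn); rewrite [X in _ --> X](_ : _ = 0); last first.
  by rewrite /Rintegral integral0_eq.
move=> /cvgrPdist_lt/(_ _ e0)[k _ /(_ k (leqnn _))].
rewrite sub0r normrN => H; exists k.
have iF : mu.-integrable setT (EFin \o F k).
  apply: (le_integrable measurableT _ _ ig); first exact/measurable_EFinP.
  by move=> x _ /=; rewrite lee_fin (le_trans (Fn k x))// ler_norm.
rewrite -(fineK (integrable_fin_num measurableT iF)) lte_fin.
exact: le_lt_trans (ler_norm _) H.
Qed.

End dominated.

Context {n : nat}.
Notation V := 'rV[R]_n.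
Notation mu := (@leb R n).
Notation e_ i := (delta_mx ord0 i : V).
Implicit Types (f g u : V -> R) (G H : V -> V) (x y v : V).

Lemma cvg_inv_succ_dnbhs : (fun k : nat => (k.+1%:R^-1 : R)) @ \oo --> 0^'.
Proof.
move=> A /= HA; have H := @cvg_harmonic R _ HA.
have {}H : \oo [set k : nat | (harmonic k : R) != 0 -> A (harmonic k)] := H.
by apply: filterS H => k; apply; rewrite /harmonic invr_neq0.
Qed.

(** The mean value theorem bounds the difference quotients of [zeta] by the
    supremum of its partial derivative, so dominated convergence applies. *)
Lemma diffquot_cvg u zeta i : continuous u -> test_fun zeta ->
  \int[mu]_x (u x * (k.+1%:R * (zeta (k.+1%:R^-1 *: e_ i + x) - zeta x))) @[k --> \oo]
  --> \int[mu]_x (u x * partial i zeta x).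
Proof.
move=> cu tz; have sz := test_smooth tz.
have [M M0 HM] := test_support tz.
have [C C0 HC] := test_bounded (test_partial i tz).
have [D D0 HD] := bounded_on_cube (M + 1) cu.
have quot k x : `|k.+1%:R * (zeta (k.+1%:R^-1 *: e_ i + x) - zeta x)| <= C.
  have [xi _ ->] := @mvt_line R n zeta x (e_ i) (k.+1%:R^-1) (fun t => @smooth_derivable _ _ zeta i _ sz).
  by rewrite mulrA divff// mul1r; exact: HC.
apply: (Rintegral_dominated_cvg (g := fun x => D * C * \1_(cube (M + 1)) x)).
- move=> k; apply: measurable_funM; first exact: continuous_measurable_rV.
  apply: measurable_funM => //; apply: measurable_funB; last exact: test_measurable.
  apply: measurableT_comp; first exact: test_measurable.
  by apply: measurable_rV_add => //; exact: measurable_cst.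
- move=> x; apply: cvgM; first exact: cvg_cst.
  have d : derivable zeta x (e_ i) by exact: smooth_derivable.
  have := cvg_comp _ _ cvg_inv_succ_dnbhs d.
  apply: cvg_trans; apply: near_eq_cvg; near=> k.
  by rewrite /= invrK.
- exact: integrableZl (integrable_cube (M + 1)).
- move=> k x; rewrite indicE; have [xM|xM] := leP `|x| (M + 1).
    rewrite (mem_set (xM : cube (M + 1) x)) mulr1 normrM ler_pM//; exact: HD.
  rewrite [zeta (_ + _)]HM ?[zeta x]HM ?subr0 ?mulr0 ?normr0 ?mulr_ge0//.
    by apply: lt_trans xM; rewrite ltrDl.
  have h1 : `|k.+1%:R^-1 *: e_ i| <= 1.
    rewrite normrZ ger0_norm ?invr_ge0//; apply: mulr_ile1 => //; last exact: norm_delta.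
    by rewrite invf_le1// ler1n.
  have := ler_normB (k.+1%:R^-1 *: e_ i + x) (k.+1%:R^-1 *: e_ i).
  rewrite addrAC subrr add0r => h2.
  move: h1 h2 xM; move: `|k.+1%:R^-1 *: e_ i| `|_ + x| `|x| => a b c; lra.
Unshelve. all: by end_near. Qed.

Lemma Rintegral_shift (a : V) f : measurable_fun setT f ->
  \int[mu]_x f (x + a) = \int[mu]_x f x.
Proof.
move=> mf; rewrite /Rintegral; congr fine.
by apply: (@integral_shift _ _ a (EFin \o f)); exact/measurable_EFinP.
Qed.

Lemma test_shift a f : test_fun f -> test_fun (fun x => f (x + a)).
Proof.
move=> tf; have [M M0 HM] := test_support tf.
apply: (test_intro (M := M + `|a|)).
  apply/smoothP => k; apply: (@Ck_affine _ _ k (fun x => x + a) (fun i => e_ i)).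
  - by move=> x; exact: (@continuousD _ _ _ id (cst a) x (@cvg_id _ _) (@cst_continuous _ _ a x)).
  - by move=> i h x; rewrite addrA.
  - exact: ((smoothP _).1 (test_smooth tf)).
move=> x xM; apply: HM; have := ler_normB (x + a) a; rewrite addrK => h2.
move: h2 xM; move: `|_ + a| `|x| `|a| => b c e; lra.
Qed.

(** The integrals of the difference quotients vanish by translation invariance. *)
Lemma integral_partial0 zeta i : test_fun zeta -> \int[mu]_x partial i zeta x = 0.
Proof.
move=> tz; have := @diffquot_cvg (cst 1) zeta i (@cst_continuous _ _ _) tz.
rewrite (_ : (fun k => _) = cst 0); last first.
  apply/funext => k; rewrite /= (_ : (fun x : V => _) =
     (fun x => k.+1%:R * (zeta (x + k.+1%:R^-1 *: e_ i) - zeta x))); last first.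
    by apply/funext => x; rewrite mul1r [_ *: _ + _]addrC.
  have i1 := integrable_test (test_shift (k.+1%:R^-1 *: e_ i) tz).
  have i2 := integrable_test tz.
  rewrite RintegralZl//; last exact: (integrableB measurableT i1 i2).
  by rewrite RintegralB// Rintegral_shift ?subrr ?mulr0//; exact: test_measurable.
move=> H; have := cvg_lim (@Rhausdorff R) H; rewrite lim_cst//.
by move=> ->; apply: eq_Rintegral => x _; rewrite mul1r.
Qed.

Lemma integration_by_parts_test f phi i : smooth f -> test_fun phi ->
  \int[mu]_x (f x * partial i phi x) = - \int[mu]_x (partial i f x * phi x).
Proof.
move=> sf tp; have := integral_partial0 i (testM sf tp).
have i1 := integrable_test (testM sf (test_partial i tp)).
have i2 := integrable_test (testM (smooth_partial i sf) tp).
rewrite (_ : (fun x => partial i _ x) =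
  (fun x => f x * partial i phi x + partial i f x * phi x)); last first.
  by apply/funext => x; rewrite partialM//; [rewrite [phi x * _]mulrC|exact: test_smooth].
by rewrite RintegralD// => /eqP; rewrite addr_eq0 => /eqP.
Qed.

Lemma smooth_is_weak_grad f : smooth f -> is_weak_grad f (grad f).
Proof.
move=> sf; split.
- exact/L1loc_continuous/smooth_continuous.
- move=> i; rewrite (_ : (fun x => _) = partial i f).
    exact/L1loc_continuous/smooth_continuous/smooth_partial.
  by apply/funext => x; rewrite mxE.
- move=> phi i tp; rewrite integration_by_parts_test//.
  by congr (- _); apply: eq_Rintegral => x _; rewrite mxE.
Qed.

Section approximation.
Variables (w : V -> R) (w0 : forall x, 0 <= w x).
Hypothesis iw : mu.-integrable setT (EFin \o w).

Let mw : measurable_fun setT w.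
Proof. by apply/measurable_EFinP; exact: measurable_int iw. Qed.

(** Sets whose indicator is, in [L^1(w dx)], a limit of smooth functions with
    values in [[0, 1]].  They form a sigma-algebra containing the coordinate half
    spaces, hence are all the measurable sets. *)
Definition smoothable : set (set V) := [set A | measurable A /\
  forall e : R, 0 < e -> exists phi, [/\ smooth phi, forall x, 0 <= phi x <= 1 &
    (\int[mu]_x (w x * `|\1_A x - phi x|)%:E < e%:E)%E]].

Let mwd (A : set V) phi : measurable A -> smooth phi ->
  measurable_fun setT (fun x => (w x * `|\1_A x - phi x|)%:E).
Proof.
move=> mA sp; apply/measurable_EFinP; apply: measurable_funM => //.
apply: measurableT_comp => //; apply: measurable_funB => //.
exact: smooth_measurable.
Qed.

Lemma smoothable_limit (A : nat -> set V) (B : set V) : measurable B ->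
  (forall k, smoothable (A k)) ->
  (forall x, exists k0, forall k, (k0 <= k)%N -> A k x <-> B x) -> smoothable B.
Proof.
move=> mB sA AB; split=> // e e0; have e20 : 0 < e / 2 by rewrite divr_gt0.
pose F k x := w x * `|\1_(A k) x - \1_B x|.
have mF k : measurable_fun setT (F k).
  have [mA _] := sA k.
  apply: measurable_funM => //; apply: measurableT_comp => //.
  by apply: measurable_funB.
have F0 x : F k x @[k --> \oo] --> 0.
  have [k0 Hk] := AB x; rewrite -(cvg_shiftn k0) /=.
  rewrite (_ : (fun k => _) = cst 0); first exact: cvg_cst.
  apply/funext => k; rewrite /F /= !indicE.
  have H := Hk (k + k0)%N (leq_addl _ _).
  rewrite (_ : (x \in A _) = (x \in B)) ?subrr ?normr0 ?mulr0//.
  by apply/idP/idP; rewrite !inE => /H.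
have Fg k x : 0 <= F k x <= w x.
  rewrite /F mulr_ge0//= ler_piMr// !indicE.
  by case: (_ \in _); case: (_ \in _); rewrite ?subrr ?normr0 ?subr0 ?normr1 ?sub0r ?normrN ?normr1.
have [k Hk] := integral_small e20 mF F0 iw Fg.
have [mA /(_ _ e20)[phi [sp p01 Hp]]] := sA k.
exists phi; split=> //.
apply: (@le_lt_trans _ _ (\int[mu]_x ((F k x)%:E + (w x * `|\1_(A k) x - phi x|)%:E))%E).
  apply: ge0_le_integral => //.
  - by move=> x _; rewrite lee_fin mulr_ge0.
  - exact: mwd.
  - by apply: emeasurable_funD; [exact/measurable_EFinP|exact: mwd].
  - move=> x _; rewrite -EFinD lee_fin /F -mulrDr ler_wpM2l//.
    rewrite [X in _ <= X + _]distrC.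
    have := ler_normD (\1_B x - \1_(A k) x : R) (\1_(A k) x - phi x).
    by rewrite addrA subrK.
rewrite ge0_integralD//.
- by rewrite [e]splitr EFinD; apply: lteD.
- by move=> x _; rewrite lee_fin; have /andP[] := Fg k x.
- exact/measurable_EFinP.
- by move=> x _; rewrite lee_fin mulr_ge0.
- exact: mwd.
Qed.

Lemma smoothableT : smoothable setT.
Proof.
split=> // e e0; exists (cst 1); split; first exact: smooth_cst.
  by move=> x; rewrite /= ler01 lexx.
rewrite integral0_eq ?lte_fin// => x _.
by rewrite indicE mem_set//= subrr normr0 mulr0.
Qed.

Lemma smoothableC A : smoothable A -> smoothable (~` A).
Proof.
move=> [mA HA]; split=> [|e e0]; first exact: measurableC.
have [phi [sp p01 Hp]] := HA _ e0.
exists (fun x => 1 + - phi x); split.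
- exact: smoothD (smooth_cst 1) (smoothN sp).
- by move=> x; have /andP[? ?] := p01 x; apply/andP; split; lra.
- apply: le_lt_trans Hp; rewrite (_ : (\int[mu]_x _)%E = (\int[mu]_x (w x * `|\1_A x - phi x|)%:E)%E)//.
  apply: eq_integral => x _; rewrite indicC /= -[in RHS]normrN; congr (_ * `|_|)%:E.
  by rewrite indicE; case: (_ \in _) => /=; ring.
Qed.

Lemma smoothableU A B : smoothable A -> smoothable B -> smoothable (A `|` B).
Proof.
move=> [mA HA] [mB HB]; split=> [|e e0]; first exact: measurableU.
have e20 : 0 < e / 2 by rewrite divr_gt0.
have [phi [sp p01 Hp]] := HA _ e20; have [psi [sq q01 Hq]] := HB _ e20.
exists (fun x => 1 + - ((1 + - phi x) * (1 + - psi x))); split.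
- apply: smoothD (smooth_cst 1) (smoothN _).
  by apply: smoothM; apply: smoothD (smooth_cst 1) (smoothN _).
- move=> x; have /andP[? ?] := p01 x; have /andP[? ?] := q01 x.
  by apply/andP; split; nra.
- apply: (@le_lt_trans _ _ (\int[mu]_x ((w x * `|\1_A x - phi x|)%:E + (w x * `|\1_B x - psi x|)%:E))%E).
    have mU := measurableU _ _ mA mB.
    apply: ge0_le_integral => //.
    + by move=> x _; rewrite lee_fin mulr_ge0.
    + apply: mwd => //; apply: smoothD (smooth_cst 1) (smoothN _).
      by apply: smoothM; apply: smoothD (smooth_cst 1) (smoothN _).
    + by apply: emeasurable_funD; exact: mwd.
    + move=> x _; rewrite -EFinD lee_fin -mulrDr ler_wpM2l//.
      have /andP[a0 a1] := p01 x; have /andP[b0 b1] := q01 x.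
      rewrite !indicE in_setU.
      move: (phi x) (psi x) a0 a1 b0 b1 => a b a0 a1 b0 b1.
      case: (x \in A); case: (x \in B) => /=.
      * rewrite !ger0_norm; [nra|lra|lra|nra].
      * rewrite [X in _ <= _ + X]ler0_norm ?[X in _ <= X + _]ger0_norm ?[X in X <= _]ger0_norm; [nra|nra|lra|lra].
      * rewrite [X in _ <= X + _]ler0_norm ?[X in _ <= _ + X]ger0_norm ?[X in X <= _]ger0_norm; [nra|nra|lra|lra].
      * rewrite !ler0_norm; [nra|lra|lra|nra].
  rewrite ge0_integralD//.
  + by rewrite [e]splitr EFinD; apply: lteD.
  + by move=> x _; rewrite lee_fin mulr_ge0.
  + exact: mwd.
  + by move=> x _; rewrite lee_fin mulr_ge0.
  + exact: mwd.
Qed.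

Lemma smoothable_bigcup (F : nat -> set V) : (forall k, smoothable (F k)) ->
  smoothable (\bigcup_k F k).
Proof.
move=> HF; pose A k := \big[setU/set0]_(i < k) F i.
have sA k : smoothable (A k).
  rewrite /A; elim/big_ind : _ => //.
    by rewrite -setCT; apply: smoothableC; exact: smoothableT.
  exact: smoothableU.
apply: (smoothable_limit (A := A)) => //.
  by apply: bigcup_measurable => k _; have [] := HF k.
move=> x; have [[k0 _ Hx]|Hx] := pselect ((\bigcup_k F k) x).
  exists k0.+1 => k k0k; split=> // _; first by exists k0.
  by rewrite /A -bigcup_mkord; exists k0.
exists 0%N => k _; split=> //; rewrite /A -bigcup_mkord => -[i _ Hi].
by exists i.
Qed.

Lemma smoothable_half i (a : R) : smoothable [set x : V | a < x ord0 i].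
Proof.
have mH : measurable [set x : V | a < x ord0 i].
  rewrite (_ : [set x | _] = (fun x : V => x ord0 i) @^-1` `]a, +oo[%classic); last first.
    by apply/seteqP; split=> x /=; rewrite in_itv/= andbT.
  by apply: measurable_preimage => //; exact: measurable_coord.
split=> // e e0.
pose phi (k : nat) (x : V) : R := flat 0 (k.+1%:R * x ord0 i + (- k.+1%:R * a)).
have sp k : smooth (phi k).
  have H := smooth_comp (fun m => C1k_aff k.+1%:R (- k.+1%:R * a) (C1k_flat m 0)) (@smooth_coord R n i).
  exact: H.
pose F k x := w x * `|\1_[set x : V | a < x ord0 i] x - phi k x|.
have mF k : measurable_fun setT (F k).
  by apply/measurable_EFinP; exact: mwd.
have Fg k x : 0 <= F k x <= w x.
  rewrite /F mulr_ge0//= ler_piMr// !indicE.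
  have := flat_ge0 0 (k.+1%:R * x ord0 i + (- k.+1%:R * a)).
  have := flat_le1 (k.+1%:R * x ord0 i + (- k.+1%:R * a)).
  rewrite -/(phi k x); case: (_ \in _) => ? ?; rewrite ler_norml; apply/andP; split => /=; lra.
have F0 x : F k x @[k --> \oo] --> 0.
  have [ax|ax] := ltP a (x ord0 i); last first.
    rewrite (_ : (fun k => _) = cst 0); first exact: cvg_cst.
    apply/funext => k; rewrite /F indicE memNset/=; last by rewrite /= ltNge ax.
    rewrite /phi flat_le0 ?subrr ?normr0 ?mulr0//.
    by rewrite mulNr -mulrBr; apply: mulr_ge0_le0 => //; rewrite subr_le0.
  rewrite -[X in _ --> X](mulr0 (w x)); apply: cvgM; first exact: cvg_cst.
  pose c := x ord0 i - a; have c0 : 0 < c by rewrite subr_gt0.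
  apply: (@squeeze_cvgr _ _ _ _ (cst 0) (fun k : nat => c^-1 * (k.+1%:R^-1))); last 2 first.
  - exact: cvg_cst.
  - rewrite -[X in _ --> X](mulr0 c^-1); apply: cvgM; first exact: cvg_cst.
    exact: cvg_harmonic.
  apply: nearW => k; rewrite normr_ge0/= indicE mem_set//=.
  rewrite /phi mulNr -mulrBr -/c.
  have kc : 0 < k.+1%:R * c by rewrite mulr_gt0.
  rewrite ger0_norm ?subr_ge0 ?flat_le1//.
  rewrite /flat kc expr0 mul1r.
  have -> : c^-1 * k.+1%:R^-1 = (k.+1%:R * c)^-1 by rewrite invfM mulrC.
  have := expR_ge1Dx (- (k.+1%:R * c)^-1); move: (k.+1%:R * c)^-1 => a2; move: (expR _) => a1 ?; lra.
have [k Hk] := integral_small e0 mF F0 iw Fg.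
exists (phi k); split=> // x; rewrite flat_ge0/=; exact: flat_le1.
Qed.

Lemma measurable_smoothable A : measurable A -> smoothable A.
Proof.
suff : (measurable : set (set V)) `<=` smoothable by apply.
apply: smallest_sub.
  split.
  - by rewrite -setCT; apply: smoothableC; exact: smoothableT.
  - by move=> B HB; rewrite setTD; exact: smoothableC.
  - exact: smoothable_bigcup.
move=> B; rewrite -bigcup_seq => -[i _ [C mC <-]]; rewrite setTI.
move: C mC; rewrite RGenOInfty.measurableE.
suff : (<<s (@RGenOInfty.G R) >> : set (set R)) `<=` [set C | smoothable (rV_coord i @^-1` C)].
  by apply.
apply: smallest_sub.
  split => /=.
  - by rewrite preimage_set0 -setCT; apply: smoothableC; exact: smoothableT.
  - by move=> C HC; rewrite setTD preimage_setC; exact: smoothableC.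
  - by move=> F HF; rewrite preimage_bigcup; exact: smoothable_bigcup.
move=> _ [a ->] /=; rewrite (_ : _ @^-1` _ = [set x : V | a < x ord0 i]).
  exact: smoothable_half.
by apply/seteqP; split=> x /=; rewrite in_itv/= andbT.
Qed.

End approximation.

(** Test the sign of [f] against smooth approximations of the indicator of
    [{f < 0}], cut off by a plateau. *)
Lemma ae_ge0_of_test f : L1loc f ->
  (forall phi, test_fun phi -> (forall x, 0 <= phi x) -> 0 <= \int[mu]_x (f x * phi x)) ->
  {ae mu, forall x, 0 <= f x}.
Proof.
move=> Lf Hf; have [mf _] := Lf.
suff H (M : nat) : {ae mu, forall x, `|x| <= M%:R -> 0 <= f x}.
  have := ae_foralln H; apply: filterS => x Hx.
  by apply: (Hx (Num.truncn `|x|).+1); apply: ltW; exact: truncnS_gt.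
have [chi [tc c01 c1]] := @plateau R n M%:R (ler0n _ _).
pose w x := `|f x * chi x|.
have iw : mu.-integrable setT (EFin \o w) := integrable_norm (integrable_L1loc_test Lf tc).
pose A : set V := [set x | f x < 0].
have mA : measurable A.
  rewrite (_ : A = f @^-1` `]-oo, 0[%classic); last first.
    by apply/seteqP; split=> x /=; rewrite in_itv.
  exact: measurable_preimage.
have ifc := integrable_L1loc_test Lf tc.
have ifcA : mu.-integrable setT (EFin \o (fun x => f x * chi x * \1_A x)).
  apply: (le_integrable measurableT _ _ iw).
    apply/measurable_EFinP; apply: measurable_funM => //.
    by apply: measurable_funM => //; exact: test_measurable.
  move=> x _ /=; rewrite lee_fin /w normr_id normrM ler_piMr// indicE.
  by case: (_ \in _); rewrite ?normr1 ?normr0.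
have I0 : 0 <= \int[mu]_x (f x * chi x * \1_A x).
  rewrite leNgt; apply/negP => I0.
  pose e := - \int[mu]_x (f x * chi x * \1_A x).
  have e0 : 0 < e by rewrite oppr_gt0.
  have [_ /(_ _ e0)[phi [sp p01 Hp]]] := measurable_smoothable (fun x => normr_ge0 (f x * chi x)) iw mA.
  have tpc : test_fun (fun x => phi x * chi x) by exact: testM.
  have pc0 x : 0 <= phi x * chi x.
    by have /andP[? _] := p01 x; have /andP[? _] := c01 x; exact: mulr_ge0.
  have J0 := Hf _ tpc pc0.
  have iJ := integrable_L1loc_test Lf tpc.
  have iD := integrableB measurableT iJ ifcA.
  have := le_normr_Rintegral measurableT iD.
  rewrite [X in _ <= X -> _](_ : _ = \int[mu]_x (`|f x * chi x| * `|\1_A x - phi x|)); last first.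
    apply: eq_Rintegral => x _; rewrite -normrM distrC mulrBr.
    by congr `|_ - _|; ring.
  rewrite RintegralB//.
  have : \int[mu]_x (`|f x * chi x| * `|\1_A x - phi x|) < e.
    move: (Hp); rewrite -lte_fin /Rintegral fineK// fin_real//.
    by rewrite (lt_trans Hp) ?ltry// andbT (lt_le_trans (ltNyr 0))//; apply: integral_ge0 => x _; rewrite lee_fin mulr_ge0.
  rewrite /e; move: I0 J0; move: (\int[mu]_x (f x * chi x * \1_A x)) => I.
  move: (\int[mu]_x (f x * _)) => J I0 J0 h1 h2.
  have := ler_norm (J - I); lra.
pose h x := f x * chi x * \1_A x.
have h0 x : h x <= 0.
  rewrite /h indicE; case: (boolP (x \in A)) => [|_]; last by rewrite mulr0.
  rewrite inE /A/= => fx; rewrite mulr1; apply: mulr_le0_ge0; first exact: ltW.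
  by have /andP[] := c01 x.
have mh : measurable_fun setT (EFin \o h) := measurable_int _ ifcA.
have : (\int[mu]_x `|(EFin \o h) x| = 0)%E.
  have E : \int[mu]_x `|h x| = 0.
    apply/eqP; rewrite eq_le; apply/andP; split; last by apply: Rintegral_ge0.
    rewrite (_ : \int[mu]_x `|h x| = \int[mu]_x (-1 * h x)); last first.
      by apply: eq_Rintegral => x _; rewrite ler0_norm// mulN1r.
    by rewrite RintegralZl// mulN1r oppr_le0.
  have ih := integrable_norm ifcA.
  by rewrite -[RHS]/(0%:E) -E /Rintegral fineK//; exact: (integrable_fin_num measurableT ih).
move/(ae_eq_integral_abs mu measurableT mh).
apply: filterS => x /(_ I)/= [] hx xM; rewrite leNgt; apply/negP => fx.
move: hx; rewrite /h c1// mulr1 indicE mem_set//= mulr1 => fx0.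
by rewrite fx0 ltxx in fx.
Qed.

Lemma ae_eq0_of_test f : L1loc f ->
  (forall phi, test_fun phi -> \int[mu]_x (f x * phi x) = 0) ->
  {ae mu, forall x, f x = 0}.
Proof.
move=> Lf Hf.
have H1 : {ae mu, forall x, 0 <= f x}.
  by apply: ae_ge0_of_test => // phi tp _; rewrite Hf.
have H2 : {ae mu, forall x, 0 <= - f x}.
  apply: (@ae_ge0_of_test (fun x => - f x)).
    split; first by apply: measurableT_comp => //; have [] := Lf.
    by move=> K cK; under eq_integral do rewrite normrN; have [_] := Lf; exact.
  move=> phi tp _; rewrite (_ : \int[mu]_x _ = \int[mu]_x (-1 * (f x * phi x))).
    by rewrite RintegralZl ?Hf ?mulr0//; exact: integrable_L1loc_test.
  by apply: eq_Rintegral => x _; rewrite mulN1r mulNr.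
by apply: filterS2 H1 H2 => x; rewrite oppr_ge0 => a b; apply/eqP; rewrite eq_le a b.
Qed.

Lemma L1locB f g : L1loc f -> L1loc g -> L1loc (fun x => f x - g x).
Proof.
move=> [mf Lf] [mg Lg]; split; first exact: measurable_funB.
move=> K cK.
have mK : measurable K by apply: closed_measurable_rV; apply: compact_closed => //; exact: norm_hausdorff.
apply: (@le_lt_trans _ _ (\int[mu]_(x in K) (`|f x|%:E + `|g x|%:E))%E).
  apply: ge0_le_integral => //.
  - by apply/measurable_EFinP; apply: measurableT_comp => //; apply: measurable_funTS; exact: measurable_funB.
  - by apply: emeasurable_funD; apply/measurable_EFinP; apply: measurableT_comp => //; exact: measurable_funTS.
  - by move=> x _; rewrite -EFinD lee_fin; exact: ler_normB.
rewrite ge0_integralD//; first by apply: lte_add_pinfty; [exact: Lf|exact: Lg].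
- by apply/measurable_EFinP; apply: measurableT_comp => //; exact: measurable_funTS.
- by apply/measurable_EFinP; apply: measurableT_comp => //; exact: measurable_funTS.
Qed.

(** Two weak gradients have equal integrals against test functions. *)
Lemma weak_grad_unique u G H : is_weak_grad u G -> is_weak_grad u H ->
  {ae mu, forall x, G x = H x}.
Proof.
move=> [_ LG EG] [_ LH EH].
have K (i : 'I_n) : {ae mu, forall x, G x ord0 i - H x ord0 i = 0}.
  apply: (@ae_eq0_of_test (fun x => G x ord0 i - H x ord0 i)); first exact: L1locB.
  move=> phi tp.
  have i1 := integrable_L1loc_test (LG i) tp; have i2 := integrable_L1loc_test (LH i) tp.
  rewrite (_ : \int[mu]_x _ = \int[mu]_x (G x ord0 i * phi x - H x ord0 i * phi x)); last first.
    by apply: eq_Rintegral => x _; rewrite mulrBl.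
  rewrite RintegralB//; apply/eqP; rewrite subr_eq0; apply/eqP; apply: oppr_inj.
  by rewrite -EG// EH.
have {}K : {ae mu, forall x, forall i : 'I_n, G x ord0 i - H x ord0 i = 0}.
  by apply: filter_forall.
apply: filterS K => x Hx.
by apply/rowP => i; have /eqP := Hx i; rewrite subr_eq0 => /eqP.
Qed.

Lemma nabla_weak_grad u : (exists G, is_weak_grad u G) -> is_weak_grad u (nabla u).
Proof. by move=> [G HG]; have := @xgetPex _ (fun=> 0) [set G | is_weak_grad u G] (ex_intro _ G HG). Qed.

Lemma nabla_eq u G : is_weak_grad u G -> {ae mu, forall x, nabla u x = G x}.
Proof.
move=> HG; apply: weak_grad_unique (HG); apply: nabla_weak_grad; by exists G.
Qed.

End weak_gradients.

(** * The Euclidean norm and limits of test functions *)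

Section enorm_theory.
Context {R : realType} {n : nat}.
Notation V := 'rV[R]_n.
Implicit Types x y v : V.

Lemma enorm_ge0 x : 0 <= enorm x.
Proof. exact: sqrtr_ge0. Qed.

Lemma sqr_enorm x : enorm x ^+ 2 = \sum_(i < n) x ord0 i ^+ 2.
Proof. by rewrite sqr_sqrtr// sumr_ge0// => i _; exact: sqr_ge0. Qed.

Lemma enorm0 : enorm (0 : V) = 0.
Proof. by rewrite /enorm big1 ?sqrtr0// => i _; rewrite mxE expr0n. Qed.

Lemma enorm_eq0 x : (enorm x == 0) = (x == 0).
Proof.
apply/idP/idP => [/eqP H|/eqP ->]; last by rewrite enorm0.
have : \sum_(i < n) x ord0 i ^+ 2 == 0 by rewrite -sqr_enorm H expr0n.
rewrite psumr_eq0; last by move=> i _; exact: sqr_ge0.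
move=> /allP h; apply/eqP/rowP => i; rewrite mxE; apply/eqP.
by rewrite -sqrf_eq0; apply: h; rewrite mem_index_enum.
Qed.

Lemma enormZ (c : R) x : enorm (c *: x) = `|c| * enorm x.
Proof.
rewrite /enorm -sqrtr_sqr -sqrtrM ?sqr_ge0// mulr_sumr; congr Num.sqrt.
by apply: eq_bigr => i _; rewrite mxE exprMn.
Qed.

Lemma enormN x : enorm (- x) = enorm x.
Proof. by rewrite -scaleN1r enormZ normrN1 mul1r. Qed.

Lemma enormB x y : enorm (x - y) = enorm (y - x).
Proof. by rewrite -enormN opprB. Qed.

Lemma enorm_coord_le x i : `|x ord0 i| <= enorm x.
Proof.
rewrite -(ger0_norm (enorm_ge0 x)) -ler_sqr ?nnegrE//= ?normr_ge0//.
rewrite !real_normK ?num_real// sqr_enorm (bigD1 i)//= lerDl sumr_ge0// => j _.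
exact: sqr_ge0.
Qed.

Lemma norm_le_enorm x : `|x| <= enorm x.
Proof. by apply/rV_norm_le => [|i]; [exact: enorm_ge0|exact: enorm_coord_le]. Qed.

Lemma sqr_enormD_le x y : enorm (x + y) ^+ 2 <= 2 * (enorm x ^+ 2 + enorm y ^+ 2).
Proof.
rewrite !sqr_enorm -big_split mulr_sumr ler_sum// => i _; rewrite mxE /=.
move: (x _ i) (y _ i) => a b; have := sqr_ge0 (a - b); nra.
Qed.

Lemma enormD_max x y : enorm (x + y) <= 2 * Num.max (enorm x) (enorm y).
Proof.
have m0 : 0 <= Num.max (enorm x) (enorm y) by rewrite le_max enorm_ge0.
rewrite -ler_sqr ?nnegrE ?enorm_ge0//; last by rewrite mulr_ge0.
apply: (le_trans (sqr_enormD_le x y)); rewrite exprMn.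
set m := Num.max _ _ in m0 *.
have h1 : enorm x <= m by rewrite le_max lexx.
have h2 : enorm y <= m by rewrite le_max lexx orbT.
have := enorm_ge0 x; have := enorm_ge0 y.
move: m (enorm x) (enorm y) m0 h1 h2 => m a b ? ? ? ? ?; nra.
Qed.

(** [t^2 + t^r], whose integral controls both the [L^2] and the [L^r] norm. *)
Definition Phi (r t : R) : R := t ^+ 2 + t `^ r.

Lemma Phi_ge0 r t : 0 <= Phi r t.
Proof. by rewrite addr_ge0 ?sqr_ge0 ?powR_ge0. Qed.

Lemma Phi_mono r s t : 0 <= r -> 0 <= s -> s <= t -> Phi r s <= Phi r t.
Proof.
move=> r0 s0 st; have t0 := le_trans s0 st.
by rewrite lerD ?ler_sqr ?nnegrE//; apply: ge0_ler_powR.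
Qed.

(** A constant for the quasi-triangle inequality of [Phi]. *)
Definition PhiC (r : R) : R := 4 + 2 `^ r.

Lemma PhiC_ge0 r : 0 <= PhiC r.
Proof. by rewrite addr_ge0 ?powR_ge0. Qed.

Lemma Phi_double r t : 0 <= t -> Phi r (2 * t) <= PhiC r * Phi r t.
Proof.
move=> t0; rewrite /Phi /PhiC exprMn powRM//.
have := powR_ge0 2 r; have := powR_ge0 t r; have := sqr_ge0 t.
move: (t ^+ 2) (t `^ r) (2 `^ r) => a b c ? ? ?.
have -> : (2 : R) ^+ 2 = 4 by ring.
nra.
Qed.

Lemma Phi_enormD r x y : 0 <= r ->
  Phi r (enorm (x + y)) <= PhiC r * (Phi r (enorm x) + Phi r (enorm y)).
Proof.
move=> r0; have m0 : 0 <= Num.max (enorm x) (enorm y) by rewrite le_max enorm_ge0.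
apply: (le_trans (Phi_mono r0 (enorm_ge0 _) (enormD_max x y))).
apply: (le_trans (Phi_double r m0)); apply: ler_wpM2l; first exact: PhiC_ge0.
by case: (leP (enorm x) (enorm y)) => _; rewrite ?lerDl ?lerDr Phi_ge0.
Qed.

Lemma Phi_small r t : 2 <= r -> 0 <= t <= 2 -> Phi r t <= PhiC r * t ^+ 2.
Proof.
move=> r2 /andP[t0 t2]; rewrite /Phi /PhiC mulrDl.
have h : t `^ r <= 2 `^ r * t ^+ 2.
  have [->|tn0] := eqVneq t 0.
    by rewrite powR0 ?mulr_ge0 ?powR_ge0 ?sqr_ge0//; lra.
  have tp : 0 < t by rewrite lt_neqAle eq_sym tn0.
  have -> : t = 2 * (t / 2) by field.
  rewrite powRM ?divr_ge0// ler_wpM2l ?powR_ge0//.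
  have h2 : (t / 2) `^ r <= (t / 2) `^ 2.
    apply: ger_powR => //; rewrite divr_gt0//=; lra.
  apply: (le_trans h2); rewrite powR_mulrn ?divr_ge0//.
  by rewrite ler_sqr ?nnegrE ?mulr_ge0 ?divr_ge0//; lra.
have := sqr_ge0 t; move: (t ^+ 2) (t `^ r) h => a b ? ?; lra.
Qed.

Lemma measurable_Phi d (T : measurableType d) r (f : T -> R) :
  measurable_fun setT f -> measurable_fun setT (fun t => Phi r (f t)).
Proof.
move=> mf; apply: measurable_funD; first exact: measurable_funX.
by apply: (@measurableT_comp _ _ _ _ _ _ (fun x : R => x `^ r) _ f); first exact: measurable_powR.
Qed.

End enorm_theory.

Section null_sequences.
Context {R : realType}.

Lemma cvge0P (y : nat -> \bar R) : (forall k, (0 <= y k)%E) ->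
  (y k @[k --> \oo] --> 0%E) <->
  forall e : R, 0 < e -> \forall k \near \oo, (y k < e%:E)%E.
Proof.
move=> y0; split=> [/fine_cvgP[fy /cvgrPdist_lt H] e e0|H].
  near=> k.
  have fk : y k \is a fin_num by near: k.
  have : `|0 - fine (y k)| < e by near: k; exact: H.
  by rewrite sub0r normrN => h; rewrite -(fineK fk) lte_fin (le_lt_trans (ler_norm _)).
apply/fine_cvgP; split.
  have := H 1 ltr01; apply: filterS => k hk; rewrite ge0_fin_numE//.
  by apply: lt_trans hk _; rewrite ltry.
apply/cvgrPdist_lt => e e0; have := H _ e0; apply: filterS => k hk.
have fk : y k \is a fin_num by rewrite ge0_fin_numE// (lt_trans hk)// ltry.
by rewrite sub0r normrN /= ger0_norm ?fine_ge0// -lte_fin fineK.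
Unshelve. all: by end_near. Qed.

Lemma cvge0_le (y z : nat -> \bar R) (C : R) : 0 <= C ->
  (forall k, (0 <= y k)%E) -> (forall k, (0 <= z k)%E) ->
  (forall k, (y k <= C%:E * z k)%E) -> z k @[k --> \oo] --> 0%E ->
  y k @[k --> \oo] --> 0%E.
Proof.
move=> C0 y0 z0 yz /(cvge0P z0) H; apply/(cvge0P y0) => e e0.
have C1 : 0 < C + 1 by rewrite ltr_wpDl.
have := H (e / (C + 1)); rewrite divr_gt0// => /(_ isT); apply: filterS => k hk.
have fk : z k \is a fin_num by rewrite ge0_fin_numE// (lt_trans hk)// ltry.
apply: (le_lt_trans (yz k)); move: hk (z0 k); rewrite -(fineK fk) -EFinM !lte_fin lee_fin.
move: (fine _) => t; rewrite ltr_pdivlMr// => ? ?; nra.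
Qed.

Lemma cvge0_poweR (y : nat -> \bar R) (s : R) : 0 < s -> (forall k, (0 <= y k)%E) ->
  y k @[k --> \oo] --> 0%E -> (y k `^ s)%E @[k --> \oo] --> 0%E.
Proof.
move=> s0 y0 /(cvge0P y0) H; apply/cvge0P => [k|e e0]; first exact: poweR_ge0.
have t0 : 0 < e `^ s^-1 by exact: powR_gt0.
have := H _ t0; apply: filterS => k hk.
have fk : y k \is a fin_num by rewrite ge0_fin_numE// (lt_trans hk)// ltry.
move: hk (y0 k); rewrite -(fineK fk) poweR_EFin !lte_fin lee_fin; move: (fine _) => t ht t1.
have := @gt0_ltr_powR R s s0 t (e `^ s^-1).
rewrite !nnegrE t1 powR_ge0 => /(_ isT isT ht).
by rewrite -powRrM mulVf ?gt_eqF// powRr1// ltW.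
Qed.

End null_sequences.

Section X1_class.
Context {R : realType} {n : nat}.
Notation V := 'rV[R]_n.
Notation mu := (@leb R n).
Implicit Types (f g u w phi psi : V -> R) (G H W : V -> V) (x y v : V).

(** The integral of [defect r phi u G] is small exactly when [phi] is close to [u]
    in the [X_1] norm, [G] being the gradient of [u]; being one integral, it is
    easier to estimate pointwise than the norm. *)
Definition defect r phi u G x : R :=
  (phi x - u x) ^+ 2 + Phi r (enorm (grad phi x - G x)).

Lemma defect_ge0 r phi u G x : 0 <= defect r phi u G x.
Proof. by rewrite addr_ge0 ?sqr_ge0 ?Phi_ge0. Qed.

Lemma measurable_grad phi : smooth phi -> measurable_fun setT (grad phi).
Proof.
move=> sp; apply: measurable_fun_rV => i.
rewrite (_ : _ \o _ = partial i phi); first by apply: smooth_measurable; exact: smooth_partial.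
by apply/funext => x; rewrite /rV_coord /= mxE.
Qed.

Lemma measurable_defect r phi u G : smooth phi -> measurable_fun setT u ->
  measurable_fun setT G -> measurable_fun setT (defect r phi u G).
Proof.
move=> sp mu' mG; apply: measurable_funD.
  by apply: measurable_funX; apply: measurable_funB => //; exact: smooth_measurable.
have me : measurable_fun setT (fun x => enorm (grad phi x - G x)).
  by apply: measurable_enorm; apply: measurable_rV_sub => //; exact: measurable_grad.
exact: measurable_Phi me.
Qed.

(** The admissible functions: continuous limits of test functions for the [X_1]
    norm with a gradient bounded by one, together with a representative [G] of
    that gradient for which the bound holds everywhere. *)
Definition lipX1 (r : R) u G : Prop := [/\ continuous u, measurable_fun setT G,
  (forall x, enorm (G x) <= 1) &
  exists phi : nat -> V -> R, (forall k, test_fun (phi k)) /\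
    (\int[mu]_x (defect r (phi k) u G x)%:E)%E @[k --> \oo] --> 0%E].

(** The form in which operations on admissible functions are justified: apply the
    operation to the approximating test functions and estimate the new defect
    pointwise by the old one, at [x] and at its image under a measure
    preserving map. *)
Lemma lipX1_transfer r u G w W (T : V -> V) (C : R) : 0 <= C ->
  measurable_fun setT T -> (forall A, measurable A -> mu (T @^-1` A) = mu A) ->
  continuous w -> measurable_fun setT W -> (forall x, enorm (W x) <= 1) ->
  (forall phi, test_fun phi -> exists2 psi, test_fun psi & forall x,
     defect r psi w W x <= C * (defect r phi u G x + defect r phi u G (T x))) ->
  lipX1 r u G -> lipX1 r w W.
Proof.
move=> C0 mT HT cw mW W1 H [cu mG G1 [phi [tphi cphi]]].
split=> //.
have /choice[psi Hpsi] : forall k, exists psi, test_fun psi /\ forall x,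
     defect r psi w W x <= C * (defect r (phi k) u G x + defect r (phi k) u G (T x)).
  by move=> k; have [psi tp h] := H _ (tphi k); exists psi.
exists psi; split; first by move=> k; have [] := Hpsi k.
have mu' := continuous_measurable_rV cu; have mw := continuous_measurable_rV cw.
have mD k : measurable_fun setT (defect r (phi k) u G).
  by apply: measurable_defect => //; exact: test_smooth.
have mDT k : measurable_fun setT (fun x => defect r (phi k) u G (T x)) := measurableT_comp (mD k) mT.
apply: (@cvge0_le _ _ (fun k => \int[mu]_x (defect r (phi k) u G x)%:E)%E (2 * C)) => //.
- exact: mulr_ge0.
- by move=> k; apply: integral_ge0 => x _; rewrite lee_fin defect_ge0.
- by move=> k; apply: integral_ge0 => x _; rewrite lee_fin defect_ge0.
- move=> k.
  have [tp h] := Hpsi k.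
  apply: (@le_trans _ _ (\int[mu]_x (C%:E * ((defect r (phi k) u G x)%:E + (defect r (phi k) u G (T x))%:E)))%E).
    apply: ge0_le_integral => //.
    + by move=> x _; rewrite lee_fin defect_ge0.
    + by apply/measurable_EFinP; apply: measurable_defect => //; exact: test_smooth.
    + apply: emeasurable_funM => //.
      by apply: emeasurable_funD; exact/measurable_EFinP.
    + by move=> x _; rewrite -EFinD -EFinM lee_fin.
  rewrite ge0_integralZl//; last 2 first.
  + by apply: emeasurable_funD; exact/measurable_EFinP.
  + by move=> x _; rewrite -EFinD lee_fin addr_ge0 ?defect_ge0.
  rewrite ge0_integralD//; last 4 first.
  + by move=> x _; rewrite lee_fin defect_ge0.
  + exact/measurable_EFinP.
  + by move=> x _; rewrite lee_fin defect_ge0.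
  + exact/measurable_EFinP.
  have mDE : measurable_fun setT (fun x => (defect r (phi k) u G x)%:E) by exact/measurable_EFinP.
  have E := integral_mpres mT HT mDE.
  rewrite [X in (_ * (_ + X) <= _)%E]E.
  by rewrite -mule2n -mule_natl muleA -EFinM [(C * 2)%R]mulrC.
Qed.

Lemma lipX1_fin r u G : lipX1 r u G -> exists2 phi, test_fun phi &
  (\int[mu]_x (defect r phi u G x)%:E < +oo)%E.
Proof.
move=> [_ _ _ [phi [tp c]]].
have : \forall k \near \oo, (\int[mu]_x (defect r (phi k) u G x)%:E < 1%:E)%E.
  by apply: (cvge0P _).1 => // k; apply: integral_ge0 => x _; rewrite lee_fin defect_ge0.
move=> [k _ /(_ k (leqnn _))] h; exists (phi k) => //.
by apply: lt_trans h _; rewrite ltry.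
Qed.

Lemma lipX1_sqr_lty r u G : lipX1 r u G -> (\int[mu]_x (u x ^+ 2)%:E < +oo)%E.
Proof.
move=> L; have [phi tp fin] := lipX1_fin L; have [cu mG _ _] := L.
have mu' := continuous_measurable_rV cu.
have mD : measurable_fun setT (defect r phi u G).
  by apply: measurable_defect => //; exact: test_smooth.
have t2 : test_fun (fun x => phi x * phi x) by apply: testM => //; exact: test_smooth.
have i2 := integrable_test t2.
have iD : mu.-integrable setT (EFin \o defect r phi u G).
  apply/integrableP; split; first exact/measurable_EFinP.
  by under eq_integral do rewrite /= ger0_norm ?defect_ge0//.
have i3 := integrableZl measurableT 2 (integrableD measurableT iD i2).
have : mu.-integrable setT (EFin \o (fun x => u x ^+ 2)).
  apply: (le_integrable measurableT _ _ i3).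
    by apply/measurable_EFinP; exact: measurable_funX.
  move=> x _ /=; rewrite lee_fin ger0_norm ?sqr_ge0//.
  apply: le_trans (ler_norm _); rewrite /defect.
  have := Phi_ge0 r (enorm (grad phi x - G x)).
  have := sqr_ge0 (2 * phi x - u x); move: (phi x) (u x) (Phi _ _) => a b c; nra.
move=> /integrableP[_]; under eq_integral do rewrite /= ger0_norm ?sqr_ge0//.
by [].
Qed.

Lemma lipX1_grad_lty r u G : lipX1 r u G -> (\int[mu]_x (enorm (G x) ^+ 2)%:E < +oo)%E.
Proof.
move=> L; have [phi tp fin] := lipX1_fin L; have [cu mG _ _] := L.
have mu' := continuous_measurable_rV cu.
have mD : measurable_fun setT (defect r phi u G).
  by apply: measurable_defect => //; exact: test_smooth.
have i2 : mu.-integrable setT (EFin \o (fun x => enorm (grad phi x) ^+ 2)).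
  have i3 (i : 'I_n) : mu.-integrable setT (EFin \o (fun x => partial i phi x * partial i phi x)).
    by apply: integrable_test; apply: testM; [apply: smooth_partial; exact: test_smooth|exact: test_partial].
  have := @integrable_sum _ _ _ mu setT measurableT _ (index_enum 'I_n) xpredT (fun i x => (partial i phi x * partial i phi x)%:E) (fun i _ => i3 i).
  apply: eq_integrable => // x _ /=; rewrite sqr_enorm -sumEFin.
  by apply: eq_bigr => i _; rewrite mxE expr2.
have iD : mu.-integrable setT (EFin \o defect r phi u G).
  apply/integrableP; split; first exact/measurable_EFinP.
  by under eq_integral do rewrite /= ger0_norm ?defect_ge0//.
have i3 := integrableZl measurableT 2 (integrableD measurableT iD i2).
have : mu.-integrable setT (EFin \o (fun x => enorm (G x) ^+ 2)).
  apply: (le_integrable measurableT _ _ i3).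
    by apply/measurable_EFinP; apply: measurable_funX; exact: measurable_enorm.
  move=> x _ /=; rewrite lee_fin ger0_norm ?sqr_ge0//.
  apply: le_trans (ler_norm _); rewrite /defect /Phi.
  have := sqr_enormD_le (G x - grad phi x) (grad phi x); rewrite subrK [enorm (G x - _)]enormB.
  have := powR_ge0 (enorm (grad phi x - G x)) r; have := sqr_ge0 (phi x - u x).
  move: (enorm _ ^+ 2) (_ `^ r) (_ ^+ 2) (enorm _ ^+ 2) (enorm _ ^+ 2) => a b c d e; lra.
move=> /integrableP[_]; under eq_integral do rewrite /= ger0_norm ?sqr_ge0//.
by [].
Qed.

(** [|f psi| <= s f^2 + psi^2 / s] with [s] large gives the weak convergence. *)
Lemma sqr_cvg0_test (f : nat -> V -> R) psi : (forall k, measurable_fun setT (f k)) ->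
  (\int[mu]_x (f k x ^+ 2)%:E)%E @[k --> \oo] --> 0%E -> test_fun psi ->
  (\int[mu]_x (`|f k x * psi x|)%:E)%E @[k --> \oo] --> 0%E.
Proof.
move=> mf cf tp.
have t2 : test_fun (fun x => psi x * psi x) by apply: testM => //; exact: test_smooth.
have i2 := integrable_test t2.
pose B := \int[mu]_x (psi x * psi x).
have EB : (\int[mu]_x (psi x * psi x)%:E = B%:E)%E.
  by rewrite /B /Rintegral fineK//; exact: (integrable_fin_num measurableT i2).
have B0 : 0 <= B by apply: Rintegral_ge0 => x _; rewrite -expr2 sqr_ge0.
apply/cvge0P => [k|e e0]; first by apply: integral_ge0 => x _; rewrite lee_fin.
pose s := 2 * (B + 1) / e.
have B1 : 0 < B + 1 by rewrite ltr_wpDl.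
have s0 : 0 < s by rewrite divr_gt0// mulr_gt0.
have d0 : 0 < e / (2 * s) by rewrite divr_gt0// mulr_gt0.
have := (cvge0P _).1 cf _ d0.
move=> /(_ (fun k => integral_ge0 _ _)) => H.
have {}H : \forall k \near \oo, (\int[mu]_x (f k x ^+ 2)%:E < (e / (2 * s))%:E)%E.
  by apply: H => k x _; rewrite lee_fin sqr_ge0.
apply: filterS H => k hk.
have mf2 : measurable_fun setT (fun x => (f k x ^+ 2)%:E).
  by apply/measurable_EFinP; exact: measurable_funX.
have mp2 : measurable_fun setT (fun x => (psi x * psi x)%:E) := measurable_int _ i2.
apply: (@le_lt_trans _ _ (\int[mu]_x (s%:E * (f k x ^+ 2)%:E + s^-1%:E * (psi x * psi x)%:E))%E).
  apply: ge0_le_integral => //.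
  - apply/measurable_EFinP; apply: measurableT_comp => //; apply: measurable_funM => //.
    exact: test_measurable.
  - by apply: emeasurable_funD; apply: emeasurable_funM.
  - move=> x _; rewrite -!EFinM -EFinD lee_fin normrM.
    rewrite -(real_normK (num_real (f k x))) -expr2 -(real_normK (num_real (psi x))).
    move: `|f k x| `|psi x| (normr_ge0 (f k x)) (normr_ge0 (psi x)) => a b a0 b0.
    have h := sqr_ge0 (s * a - b).
    rewrite -(ler_pM2l s0) mulrDr [s * (s^-1 * _)]mulrA divff ?gt_eqF// mul1r.
    have := mulr_ge0 (mulr_ge0 (ltW s0) a0) b0; nra.
rewrite ge0_integralD//; last 4 first.
- by move=> x _; rewrite -EFinM lee_fin mulr_ge0 ?sqr_ge0// ltW.
- exact: emeasurable_funM.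
- by move=> x _; rewrite -EFinM lee_fin -expr2 mulr_ge0 ?sqr_ge0// invr_ge0 ltW.
- exact: emeasurable_funM.
rewrite !ge0_integralZl//; last 4 first.
- by move=> x _; rewrite lee_fin -expr2 sqr_ge0.
- by rewrite lee_fin invr_ge0 ltW.
- by move=> x _; rewrite lee_fin sqr_ge0.
- by rewrite lee_fin ltW.
have I0 : (0 <= \int[mu]_x (f k x ^+ 2)%:E)%E by apply: integral_ge0 => x _; rewrite lee_fin sqr_ge0.
have fk : (\int[mu]_x (f k x ^+ 2)%:E)%E \is a fin_num by rewrite ge0_fin_numE// (lt_trans hk)// ltry.
rewrite EB; move: hk; rewrite -(fineK fk) -!EFinM -EFinD !lte_fin.
have s20 : 0 < 2 * s by exact: mulr_gt0.
move: (fine _) => t; rewrite (ltr_pdivlMr _ _ s20) => ht.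
have h2 : s^-1 * B < e / 2.
  rewrite -(ltr_pM2l s0) mulrA divff ?gt_eqF// mul1r.
  have -> : s * (e / 2) = B + 1 by rewrite /s; field; rewrite gt_eqF.
  by rewrite ltrDl.
by nra.
Qed.

End X1_class.

(** * Membership in X_1 and the value of Psi_0 *)

Section X1_membership.
Context {R : realType} {n : nat}.
Notation V := 'rV[R]_n.
Notation mu := (@leb R n).
Implicit Types (f g u w phi psi : V -> R) (G H W : V -> V) (x y v : V).

Lemma cvge0D (y z : nat -> \bar R) : y k @[k --> \oo] --> 0%E -> z k @[k --> \oo] --> 0%E ->
  (y k + z k)%E @[k --> \oo] --> 0%E.
Proof. by move=> h1 h2; have h := cvgeD (isT : (0 +? (0 : \bar R))%E) h1 h2; rewrite adde0 in h; exact: h. Qed.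

Lemma measurable_ord (G : V -> V) i : measurable_fun setT G ->
  measurable_fun setT (fun x => G x ord0 i : R).
Proof. exact: measurable_coord_comp. Qed.

Lemma L1loc_bounded f (C : R) : measurable_fun setT f -> (forall x, `|f x| <= C) -> L1loc f.
Proof.
move=> mf fC; split=> // K cK; have [_ H] := L1loc_continuous (@cst_continuous V _ C).
apply: le_lt_trans (H K cK).
have mK : measurable K by apply: closed_measurable_rV; apply: compact_closed => //; exact: norm_hausdorff.
apply: ge0_le_integral => //.
- by apply/measurable_EFinP; apply: measurableT_comp => //; exact: measurable_funTS.
- by move=> x _; rewrite lee_fin (le_trans (fC x))// ler_norm.
Qed.

(** Pass to the limit in the integration by parts formula for the approximating
    test functions. *)
Lemma weak_grad_limit u G (phi : nat -> V -> R) : continuous u ->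
  measurable_fun setT G -> (forall x, enorm (G x) <= 1) ->
  (forall k, test_fun (phi k)) ->
  (\int[mu]_x ((phi k x - u x) ^+ 2)%:E)%E @[k --> \oo] --> 0%E ->
  (forall i, (\int[mu]_x ((partial i (phi k) x - G x ord0 i) ^+ 2)%:E)%E @[k --> \oo] --> 0%E) ->
  is_weak_grad u G.
Proof.
move=> cu mG G1 tphi c1 c2.
have mu' := continuous_measurable_rV cu.
have LG i : L1loc (fun x => G x ord0 i).
  apply: (@L1loc_bounded _ 1); first exact: measurable_ord.
  by move=> x; apply: le_trans (G1 x); exact: enorm_coord_le.
have Lu := L1loc_continuous cu.
split=> // psi i tp.
have K (f : V -> R) (fk : nat -> V -> R) (q : V -> R) : test_fun q -> L1loc f ->
    (forall k, test_fun (fk k)) ->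
    (\int[mu]_x ((fk k x - f x) ^+ 2)%:E)%E @[k --> \oo] --> 0%E ->
    \int[mu]_x (fk k x * q x) @[k --> \oo] --> \int[mu]_x (f x * q x).
  move=> tq Lf tf cf.
  have mf : measurable_fun setT f by have [] := Lf.
  have md k : measurable_fun setT (fun x => fk k x - f x).
    by apply: measurable_funB => //; exact: test_measurable.
  have c := sqr_cvg0_test md cf tq.
  apply/cvgrPdist_lt => e e0.
  have := (cvge0P _).1 c _ e0 => /(_ (fun k => integral_ge0 _ _)) H.
  have {}H : \forall k \near \oo, (\int[mu]_x `|(fk k x - f x) * q x|%:E < e%:E)%E.
    by apply: H => k x _; rewrite lee_fin.
  apply: filterS H => k hk; rewrite distrC.
  have i1 : mu.-integrable setT (EFin \o (fun x => fk k x * q x)).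
    by apply: integrable_continuous_test => //; exact: test_continuous.
  have i2 := integrable_L1loc_test Lf tq.
  rewrite -RintegralB//.
  have iD := integrableB measurableT i1 i2.
  apply: le_lt_trans (le_normr_Rintegral measurableT iD) _.
  rewrite -lte_fin /Rintegral fineK; last first.
    exact: (integrable_fin_num measurableT (integrable_norm iD)).
  apply: le_lt_trans hk; rewrite le_eqVlt; apply/orP; left; apply/eqP.
  by apply: eq_integral => x _; rewrite mulrBl.
have h1 := K u phi (partial i psi) (test_partial i tp) Lu tphi c1.
have h2 := K (fun x => G x ord0 i) (fun k => partial i (phi k)) psi tp (LG i) (fun k => test_partial i (tphi k)) (c2 i).
have h3 : \int[mu]_x (phi k x * partial i psi x) @[k --> \oo] --> - \int[mu]_x (G x ord0 i * psi x).
  rewrite (_ : (fun k => _) = (fun k => - \int[mu]_x (partial i (phi k) x * psi x))).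
    by apply: cvgN.
  by apply/funext => k; rewrite integration_by_parts_test//; exact: test_smooth.
by rewrite -(cvg_lim (@Rhausdorff R) h1); exact: (cvg_lim (@Rhausdorff R) h3).
Qed.

Lemma lipX1_is_weak_grad r u G : lipX1 r u G -> is_weak_grad u G.
Proof.
move=> [cu mG G1 [phi [tp c]]].
have D0 k : (0 <= \int[mu]_x (defect r (phi k) u G x)%:E)%E.
  by apply: integral_ge0 => x _; rewrite lee_fin defect_ge0.
have mD k : measurable_fun setT (fun x => (defect r (phi k) u G x)%:E).
  apply/measurable_EFinP; apply: measurable_defect => //; first exact: test_smooth.
  exact: continuous_measurable_rV.
apply: (weak_grad_limit (phi := phi)) => // [|i].
  apply: (@cvge0_le _ _ (fun k => \int[mu]_x (defect r (phi k) u G x)%:E)%E 1) => //.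
    by move=> k; apply: integral_ge0 => x _; rewrite lee_fin sqr_ge0.
  move=> k; rewrite mul1e; apply: ge0_le_integral => //.
  - by move=> x _; rewrite lee_fin sqr_ge0.
  - apply/measurable_EFinP; apply: measurable_funX; apply: measurable_funB.
      exact: test_measurable.
    exact: continuous_measurable_rV.
  - by move=> x _; rewrite lee_fin /defect lerDl Phi_ge0.
apply: (@cvge0_le _ _ (fun k => \int[mu]_x (defect r (phi k) u G x)%:E)%E 1) => //.
  by move=> k; apply: integral_ge0 => x _; rewrite lee_fin sqr_ge0.
move=> k; rewrite mul1e; apply: ge0_le_integral => //.
- by move=> x _; rewrite lee_fin sqr_ge0.
- apply/measurable_EFinP; apply: measurable_funX; apply: measurable_funB.
    by apply: test_measurable; exact: test_partial.
  exact: measurable_ord.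
- move=> x _; rewrite lee_fin /defect /Phi.
  apply: (@le_trans _ _ (enorm (grad (phi k) x - G x) ^+ 2)).
    rewrite sqr_enorm (bigD1 i)//= !mxE lerDl; apply: sumr_ge0 => j _; exact: sqr_ge0.
  by rewrite addrCA lerDl addr_ge0 ?sqr_ge0 ?powR_ge0.
Qed.

Lemma sqr_Lnorm2 f : ('N[mu]_(2%:E)[EFin \o f] ^+ 2 = \int[mu]_x (f x ^+ 2)%:E)%E.
Proof.
have E : (\int[mu]_x (f x ^+ 2)%:E = \int[mu]_x (`|(EFin \o f) x| `^ 2))%E.
  apply: eq_integral => x _; rewrite poweR_EFin; congr EFin.
  by rewrite powR_mulrn// real_normK// num_real.
rewrite E -(@poweR_Lnorm _ _ R mu (EFin \o f) 2)//.
have := Lnorm_ge0 mu 2%:E (EFin \o f).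
case: ('N[mu]_(2%:E)[EFin \o f])%E => [t| |]//.
- by rewrite lee_fin => t0; rewrite poweR_EFin powR_mulrn// EFin_expe.
- by move=> _; rewrite poweRyr// expeS mulyy.
Qed.

Lemma Lnorm_sqr_poweR r f : 0 < r -> (forall x, 0 <= f x) ->
  ('N[mu]_(r%:E)[EFin \o f] ^+ 2 = (\int[mu]_x (f x `^ r)%:E) `^ (2 / r))%E.
Proof.
move=> r0 f0.
have E : (\int[mu]_x (f x `^ r)%:E = \int[mu]_x (`|(EFin \o f) x| `^ r))%E.
  by apply: eq_integral => x _; rewrite poweR_EFin /= ger0_norm.
rewrite E -(@poweR_Lnorm _ _ R mu (EFin \o f) r) ?gt_eqF//.
have N0 := Lnorm_ge0 mu r%:E (EFin \o f).
rewrite -poweRrM mulrC divfK ?gt_eqF//.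
move: N0; case: ('N[mu]_(r%:E)[EFin \o f])%E => [t| |]//.
- by rewrite lee_fin => t0; rewrite poweR_EFin powR_mulrn// EFin_expe.
- by move=> _; rewrite poweRyr// expeS mulyy.
Qed.

Lemma is_weak_gradB u G phi : is_weak_grad u G -> test_fun phi ->
  is_weak_grad (fun x => u x - phi x) (fun x => G x - grad phi x).
Proof.
move=> [Lu LG HG] tp; have [Lp Lgp Hp] := smooth_is_weak_grad (test_smooth tp).
split.
- exact: L1locB.
- move=> i; rewrite (_ : (fun x => _) = (fun x => G x ord0 i - grad phi x ord0 i)); first exact: L1locB.
  by apply/funext => x; rewrite !mxE.
- move=> psi i tq.
  have i1 := integrable_L1loc_test Lu (test_partial i tq).
  have i2 := integrable_L1loc_test Lp (test_partial i tq).
  have i3 := integrable_L1loc_test (LG i) tq.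
  have i4 := integrable_L1loc_test (Lgp i) tq.
  rewrite (_ : \int[mu]_x _ = \int[mu]_x (u x * partial i psi x - phi x * partial i psi x)); last first.
    by apply: eq_Rintegral => x _; rewrite mulrBl.
  rewrite [in RHS](_ : \int[mu]_x _ = \int[mu]_x (G x ord0 i * psi x - grad phi x ord0 i * psi x)); last first.
    by apply: eq_Rintegral => x _; rewrite !mxE mulrBl.
  by rewrite !RintegralB// HG// Hp// opprB opprK addrC.
Qed.

Lemma measurable_powR_comp r f : measurable_fun setT f ->
  measurable_fun setT (fun x => (f x `^ r)%:E).
Proof.
move=> mf; apply/measurable_EFinP.
by apply: (@measurableT_comp _ _ _ _ _ _ (fun t : R => t `^ r) _ f); first exact: measurable_powR.
Qed.

Lemma ae_eq_integral_powR r f g : measurable_fun setT f -> measurable_fun setT g ->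
  {ae mu, forall x, f x = g x} ->
  (\int[mu]_x (f x `^ r)%:E = \int[mu]_x (g x `^ r)%:E)%E.
Proof.
move=> mf mg fg; apply: ae_eq_integral; [exact: measurableT|exact: measurable_powR_comp|exact: measurable_powR_comp|].
by apply: filterS fg => x /= ->.
Qed.

(** The two descriptions of convergence differ by fixed powers and by the
    choice of the representative of the gradient. *)
Lemma X1norm_defect r u G (phi : nat -> V -> R) : 2 < r -> continuous u ->
  is_weak_grad u G -> measurable_fun setT G ->
  (forall k, test_fun (phi k)) ->
  (X1norm r (fun x => u x - phi k x) @[k --> \oo] --> 0%E) <->
  ((\int[mu]_x (defect r (phi k) u G x)%:E)%E @[k --> \oo] --> 0%E).
Proof.
move=> r2 cu wG mG tphi; have r0 : 0 < r by lra.
have mu' := continuous_measurable_rV cu.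
pose a k := (\int[mu]_x ((phi k x - u x) ^+ 2)%:E)%E.
pose e k x := enorm (grad (phi k) x - G x).
pose b k := (\int[mu]_x (e k x ^+ 2)%:E)%E.
pose c k := (\int[mu]_x (e k x `^ r)%:E)%E.
have me k : measurable_fun setT (e k).
  by apply: measurable_enorm; apply: measurable_rV_sub => //; apply: measurable_grad; exact: test_smooth.
have a0 k : (0 <= a k)%E by apply: integral_ge0 => x _; rewrite lee_fin sqr_ge0.
have b0 k : (0 <= b k)%E by apply: integral_ge0 => x _; rewrite lee_fin sqr_ge0.
have c0 k : (0 <= c k)%E by apply: integral_ge0 => x _; rewrite lee_fin powR_ge0.
have mer k : measurable_fun setT (fun x => (e k x `^ r)%:E).
  exact: measurable_powR_comp.
have me2 k : measurable_fun setT (fun x => (e k x ^+ 2)%:E).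
  by apply/measurable_EFinP; exact: measurable_funX.
have ma2 k : measurable_fun setT (fun x => ((phi k x - u x) ^+ 2)%:E).
  apply/measurable_EFinP; apply: measurable_funX; apply: measurable_funB => //.
  exact: test_measurable.
have DE k : (\int[mu]_x (defect r (phi k) u G x)%:E = a k + (b k + c k))%E.
  rewrite /a /b /c -ge0_integralD//; last 2 first.
  - by move=> x _; rewrite lee_fin sqr_ge0.
  - by move=> x _; rewrite lee_fin powR_ge0.
  rewrite -ge0_integralD//.
  - by move=> x _; rewrite lee_fin sqr_ge0.
  - by move=> x _; rewrite -EFinD lee_fin addr_ge0 ?sqr_ge0 ?powR_ge0.
  - exact: emeasurable_funD.
have XE k : X1norm r (fun x => u x - phi k x) = ((a k + b k + c k `^ (2 / r)) `^ 2^-1)%E.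
  rewrite /X1norm; congr (_ `^ _)%E.
  have Hn := nabla_eq (is_weak_gradB wG (tphi k)).
  have [_ Ln _] : is_weak_grad (fun x => u x - phi k x) (nabla (fun x => u x - phi k x)).
    by apply: nabla_weak_grad; exists (fun x => G x - grad (phi k) x); exact: is_weak_gradB.
  have mn : measurable_fun setT (nabla (fun x => u x - phi k x)).
    by apply: measurable_fun_rV => i; have [] := Ln i.
  have mne := measurable_enorm mn.
  have He : {ae mu, forall x, enorm (nabla (fun x => u x - phi k x) x) = e k x}.
    by apply: filterS Hn => x ->; rewrite /e enormB.
  congr (_ + _ + _)%E.
  - by rewrite sqr_Lnorm2; apply: eq_integral => x _; rewrite -sqrrN opprB.
  - rewrite sqr_Lnorm2; apply: ae_eq_integral => //.
      by apply/measurable_EFinP; exact: measurable_funX.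
    by apply: filterS He => x /= -> _.
  - have E3 := @Lnorm_sqr_poweR r (@enorm R n \o nabla (fun x => u x - phi k x)) r0 (fun x => enorm_ge0 _).
    etransitivity; first exact: E3.
    have E4 := ae_eq_integral_powR r mne (me k) He.
    by rewrite /c -E4.
under eq_cvg do rewrite XE.
under [X in _ <-> X]eq_cvg do rewrite DE.
have p0 k : (0 <= c k `^ (2 / r))%E by exact: poweR_ge0.
have ab0 k : (0 <= a k + b k)%E by apply: adde_ge0.
have bc0 k : (0 <= b k + c k)%E by apply: adde_ge0.
have h0 k : (0 <= a k + b k + c k `^ (2 / r))%E by apply: adde_ge0.
have abc k : (0 <= a k + (b k + c k))%E by apply: adde_ge0.
split=> H.
  have {}H : (a k + b k + c k `^ (2 / r))%E @[k --> \oo] --> 0%E.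
    have h2 : (0 : R) < 2 by [].
    have := cvge0_poweR h2 (fun k => poweR_ge0 _ _) H; apply: cvg_trans.
    apply: near_eq_cvg; apply: nearW => k.
    by rewrite -poweRrM mulVf// poweRe1.
  have Ha : a k @[k --> \oo] --> 0%E.
    by apply: (cvge0_le ler01 a0 h0 _ H) => k; rewrite mul1e -addeA leeDl// adde_ge0.
  have Hb : b k @[k --> \oo] --> 0%E.
    by apply: (cvge0_le ler01 b0 h0 _ H) => k; rewrite mul1e addeAC leeDr// adde_ge0.
  have Hc : c k @[k --> \oo] --> 0%E.
    have Hc' : (c k `^ (2 / r))%E @[k --> \oo] --> 0%E.
      by apply: (cvge0_le ler01 p0 h0 _ H) => k; rewrite mul1e leeDr.
    have h2 : 0 < r / 2 by rewrite divr_gt0.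
    have := cvge0_poweR h2 p0 Hc'; apply: cvg_trans.
    apply: near_eq_cvg; apply: nearW => k.
    have e1 : 2 / r * (r / 2) = 1 by rewrite mulrA divfK ?gt_eqF// divff.
    by rewrite -poweRrM e1 poweRe1.
  exact: (cvge0D Ha (cvge0D Hb Hc)).
have Ha : a k @[k --> \oo] --> 0%E.
  by apply: (cvge0_le ler01 a0 abc _ H) => k; rewrite mul1e leeDl.
have Hb : b k @[k --> \oo] --> 0%E.
  by apply: (cvge0_le ler01 b0 abc _ H) => k; rewrite mul1e addeCA leeDl// adde_ge0.
have Hc : c k @[k --> \oo] --> 0%E.
  by apply: (cvge0_le ler01 c0 abc _ H) => k; rewrite mul1e addeA leeDr// adde_ge0.
apply: cvge0_poweR => //.
have h2 : 0 < 2 / r by rewrite divr_gt0.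
exact: (cvge0D (cvge0D Ha Hb) (cvge0_poweR h2 c0 Hc)).
Qed.

Lemma lipX1_X1 r u G : 2 < r -> lipX1 r u G -> X1 r u.
Proof.
move=> r2 L; have wG := lipX1_is_weak_grad L; have [cu mG G1 [phi [tp c]]] := L.
split=> //; first by exists G.
by exists phi; split=> //; apply/(X1norm_defect r2 cu wG mG tp).
Qed.

Lemma lipX1_nabla r u G : lipX1 r u G -> {ae mu, forall x, nabla u x = G x}.
Proof. by move=> L; apply: nabla_eq; exact: lipX1_is_weak_grad L. Qed.

Lemma lipX1_DPsi0 r u G : 2 < r -> lipX1 r u G -> DPsi0 r u.
Proof.
move=> r2 L; split; first exact: lipX1_X1 L.
have [_ _ G1 _] := L.
by apply: filterS (lipX1_nabla L) => x ->.
Qed.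

(** Redefine the weak gradient as zero on the null set where its norm exceeds one. *)
Lemma DPsi0_lipX1 r u : 2 < r -> DPsi0 r u -> exists G, lipX1 r u G.
Proof.
move=> r2 [[cu [G0 wG0] [phi [tp c]]] n1].
have wn : is_weak_grad u (nabla u) by apply: nabla_weak_grad; exists G0.
have mn : measurable_fun setT (nabla u).
  by apply: measurable_fun_rV => i; have [_ Ln _] := wn; have [] := Ln i.
pose G x := if enorm (nabla u x) <= 1 then nabla u x else 0.
have mG : measurable_fun setT G.
  apply: measurable_fun_ifT => //.
  apply: measurable_fun_ler => //; exact: measurable_enorm.
have aeG : {ae mu, forall x, nabla u x = G x}.
  by apply: filterS n1 => x h; rewrite /G h.
have LG i : L1loc (fun x => G x ord0 i).
  apply: (@L1loc_bounded _ 1); first exact: measurable_ord.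
  move=> x; apply: le_trans (enorm_coord_le _ _) _; rewrite /G; case: ifP => //.
  by rewrite enorm0 ler01.
have wG : is_weak_grad u G.
  have [Lu Ln Hn] := wn; split=> // psi i tq; rewrite Hn//; congr (- fine _).
  apply: ae_eq_integral => //.
  - by apply/measurable_EFinP; apply: measurable_funM; [have [] := Ln i|exact: test_measurable].
  - by apply/measurable_EFinP; apply: measurable_funM; [have [] := LG i|exact: test_measurable].
  - by apply: filterS aeG => x /= <- _.
exists G; split=> //.
  by move=> x; rewrite /G; case: ifP => //; rewrite enorm0 ler01.
by exists phi; split=> //; apply/(X1norm_defect r2 cu wG mG tp).
Qed.

Lemma lipX1_Psi0 r u G : lipX1 r u G ->
  (Psi0 u = \int[mu]_x (1 - Num.sqrt (1 - enorm (G x) ^+ 2))%:E)%E.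
Proof.
move=> L; have aeG := lipX1_nabla L; have [_ mG G1 _] := L.
have n1 : {ae mu, forall x, enorm (nabla u x) <= 1} by apply: filterS aeG => x ->.
have wn : is_weak_grad u (nabla u).
  by apply: nabla_weak_grad; exists G; exact: lipX1_is_weak_grad L.
have mn : measurable_fun setT (nabla u).
  by apply: measurable_fun_rV => i; have [_ Ln _] := wn; have [] := Ln i.
have mI (H : V -> V) : measurable_fun setT H ->
  measurable_fun setT (fun x => (1 - Num.sqrt (1 - enorm (H x) ^+ 2))%:E).
  move=> mH; apply/measurable_EFinP; apply: measurable_funB => //.
  apply: (@measurableT_comp _ _ _ _ _ _ (@Num.sqrt R)).
    apply: continuous_measurable_fun; exact: sqrt_continuous.
  apply: measurable_funB => //; apply: measurable_funX; exact: measurable_enorm.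
rewrite /Psi0; case: asboolP => // _; apply: ae_eq_integral; [exact: measurableT|exact: mI|exact: mI|].
by apply: filterS aeG => x /= ->.
Qed.

End X1_membership.

(** * Reflections and smoothed polarization *)

Section reflection.
Context {R : realType} {n : nat}.
Notation V := 'rV[R]_n.
Notation mu := (@leb R n).
Notation e_ i := (delta_mx ord0 i : V).
Implicit Types (x y v w : V).

Lemma dotvC x y : dotv x y = dotv y x.
Proof. by apply: eq_bigr => i _; rewrite mulrC. Qed.

Lemma dotvDl x y v : dotv (x + y) v = dotv x v + dotv y v.
Proof. by rewrite /dotv -big_split; apply: eq_bigr => i _; rewrite mxE mulrDl. Qed.

Lemma dotvZl (c : R) x v : dotv (c *: x) v = c * dotv x v.
Proof. by rewrite /dotv mulr_sumr; apply: eq_bigr => i _; rewrite mxE mulrA. Qed.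

Lemma dotvNl x v : dotv (- x) v = - dotv x v.
Proof. by rewrite -scaleN1r dotvZl mulN1r. Qed.

Lemma dotvBl x y v : dotv (x - y) v = dotv x v - dotv y v.
Proof. by rewrite dotvDl dotvNl. Qed.

Lemma dotvBr x y v : dotv v (x - y) = dotv v x - dotv v y.
Proof. by rewrite ![dotv v _]dotvC dotvBl. Qed.

Lemma dotvZr (c : R) x v : dotv v (c *: x) = c * dotv v x.
Proof. by rewrite ![dotv v _]dotvC dotvZl. Qed.

Lemma dotvv x : dotv x x = enorm x ^+ 2.
Proof. by rewrite sqr_enorm; apply: eq_bigr => i _; rewrite expr2. Qed.

Lemma dotv_delta i x : dotv (e_ i) x = x ord0 i.
Proof.
rewrite /dotv (bigD1 i)//= mxE !eqxx mul1r big1 ?addr0// => j ji.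
by rewrite mxE (negbTE ji) andbF mul0r.
Qed.

Lemma sqr_enormB x y : enorm (x - y) ^+ 2 = enorm x ^+ 2 - 2 * dotv x y + enorm y ^+ 2.
Proof. by rewrite -!dotvv dotvBl !dotvBr [dotv y x]dotvC; ring. Qed.

Lemma continuous_dotv v : continuous (fun x => dotv x v).
Proof.
apply: (@Ck_continuous _ _ 0); apply: Ck_sum => i.
have h : Ck 0 (fun x : V => x ord0 i * v ord0 i).
  by apply: CkM; [exact: Ck_coord|exact: Ck_cst].
exact: h.
Qed.

Lemma eq_enorm x y : enorm x ^+ 2 = enorm y ^+ 2 -> enorm x = enorm y.
Proof. by move=> /eqP; rewrite eqrXn2 ?enorm_ge0// => /eqP. Qed.

(** For a unit vector [e], the linear part of the reflection in the hyperplane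
    [{x | dotv x e = a}], and the reflection itself. *)
Definition linrefl (e v : V) : V := v - (2 * dotv v e) *: e.
Definition refl (e : V) (a : R) (x : V) : V := x - (2 * (dotv x e - a)) *: e.

Lemma linreflB e v w : linrefl e (v - w) = linrefl e v - linrefl e w.
Proof.
by rewrite /linrefl dotvBl; apply/rowP => i; rewrite !mxE; ring.
Qed.

Lemma linreflD e v w : linrefl e (v + w) = linrefl e v + linrefl e w.
Proof. by rewrite /linrefl dotvDl; apply/rowP => i; rewrite !mxE; ring. Qed.

Lemma linreflZ e (c : R) v : linrefl e (c *: v) = c *: linrefl e v.
Proof. by rewrite /linrefl dotvZl; apply/rowP => i; rewrite !mxE; ring. Qed.

Lemma linrefl_sym e v w : dotv (linrefl e v) w = dotv v (linrefl e w).
Proof. by rewrite /linrefl dotvBl dotvBr dotvZl dotvZr [dotv e w]dotvC; ring. Qed.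

Lemma refl_shift e a x v : refl e a (v + x) = linrefl e v + refl e a x.
Proof.
by rewrite /refl /linrefl dotvDl; apply/rowP => i; rewrite !mxE; ring.
Qed.

Section unit.
Variables (e : V) (e1 : enorm e = 1) (a : R).
Notation sg := (refl e a).
Notation S := (linrefl e).

Let ee : dotv e e = 1. Proof. by rewrite dotvv e1 expr1n. Qed.

Lemma linreflK v : S (S v) = v.
Proof.
by rewrite /linrefl dotvBl dotvZl ee; apply/rowP => i; rewrite !mxE; ring.
Qed.

Lemma enorm_linrefl v : enorm (S v) = enorm v.
Proof. by apply: eq_enorm; rewrite -!dotvv linrefl_sym linreflK. Qed.

Lemma dotv_refl x : dotv (sg x) e = 2 * a - dotv x e.
Proof. by rewrite /refl dotvBl dotvZl ee; ring. Qed.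

Lemma reflK : involutive sg.
Proof.
by move=> x; rewrite {1}/refl dotv_refl /refl; apply/rowP => i; rewrite !mxE; ring.
Qed.

Lemma refl_fix x : dotv x e = a -> sg x = x.
Proof. by move=> xa; rewrite /refl xa subrr mulr0 scale0r subr0. Qed.

Lemma refl_sub x y : sg x - sg y = S (x - y).
Proof.
by have := refl_shift e a y (x - y); rewrite subrK => ->; rewrite addrK.
Qed.

Lemma enorm_refl_sub x y : enorm (sg x - sg y) = enorm (x - y).
Proof. by rewrite refl_sub enorm_linrefl. Qed.

Lemma sqr_enorm_sub_refl x y :
  enorm (x - sg y) ^+ 2 = enorm (x - y) ^+ 2 + 4 * (dotv x e - a) * (dotv y e - a).
Proof.
have -> : x - sg y = (x - y) - (- (2 * (dotv y e - a))) *: e.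
  by rewrite /refl; apply/rowP => i; rewrite !mxE; ring.
rewrite (sqr_enormB (x - y)) dotvZr enormZ e1 mulr1 real_normK ?num_real// dotvBl; ring.
Qed.

Lemma continuous_refl : continuous sg.
Proof.
move=> x; apply: (@continuousB _ _ _ id (fun x => (2 * (dotv x e - a)) *: e) x); first exact: cvg_id.
apply: (@continuousZl _ _ _ (fun x => 2 * (dotv x e - a)) e).
have h : Ck 0 (fun x => 2 * (dotv x e - a)).
  apply: CkZ; apply: CkD; [exact: continuous_dotv|exact: Ck_cst].
exact: h.
Qed.

Lemma measurable_refl : measurable_fun setT sg.
Proof.
apply: measurable_rV_sub => //; apply: measurable_rV_scale; last exact: measurable_cst.
apply: measurable_funM => //; apply: measurable_funB => //.
exact: (continuous_measurable_rV (continuous_dotv (v := e))).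
Qed.

Lemma leb_refl A : measurable A -> mu (sg @^-1` A) = mu A.
Proof.
apply: leb_involution; [exact: measurable_refl| |exact: reflK].
by move=> b; exists (S b) => x; rewrite addrC refl_shift linreflK addrC.
Qed.

Lemma Ck_refl k f : Ck k f -> Ck k (fun x => f (sg x)).
Proof.
move=> Hf; apply: (@Ck_affine _ _ k sg (fun i => S (e_ i))) => //; first exact: continuous_refl.
by move=> i h x; rewrite refl_shift linreflZ.
Qed.

Lemma smooth_refl f : smooth f -> smooth (fun x => f (sg x)).
Proof. by move=> /smoothP H; apply/smoothP => k; exact: Ck_refl. Qed.

Lemma grad_refl f x : smooth f -> grad (fun x => f (sg x)) x = S (grad f (sg x)).
Proof.
move=> sf; apply/rowP => i; rewrite mxE.
have [_ E] := smooth_dir (sg x) (S (e_ i)) sf.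
have E2 : (fun h : R => h^-1 *: (((fun x => f (sg x)) \o shift x) (h *: e_ i) - f (sg x))) =
    (fun h : R => h^-1 *: ((f \o shift (sg x)) (h *: S (e_ i)) - f (sg x))).
  by apply/funext => h /=; rewrite refl_shift linreflZ.
have -> : partial i (fun x => f (sg x)) x = 'D_(S (e_ i)) f (sg x).
  by rewrite /partial /derive E2.
rewrite E -[RHS]dotv_delta -linrefl_sym.
by apply: eq_bigr => j _; congr (_ * _); rewrite mxE.
Qed.

Lemma test_refl f : test_fun f -> test_fun (fun x => f (sg x)).
Proof.
move=> tf; have [M M0 HM] := test_support tf.
have cn : continuous (fun x => `|sg x|).
  move=> x; apply: (@continuous_comp _ _ _ sg (fun v : V => `|v|)).
    exact: continuous_refl.
  exact: norm_continuous.
have [C C0 HC] := bounded_on_cube M cn.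
apply: (test_intro (M := C)); first exact/smooth_refl/test_smooth.
move=> x xC; apply: HM; rewrite ltNge; apply/negP => /HC.
by rewrite normr_id reflK leNgt xC.
Qed.

(** Averaging over the two-point orbits of the reflection. *)
Lemma integral_le_refl (g h : V -> R) : measurable_fun setT g -> measurable_fun setT h ->
  (forall x, 0 <= g x) -> (forall x, 0 <= h x) ->
  (forall x, g x + g (sg x) <= h x + h (sg x)) ->
  (\int[mu]_x (g x)%:E <= \int[mu]_x (h x)%:E)%E.
Proof.
move=> mg mh g0 h0 gh.
have mE (f : V -> R) : measurable_fun setT f -> measurable_fun setT (fun x => (f x)%:E).
  by move=> mf; exact/measurable_EFinP.
have ms (f : V -> R) : measurable_fun setT f -> measurable_fun setT (fun x => (f (sg x))%:E).
  by move=> mf; apply/measurable_EFinP; exact: measurableT_comp measurable_refl.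
have D (f : V -> R) : measurable_fun setT f -> (forall x, 0 <= f x) ->
   (\int[mu]_x ((f x)%:E + (f (sg x))%:E) = \int[mu]_x (f x)%:E + \int[mu]_x (f x)%:E)%E.
  move=> mf f0.
  have p1 x : setT x -> (0 <= (f x)%:E)%E by rewrite lee_fin.
  have p2 x : setT x -> (0 <= (f (sg x))%:E)%E by rewrite lee_fin.
  have E := integral_mpres measurable_refl leb_refl (mE _ mf).
  rewrite (ge0_integralD mu measurableT p1 (mE _ mf) p2 (ms _ mf)).
  by congr (_ + _)%E; exact: E.
have : (\int[mu]_x ((g x)%:E + (g (sg x))%:E) <= \int[mu]_x ((h x)%:E + (h (sg x))%:E))%E.
  apply: ge0_le_integral => //.
  - by move=> x _; rewrite -EFinD lee_fin addr_ge0.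
  - by apply: emeasurable_funD; [exact: mE|exact: ms].
  - by apply: emeasurable_funD; [exact: mE|exact: ms].
  - by move=> x _; rewrite -!EFinD lee_fin.
rewrite !D//.
have i0 : (0 <= \int[mu]_x (g x)%:E)%E by apply: integral_ge0 => x _; rewrite lee_fin.
have j0 : (0 <= \int[mu]_x (h x)%:E)%E by apply: integral_ge0 => x _; rewrite lee_fin.
move: i0 j0; case: (\int[mu]_x (g x)%:E)%E => [s| |]; case: (\int[mu]_x (h x)%:E)%E => [t| |] //=.
- by rewrite -!EFinD !lee_fin => _ _; lra.
- by move=> *; rewrite leey.
Qed.

End unit.
End reflection.

Section polarization.
Context {R : realType} {n : nat}.
Notation V := 'rV[R]_n.
Notation mu := (@leb R n).
Variables (e : V) (e1 : enorm e = 1) (a : R) (d : R) (d0 : 0 < d).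
Notation sg := (refl e a).
Notation S := (linrefl e).
Notation j := (softabs d).
Notation j' := (derive1 (softabs d)).
Implicit Types (u phi : V -> R) (G : V -> V).

Definition side x : R := if a < dotv x e then 1 else -1.

(** Polarization with [|.|] smoothed near zero: since [softabs d] vanishes
    near zero, the sign jump of [side] on the mirror is not seen. *)
Definition polar u x : R := 2^-1 * (u x + u (sg x)) + 2^-1 * (side x * j (u x - u (sg x))).

Definition polar_grad u G x : V :=
  2^-1 *: (G x + S (G (sg x))) +
  (2^-1 * (side x * j' (u x - u (sg x)))) *: (G x - S (G (sg x))).

Lemma norm_side x : `|side x| = 1.
Proof. by rewrite /side; case: ifP => _; rewrite ?normrN normr1. Qed.

Lemma derive1_softabs_odd s : j' (- s) = - j' s.
Proof. by rewrite !derive1_softabs// mulrNN [d^-1 * - s]mulrN -mulNr opprB. Qed.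

Lemma derive1_softabs0 : j' 0 = 0.
Proof. by rewrite derive1_softabs// !mulr0 subrr. Qed.

Lemma softabs_lip s t : `|j s - j t| <= `|s - t|.
Proof.
wlog st : s t / t <= s.
  move=> H; have [st|/ltW st] := leP t s; first exact: H.
  by rewrite distrC [X in _ <= X]distrC; exact: H.
have dj (v : R) : is_derive v 1 j (j' v).
  have [dv _] := C1k_softabs d 1; split; first exact: dv.
  by rewrite derive1E.
have c : {within `[t, s], continuous j}.
  by apply: derivable_within_continuous => v _; have [] := dj v.
have [c0 _ ->] := MVT_segment st (fun z _ => dj z) c.
by rewrite normrM ler_piMl//; exact: derive1_softabs_le1.
Qed.

Let diff u x := u x - u (sg x).

Let Ck_diff k u : Ck k u -> Ck k (diff u).
Proof. by move=> Hu; apply: CkD => //; apply: CkN; exact: Ck_refl. Qed.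

(** Locally the sign [side] can be replaced by a constant: off the mirror it is
    constant, and near the mirror the factor [softabs d] vanishes. *)
Let side_local u x : continuous u -> exists c : R,
  (\forall y \near x, side y * j (diff u y) = c * j (diff u y)) /\
  side x * j' (diff u x) = c * j' (diff u x).
Proof.
move=> cu.
have cd : continuous (fun y => dotv y e) := continuous_dotv (v := e).
have [xa|xa|xa] := ltgtP (dotv x e) a.
- exists (-1); split; last by rewrite /side ltNge (ltW xa).
  have o : open ((fun y => dotv y e) @^-1` [set t | t < a]).
    by apply: open_comp; [move=> y _; exact: cd|exact: open_lt].
  have := open_nbhs_nbhs (conj o (xa : _ x)); apply: filterS => y /= ya.
  by rewrite /side ltNge (ltW ya).
- exists 1; split; last by rewrite /side xa.
  have o : open ((fun y => dotv y e) @^-1` [set t | a < t]).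
    by apply: open_comp; [move=> y _; exact: cd|exact: open_gt].
  have := open_nbhs_nbhs (conj o (xa : _ x)); apply: filterS => y /= ya.
  by rewrite /side ya.
- exists 0.
  have dx0 : diff u x = 0 by rewrite /diff refl_fix// subrr.
  split; last by rewrite dx0 derive1_softabs0 !mulr0.
  have cdu : continuous (diff u) by exact: (Ck_diff (k := 0)).
  have : \forall y \near x, `|diff u x - diff u y| < d.
    have := cdu x; move/cvgrPdist_lt => /(_ _ d0); exact.
  apply: filterS => y; rewrite dx0 sub0r normrN => h.
  by rewrite softabs_eq0 ?mulr0// ltW.
Qed.

Lemma Ck_polar k u : Ck k u -> Ck k (polar u).
Proof.
move=> Hu; have cu := Ck_continuous Hu.
apply: CkD; first by apply: CkZ; apply: CkD => //; exact: Ck_refl.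
apply: CkZ; apply: Ck_local => x; have [c [hc _]] := side_local x cu.
exists (fun y => c * j (diff u y)); split => //.
by apply: CkZ; apply: (Ck_comp (C1k_softabs d k)); exact: Ck_diff.
Qed.

Lemma smooth_polar phi : smooth phi -> smooth (polar phi).
Proof. by move=> /smoothP H; apply/smoothP => k; exact: Ck_polar. Qed.

Lemma continuous_polar u : continuous u -> continuous (polar u).
Proof. by move=> cu; exact: (@Ck_polar 0 u cu). Qed.

Lemma test_polar phi : test_fun phi -> test_fun (polar phi).
Proof.
move=> tp; have tr := test_refl e1 a tp.
have [M _ HM] := test_support tp; have [M' _ HM'] := test_support tr.
apply: (test_intro (M := Num.max M M')); first exact/smooth_polar/test_smooth.
move=> x; rewrite gt_max => /andP[/HM h1 /HM' h2].
rewrite /polar h1 h2 subrr softabs_eq0 ?mulr0 ?addr0 ?mulr0//.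
by rewrite normr0 ltW.
Qed.

Lemma grad_polar phi x : smooth phi -> grad (polar phi) x = polar_grad phi (grad phi) x.
Proof.
move=> sp; have cp := smooth_continuous sp; have sr := smooth_refl e a sp.
have sd : smooth (diff phi) := smoothD sp (smoothN sr).
have [c [hc1 hc2]] := side_local x cp.
have sj : smooth (j \o diff phi) := smooth_comp (C1k_softabs d) sd.
pose q y := side y * j (diff phi y).
have sq : smooth q.
  apply/smoothP => k; apply: Ck_local => y; have [b [hb _]] := side_local y cp.
  exists (fun y => b * j (diff phi y)); split => //.
  by apply: CkZ; exact: ((smoothP _).1 sj k).
apply/rowP => i; rewrite mxE.
have E1 : partial i (polar phi) x = 2^-1 * (partial i phi x + partial i (fun x => phi (sg x)) x)
     + 2^-1 * partial i q x.
  have s1 := smoothD sp sr; have s2 := smoothZ 2^-1 s1; have s3 := smoothZ 2^-1 sq.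
  by rewrite (partialD i x s2 s3) (partialZ 2^-1 i x s1) (partialD i x sp sr) (partialZ 2^-1 i x sq).
have E2 : partial i q x = side x * j' (diff phi x) * (partial i phi x - partial i (fun x => phi (sg x)) x).
  rewrite (@partial_local _ _ q (fun y => c * (j \o diff phi) y))//.
  have [dj _] := C1k_softabs d 1.
  rewrite (partialZ c i x sj) (partial_comp i (dj _) sd) mulrA -hc2.
  by rewrite (partialD i x sp (smoothN sr)) (partialN i x sr).
have E3 : partial i (fun x => phi (sg x)) x = S (grad phi (sg x)) ord0 i.
  by rewrite -grad_refl// mxE.
rewrite E1 E2 E3 /polar_grad !mxE /diff !mulrA; congr (_ + _).
Qed.

Lemma measurable_side : measurable_fun setT side.
Proof.
apply: measurable_fun_ifT => //; apply: measurable_fun_ltr => //.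
exact: (continuous_measurable_rV (continuous_dotv (v := e))).
Qed.

Lemma measurable_polar_grad u G : continuous u -> measurable_fun setT G ->
  measurable_fun setT (polar_grad u G).
Proof.
move=> cu mG; have ms := measurable_refl e a.
have mGs : measurable_fun setT (fun x => G (sg x)) := measurableT_comp mG ms.
have mS : measurable_fun setT (fun x => S (G (sg x))).
  apply: measurable_rV_sub => //; apply: measurable_rV_scale; last exact: measurable_cst.
  by apply: measurable_funM => //; apply: measurable_dotv => //; exact: measurable_cst.
apply: measurable_rV_add.
  apply: (@measurable_rV_scale _ _ _ _ (cst 2^-1)) => //; exact: measurable_rV_add.
apply: measurable_rV_scale; last exact: measurable_rV_sub.
apply: measurable_funM => //; apply: measurable_funM; first exact: measurable_side.
apply: (@measurableT_comp _ _ _ _ _ _ j').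
  have [_ cj] := C1k_softabs d 1; exact: continuous_measurable_fun.
exact: (continuous_measurable_rV (Ck_diff (k := 0) cu)).
Qed.

(** [polar_grad u G] is, at [x] and at its mirror image, a convex combination
    of the two gradients with the same weights exchanged. *)
Definition weight u x : R := 2^-1 * (1 + side x * j' (diff u x)).

Lemma weight_itv u x : 0 <= weight u x <= 1.
Proof.
have : `|side x * j' (diff u x)| <= 1.
  by rewrite normrM norm_side mul1r; exact: derive1_softabs_le1.
by rewrite ler_norml /weight => /andP[? ?]; apply/andP; split; lra.
Qed.

Lemma polar_gradE u G x :
  polar_grad u G x = weight u x *: G x + (1 - weight u x) *: S (G (sg x)).
Proof.
rewrite /polar_grad /weight /diff; move: (side x * _) (G x) (S _) => c v w.
rewrite scalerDr scalerBr addrACA -scalerDl -scalerBl.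
by congr (_ *: _ + _ *: _); field.
Qed.

Lemma weight_refl u x : weight u (sg x) = weight u x.
Proof.
have E : diff u (sg x) = - diff u x by rewrite /diff (reflK e1) opprB.
rewrite /weight E derive1_softabs_odd mulrN -mulNr; congr (_ * (1 + _)).
have [xa|xa|xa] := ltgtP (dotv x e) a.
- by rewrite /side dotv_refl// [a < dotv x e]ltNge (ltW xa) (_ : a < _)//; lra.
- by rewrite /side dotv_refl// xa ltNge (_ : _ <= a)//= ?opprK//; lra.
- by rewrite /diff refl_fix// subrr derive1_softabs0 !mulr0.
Qed.

Lemma polar_grad_refl u G x :
  polar_grad u G (sg x) = S ((1 - weight u x) *: G x + weight u x *: S (G (sg x))).
Proof.
rewrite polar_gradE weight_refl reflK// linreflD !linreflZ linreflK// addrC.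
by [].
Qed.

End polarization.

(** * Admissible functions: smoothed modulus, polarization, scaling *)

Section operations.
Context {R : realType} {n : nat}.
Notation V := 'rV[R]_n.
Notation mu := (@leb R n).
Implicit Types (u phi : V -> R) (G : V -> V).

Let Phi_lip (r L s t : R) : 2 <= r -> 0 <= t <= 2 -> t <= L * `|s| ->
  Phi r t <= PhiC r * (L ^+ 2 * s ^+ 2).
Proof.
move=> r2 /andP[t0 t2] tL.
have h : Phi r t <= PhiC r * t ^+ 2 by apply: Phi_small => //; rewrite t0.
apply: (le_trans h); apply: ler_wpM2l; first exact: PhiC_ge0.
rewrite -(real_normK (num_real s)) -exprMn; rewrite ler_sqr ?nnegrE//.
exact: le_trans tL.
Qed.

Let sqrB_le (p q : R) : (p - q) ^+ 2 <= 2 * (p ^+ 2 + q ^+ 2).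
Proof. by have := sqr_ge0 (p + q); nra. Qed.

Let chain (K a a' b1 b2 b c c' e e' f : R) : 0 <= K -> a <= a' ->
  b <= K * (b1 + b2) -> b1 <= K * (c + e) -> c <= c' -> e <= e' -> b2 <= f ->
  a + b <= a' + K * (K * (c' + e') + f).
Proof.
move=> K0 ha hb h1 hc he hf; apply: lerD => //; apply: (le_trans hb).
apply: ler_wpM2l => //; apply: lerD => //; apply: (le_trans h1).
by apply: ler_wpM2l => //; exact: lerD.
Qed.

Let comb1 (K B p q : R) : 0 <= K -> 0 <= B -> 0 <= p -> 0 <= q ->
  q + (K * p + B * q) <= (1 + K + B) * (q + p + (q + p)).
Proof.
move=> K0 B0 p0 q0; have := mulr_ge0 K0 q0; have := mulr_ge0 B0 p0.
by have := mulr_ge0 K0 p0; have := mulr_ge0 B0 q0; nra.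
Qed.

Let comb2 (K L s t y z : R) : 0 <= K -> 0 <= L -> 0 <= s -> 0 <= t -> 0 <= y -> 0 <= z ->
  2 * (s + t) + K * (K * (y + z) + K * (2 * L * (s + t))) <=
  (2 + K * K + K * (K * (2 * L))) * (s + y + (t + z)).
Proof.
move=> K0 L0 s0 t0 y0 z0.
have k0 := mulr_ge0 K0 K0; have b0 : 0 <= K * (K * (2 * L)) by rewrite !mulr_ge0.
rewrite -subr_ge0.
have -> : (2 + K * K + K * (K * (2 * L))) * (s + y + (t + z)) -
  (2 * (s + t) + K * (K * (y + z) + K * (2 * L * (s + t)))) =
  2 * (y + z) + K * K * (s + t) + K * (K * (2 * L)) * (y + z) by ring.
by rewrite !addr_ge0 ?(mulr_ge0 k0) ?(mulr_ge0 b0) ?addr_ge0 ?mulr_ge0 ?addr_ge0.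
Qed.

Let enorm_scale_le (c : R) (v : V) : `|c| <= 1 -> enorm (c *: v) <= enorm v.
Proof. by move=> c1; rewrite enormZ ler_piMl ?enorm_ge0. Qed.

Lemma lipX1_scale r u G (th : R) : 2 <= r -> 0 <= th <= 1 -> lipX1 r u G ->
  lipX1 r (fun x => th * u x) (fun x => th *: G x).
Proof.
move=> r2 /andP[t0 t1] L; have [cu mG G1 _] := L.
have th1 : `|th| <= 1 by rewrite ger0_norm.
apply: (@lipX1_transfer R n r u G _ _ id 1) => //.
- by move=> x; exact: (continuousM (cvg_cst _) (cu x)).
- by apply: (@measurable_rV_scale _ _ _ _ (cst th)).
- by move=> x; apply: (le_trans (enorm_scale_le _ th1)).
move=> phi tp; exists (fun x => th * phi x); first exact: testZ.
move=> x; have sp := test_smooth tp.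
have Eg : grad (fun x => th * phi x) x = th *: grad phi x.
  by apply/rowP => i; rewrite !mxE partialZ.
rewrite mul1r /defect Eg -mulrBr -scalerBr exprMn.
have h1 : th ^+ 2 * (phi x - u x) ^+ 2 <= (phi x - u x) ^+ 2.
  by rewrite ler_piMl ?sqr_ge0// expr_le1.
have h2 : Phi r (enorm (th *: (grad phi x - G x))) <= Phi r (enorm (grad phi x - G x)).
  by apply: Phi_mono; [lra|exact: enorm_ge0|exact: enorm_scale_le].
by rewrite (le_trans (lerD h1 h2))// lerDl addr_ge0 ?sqr_ge0 ?Phi_ge0.
Qed.

Section with_d.
Variables (d : R) (d0 : 0 < d).
Notation j := (softabs d).
Notation j' := (derive1 (softabs d)).

(** Chain rule.  The gradients differ by a term in which the increment of the
    derivative of [softabs d], Lipschitz in the increment of [u], multiplies the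
    bounded vector [G]. *)
Lemma lipX1_softabs r u G : 2 <= r -> lipX1 r u G ->
  lipX1 r (fun x => j (u x)) (fun x => j' (u x) *: G x).
Proof.
move=> r2 L; have [cu mG G1 _] := L.
have r0 : 0 <= r by lra.
have [dj cj'] := C1k_softabs d 1.
have cj := C1k_continuous (C1k_softabs d 1).
have mu' := continuous_measurable_rV cu.
pose K := PhiC r; have K0 : 0 <= K := PhiC_ge0 r.
pose Lp := 12 / d; have L0 : 0 <= Lp by rewrite divr_ge0 ?ltW.
pose C := 1 + K + K * (K * Lp ^+ 2).
have KLp : 0 <= K * (K * Lp ^+ 2) by apply: mulr_ge0 => //; apply: mulr_ge0 => //; exact: sqr_ge0.
have C0 : 0 <= C by rewrite /C; lra.
apply: (@lipX1_transfer R n r u G _ _ id C) => //.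
- by move=> x; apply: continuous_comp; [exact: cu|exact: cj].
- apply: measurable_rV_scale => //; apply: (@measurableT_comp _ _ _ _ _ _ j') => //.
  exact: continuous_measurable_fun.
- by move=> x; apply: (le_trans (enorm_scale_le _ (derive1_softabs_le1 d0 _))).
move=> phi tp; have sp := test_smooth tp; exists (j \o phi).
  have [M _ HM] := test_support tp; apply: (test_intro (M := M)).
    exact: smooth_comp (C1k_softabs d) sp.
  by move=> x /HM h; rewrite /= h softabs_eq0// normr0 ltW.
move=> x.
have Eg : grad (j \o phi) x = j' (phi x) *: grad phi x.
  by apply/rowP => i; rewrite !mxE (partial_comp i (dj _) sp).
rewrite /defect Eg /=.
set s := phi x - u x; set P := grad phi x - G x.
have E : j' (phi x) *: grad phi x - j' (u x) *: G x =
   j' (phi x) *: P + (j' (phi x) - j' (u x)) *: G x.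
  by rewrite /P; apply/rowP => i; rewrite !mxE; ring.
have h1 : (j (phi x) - j (u x)) ^+ 2 <= s ^+ 2.
  rewrite -(real_normK (num_real (j _ - _))) -(real_normK (num_real s)).
  by rewrite ler_sqr ?nnegrE//; exact: softabs_lip.
have h2 : Phi r (enorm (j' (phi x) *: P)) <= Phi r (enorm P).
  by apply: Phi_mono; [lra|exact: enorm_ge0|apply: enorm_scale_le; exact: derive1_softabs_le1].
have h3 : Phi r (enorm ((j' (phi x) - j' (u x)) *: G x)) <= K * (Lp ^+ 2 * s ^+ 2).
  have l2 : `|j' (phi x) - j' (u x)| <= 2.
    apply: (le_trans (ler_normB _ _)).
    exact: (lerD (derive1_softabs_le1 d0 (phi x)) (derive1_softabs_le1 d0 (u x))).
  have l3 : enorm ((j' (phi x) - j' (u x)) *: G x) <= `|j' (phi x) - j' (u x)|.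
    by rewrite enormZ ler_piMr.
  apply: Phi_lip => //; first by rewrite enorm_ge0/= (le_trans l3).
  by apply: (le_trans l3); exact: derive1_softabs_lip.
have h4 := Phi_enormD (j' (phi x) *: P) ((j' (phi x) - j' (u x)) *: G x) r0.
rewrite E -/K in h4 *.
have h5 : K * (Phi r (enorm (j' (phi x) *: P)) + Phi r (enorm ((j' (phi x) - j' (u x)) *: G x))) <=
   K * (Phi r (enorm P) + K * (Lp ^+ 2 * s ^+ 2)) by rewrite ler_wpM2l// lerD.
have s0 := sqr_ge0 s; have P0 := Phi_ge0 r (enorm P).
have h6 : (j (phi x) - j (u x)) ^+ 2 + Phi r (enorm (j' (phi x) *: P + (j' (phi x) - j' (u x)) *: G x)) <=
   s ^+ 2 + K * (Phi r (enorm P) + K * (Lp ^+ 2 * s ^+ 2)).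
  by apply: lerD => //; exact: le_trans h5.
apply: (le_trans h6).
have -> : K * (Phi r (enorm P) + K * (Lp ^+ 2 * s ^+ 2)) = K * Phi r (enorm P) + (K * (K * Lp ^+ 2)) * s ^+ 2 by ring.
exact: comb1.
Qed.

Section with_e.
Variables (e : V) (e1 : enorm e = 1) (a : R).
Notation sg := (refl e a).
Notation S := (linrefl e).
Notation side := (side e a).
Notation polar := (polar e a d).
Notation polar_grad := (polar_grad e a d).
Notation weight := (weight e a d).

Let convex_sqr (c : R) (v w : V) : 0 <= c <= 1 ->
  enorm (c *: v + (1 - c) *: w) ^+ 2 <= c * enorm v ^+ 2 + (1 - c) * enorm w ^+ 2.
Proof.
move=> /andP[c0 c1]; rewrite !sqr_enorm !mulr_sumr -big_split ler_sum// => i _.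
rewrite !mxE /=; move: (v _ i) (w _ i) => p q.
have : 0 <= c * (1 - c) * (p - q) ^+ 2 by apply: mulr_ge0; [apply: mulr_ge0 => //; rewrite subr_ge0|exact: sqr_ge0].
nra.
Qed.

Lemma enorm_polar_grad u G x : (forall x, enorm (G x) <= 1) -> enorm (polar_grad u G x) <= 1.
Proof.
move=> G1; rewrite polar_gradE//.
have w := weight_itv e a d0 u x; have /andP[w0 w1] := w.
have := convex_sqr (G x) (S (G (sg x))) w; rewrite enorm_linrefl// => h.
have g1 : enorm (G x) ^+ 2 <= 1 by rewrite expr_le1 ?enorm_ge0.
have g2 : enorm (G (sg x)) ^+ 2 <= 1 by rewrite expr_le1 ?enorm_ge0.
rewrite -(@expr_le1 _ 2)// ?enorm_ge0//; apply: (le_trans h).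
move: w0 w1 g1 g2; move: (weight u x) (enorm _ ^+ 2) (enorm _ ^+ 2) => c p q; nra.
Qed.

(** As for [lipX1_softabs]: the weights of the convex combination that is the
    polarized gradient are Lipschitz in [u], and they multiply bounded vectors. *)
Lemma lipX1_polar r u G : 2 <= r -> lipX1 r u G -> lipX1 r (polar u) (polar_grad u G).
Proof.
move=> r2 L; have [cu mG G1 _] := L.
have r0 : 0 <= r by lra.
pose K := PhiC r; have K0 : 0 <= K := PhiC_ge0 r.
pose Lp := 12 / d; have L0 : 0 <= Lp by rewrite divr_ge0 ?ltW.
pose B := K * (K * (2 * Lp ^+ 2)).
have B0 : 0 <= B.
  apply: mulr_ge0 => //; apply: mulr_ge0 => //; apply: mulr_ge0 => //; exact: sqr_ge0.
pose C := 2 + K * K + B.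
have K2 : 0 <= K * K by exact: mulr_ge0.
have C0 : 0 <= C by rewrite /C; lra.
apply: (@lipX1_transfer R n r u G _ _ sg C) => //.
- exact: measurable_refl.
- by move=> A mA; exact: leb_refl.
- exact: continuous_polar.
- exact: measurable_polar_grad.
- by move=> x; exact: enorm_polar_grad.
move=> phi tp; have sp := test_smooth tp; exists (polar phi); first exact: test_polar.
move=> x; rewrite /defect (grad_polar e a d0 x sp) /polar.
set p := phi x - u x; set q := phi (sg x) - u (sg x).
set P := grad phi x - G x; set Q0 := grad phi (sg x) - G (sg x); pose Q := S Q0.
pose D := phi x - phi (sg x); pose D' := u x - u (sg x).
have DD : D - D' = p - q by rewrite /D /D' /p /q; ring.
have ns := norm_side e a x.
have h1 : (2^-1 * (phi x + phi (sg x)) + 2^-1 * (side x * j (phi x - phi (sg x))) -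
   (2^-1 * (u x + u (sg x)) + 2^-1 * (side x * j (u x - u (sg x))))) ^+ 2 <= 2 * (p ^+ 2 + q ^+ 2).
  rewrite -/D -/D'.
  have -> : 2^-1 * (phi x + phi (sg x)) + 2^-1 * (side x * j D) -
    (2^-1 * (u x + u (sg x)) + 2^-1 * (side x * j D')) = 2^-1 * (p + q) + 2^-1 * (side x * (j D - j D')).
    by rewrite /p /q; ring.
  have l : (side x * (j D - j D')) ^+ 2 <= (p - q) ^+ 2.
    rewrite -(real_normK (num_real (side x * _))) normrM ns mul1r -(real_normK (num_real (p - q))).
    by rewrite ler_sqr ?nnegrE// -DD; exact: softabs_lip.
  move: (side x * _) l => z l.
  have := sqr_ge0 (p + q - z); nra.
have h2 : polar_grad phi (grad phi) x - polar_grad u G x =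
   (weight phi x *: P + (1 - weight phi x) *: Q) +
    (2^-1 * (side x * (j' D - j' D'))) *: (G x - S (G (sg x))).
  rewrite (polar_gradE e a d phi) (polar_gradE e a d u) /weight /Q /P /Q0 linreflB -/D -/D'.
  apply/rowP => i; rewrite !mxE.
  move: (S (grad phi (sg x)) ord0 i) (S (G (sg x)) ord0 i) => c1 c2.
  by field.
have w := weight_itv e a d0 phi x; have /andP[w0 w1] := w.
have h3 : Phi r (enorm (weight phi x *: P)) <= Phi r (enorm P).
  by apply: Phi_mono; [lra|exact: enorm_ge0|apply: enorm_scale_le; rewrite ger0_norm].
have h4 : Phi r (enorm ((1 - weight phi x) *: Q)) <= Phi r (enorm Q0).
  rewrite -(enorm_linrefl e1 Q0).
  by apply: Phi_mono; [lra|exact: enorm_ge0|apply: enorm_scale_le; rewrite ger0_norm ?subr_ge0// gerBl].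
have h5 : Phi r (enorm ((2^-1 * (side x * (j' D - j' D'))) *: (G x - S (G (sg x))))) <=
   K * (2 * Lp ^+ 2 * (p ^+ 2 + q ^+ 2)).
  have l1 : enorm (G x - S (G (sg x))) <= 2.
    apply: (le_trans (enormD_max _ _)); rewrite enormN enorm_linrefl//.
    by rewrite -[X in _ <= X]mulr1 ler_pM2l// ge_max !G1.
  have l2 : `|j' D - j' D'| <= 2.
    apply: (le_trans (ler_normB _ _)).
    exact: (lerD (derive1_softabs_le1 d0 D) (derive1_softabs_le1 d0 D')).
  have l3 : enorm ((2^-1 * (side x * (j' D - j' D'))) *: (G x - S (G (sg x)))) <= `|j' D - j' D'|.
    rewrite enormZ !normrM ns mul1r gtr0_norm ?invr_gt0// mulrC mulrA.
    by rewrite ler_piMl// ler_pdivrMr// mul1r.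
  have l4 := derive1_softabs_lip d0 D D'.
  have l5 : Phi r (enorm ((2^-1 * (side x * (j' D - j' D'))) *: (G x - S (G (sg x))))) <=
     K * (Lp ^+ 2 * (D - D') ^+ 2).
    apply: Phi_lip => //; first by rewrite enorm_ge0/= (le_trans l3).
    exact: le_trans l4.
  apply: (le_trans l5); apply: ler_wpM2l => //; rewrite DD.
  have -> : 2 * Lp ^+ 2 * (p ^+ 2 + q ^+ 2) = Lp ^+ 2 * (2 * (p ^+ 2 + q ^+ 2)) by ring.
  by apply: ler_wpM2l; [exact: sqr_ge0|exact: sqrB_le].
rewrite h2.
have h6 := Phi_enormD (weight phi x *: P + (1 - weight phi x) *: Q)
   ((2^-1 * (side x * (j' D - j' D'))) *: (G x - S (G (sg x)))) r0.
have h7 := Phi_enormD (weight phi x *: P) ((1 - weight phi x) *: Q) r0.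
rewrite -/K in h6 h7.
have p0 := sqr_ge0 p; have q0 := sqr_ge0 q.
have P0 := Phi_ge0 r (enorm P); have Q00 := Phi_ge0 r (enorm Q0).
apply: (@le_trans _ _ (2 * (p ^+ 2 + q ^+ 2) + K * (K * (Phi r (enorm P) + Phi r (enorm Q0)) +
   K * (2 * Lp ^+ 2 * (p ^+ 2 + q ^+ 2))))).
  exact: (chain K0 h1 h6 h7 h3 h4 h5).
exact: comb2 K0 (sqr_ge0 Lp) p0 q0 P0 Q00.
Qed.

(** The integrand of [Psi_0], a convex increasing function of [|xi|^2]. *)
Definition born (v : V) : R := 1 - Num.sqrt (1 - enorm v ^+ 2).

Lemma born_itv v : enorm v <= 1 -> 0 <= born v <= enorm v ^+ 2.
Proof.
move=> v1; have s1 : enorm v ^+ 2 <= 1 by rewrite expr_le1 ?enorm_ge0.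
rewrite /born; move: (enorm v ^+ 2) (sqr_ge0 (enorm v)) s1 => s s0 s1.
have h0 := sqrtr_ge0 (1 - s).
have h := @sqr_sqrtr _ (1 - s) _; rewrite subr_ge0 in h; have {}h := h s1.
move: (Num.sqrt _) h0 h => t t0 h; have t1 : t <= 1 by nra.
by apply/andP; split; nra.
Qed.

Lemma born_ge0 v : 0 <= born v.
Proof.
rewrite /born; have s0 := sqr_ge0 (enorm v); rewrite subr_ge0.
by rewrite -[X in _ <= X]sqrtr1 ler_wsqrtr//; lra.
Qed.

Lemma born_mono v w : enorm v <= enorm w -> born v <= born w.
Proof.
move=> vw; rewrite /born lerD2l lerN2 ler_wsqrtr// lerD2l lerN2.
by rewrite ler_sqr ?nnegrE ?enorm_ge0.
Qed.

Lemma born_convex (c : R) v w : 0 <= c <= 1 -> enorm v <= 1 -> enorm w <= 1 ->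
  born (c *: v + (1 - c) *: w) <= c * born v + (1 - c) * born w.
Proof.
move=> c01 v1 w1; have h := convex_sqr v w c01; have /andP[c0 c1] := c01.
have s1 : enorm v ^+ 2 <= 1 by rewrite expr_le1 ?enorm_ge0.
have s2 : enorm w ^+ 2 <= 1 by rewrite expr_le1 ?enorm_ge0.
rewrite /born.
set x := enorm v ^+ 2 in h s1 *; set y := enorm w ^+ 2 in h s2 *; set z := enorm _ ^+ 2 in h *.
have hx := @sqr_sqrtr _ (1 - x) _; rewrite subr_ge0 in hx; have {}hx := hx s1.
have hy := @sqr_sqrtr _ (1 - y) _; rewrite subr_ge0 in hy; have {}hy := hy s2.
have x0 := sqrtr_ge0 (1 - x); have y0 := sqrtr_ge0 (1 - y).
have : c * Num.sqrt (1 - x) + (1 - c) * Num.sqrt (1 - y) <= Num.sqrt (1 - z).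
  rewrite -(@ger0_norm _ (c * Num.sqrt (1 - x) + (1 - c) * Num.sqrt (1 - y))); last first.
    by rewrite addr_ge0 ?mulr_ge0//; lra.
  rewrite -sqrtr_sqr ler_wsqrtr//.
  move: (Num.sqrt (1 - x)) (Num.sqrt (1 - y)) x0 y0 hx hy => p q p0 q0 hx hy.
  have : 0 <= c * (1 - c) * (p - q) ^+ 2 by apply: mulr_ge0; [apply: mulr_ge0 => //; rewrite subr_ge0|exact: sqr_ge0].
  nra.
lra.
Qed.

Lemma measurable_born (G : V -> V) : measurable_fun setT G ->
  measurable_fun setT (fun x => born (G x)).
Proof.
move=> mG; apply: measurable_funB => //.
apply: (@measurableT_comp _ _ _ _ _ _ (@Num.sqrt R)).
  apply: continuous_measurable_fun; exact: sqrt_continuous.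
apply: measurable_funB => //; apply: measurable_funX; exact: measurable_enorm.
Qed.

(** On an orbit of the reflection the two polarized gradients are convex
    combinations of the two original ones with complementary weights, so
    convexity of [born] bounds the sum over the orbit. *)
Lemma born_polar_le u G : continuous u -> measurable_fun setT G -> (forall x, enorm (G x) <= 1) ->
  (\int[mu]_x (born (polar_grad u G x))%:E <= \int[mu]_x (born (G x))%:E)%E.
Proof.
move=> cu mG G1; have mp := measurable_born (measurable_polar_grad e a d cu mG).
apply: (@integral_le_refl R n e e1 a (fun x => born (polar_grad u G x)) (fun x => born (G x))).
- exact: mp.
- exact: measurable_born.
- by move=> x; exact: born_ge0.
- by move=> x; exact: born_ge0.
move=> x; rewrite (polar_grad_refl e1 a d0) (polar_gradE e a d).
have w := weight_itv e a d0 u x; have /andP[w0 w1] := w.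
have bS v : born (S v) = born v by rewrite /born enorm_linrefl.
have S1 : enorm (S (G (sg x))) <= 1 by rewrite enorm_linrefl.
have h1 := born_convex w (G1 x) S1.
have w' : 0 <= 1 - weight u x <= 1 by apply/andP; split; lra.
have h2 := born_convex w' (G1 x) S1.
rewrite subKr in h2; rewrite !bS in h1 h2 *; lra.
Qed.

(** On an orbit polarization keeps the sum of the two values and does not increase
    the modulus of their difference. *)
Lemma sqr_polar_le u : continuous u ->
  (\int[mu]_x (polar u x ^+ 2)%:E <= \int[mu]_x (u x ^+ 2)%:E)%E.
Proof.
move=> cu; have mu' := continuous_measurable_rV cu.
have mp := continuous_measurable_rV (@continuous_polar R n e a d d0 u cu).
apply: (@integral_le_refl R n e e1 a (fun x => polar u x ^+ 2) (fun x => u x ^+ 2)).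
- exact: measurable_funX.
- exact: measurable_funX.
- by move=> x; exact: sqr_ge0.
- by move=> x; exact: sqr_ge0.
move=> x.
have E : polar u (sg x) = 2^-1 * (u x + u (sg x)) - 2^-1 * (side x * j (u x - u (sg x))).
  rewrite /polar (reflK e1) [u (sg x) + _]addrC -[u (sg x) - u x]opprB softabsN//.
  have [xa|xa|xa] := ltgtP (dotv x e) a.
  - rewrite /side (dotv_refl e1) [a < dotv x e]ltNge (ltW xa) (_ : a < _); last by lra.
    by rewrite /=; ring.
  - rewrite /side (dotv_refl e1) xa (_ : (a < _) = false); first by ring.
    by apply/negbTE; rewrite -leNgt; lra.
  - by rewrite refl_fix// subrr softabs_eq0 ?normr0 ?(ltW d0)// !mulr0 subr0 addr0.
have l : (side x * j (u x - u (sg x))) ^+ 2 <= (u x - u (sg x)) ^+ 2.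
  rewrite -(real_normK (num_real (side x * _))) normrM (norm_side e a) mul1r -(real_normK (num_real (u x - _))).
  rewrite ler_sqr ?nnegrE//; have /andP[_ h] := softabs_bounds d0 (u x - u (sg x)).
  by rewrite ger0_norm// softabs_ge0.
rewrite E /polar; move: (side x * _) l => z l; nra.
Qed.

End with_e.
End with_d.
End operations.

(** * Double integrals over the orbits of a reflection *)

Section double_integral.
Context {R : realType} {n : nat}.
Notation V := 'rV[R]_n.
Notation mu := (@leb R n).
Implicit Types (h g : V * V -> R).

(** A nonempty open set contains a box. *)
Lemma leb_open_gt0 (U : set V) (x : V) : open U -> U x -> (0 < mu U)%E.
Proof.
move=> oU Ux; have /nbhs_ballP[s /= s0 HU] := open_nbhs_nbhs (conj oU Ux).
pose rho := s / 2; have r0 : 0 < rho by rewrite divr_gt0.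
pose B : set V := [set y | forall i, `[x ord0 i - rho, x ord0 i + rho]%classic (y ord0 i)].
have BU : B `<=` U.
  move=> y By; apply: HU; apply/rV_ballE => // i.
  apply: (@le_lt_trans _ _ rho); last by rewrite /rho ltr_pdivrMr// ltr_pMr// ltr1n.
  by rewrite distrC; have := By i; rewrite /= in_itv/= ler_distl.
have lB : mu B = (\prod_(i < n) (2 * rho)%:E)%E.
  rewrite /B (leb_box (A := fun i => `[x ord0 i - rho, x ord0 i + rho]%classic))//.
  apply: eq_bigr => i _; rewrite lebesgue_measure_itv/= lte_fin ltrD2l gtrN// -EFinB.
  by congr EFin; ring.
have mB : measurable B.
  rewrite (_ : B = \bigcap_(i in [set: 'I_n])
   (fun y : V => y ord0 i) @^-1` `[x ord0 i - rho, x ord0 i + rho]%classic); last first.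
    by apply/seteqP; split=> y H i; [move=> _; exact: H|exact: (H i I)].
  apply: fin_bigcap_measurable => [|i _]; first exact: finite_finset.
  by apply: measurable_preimage => //; exact: measurable_coord.
apply: (@lt_le_trans _ _ (mu B)); last first.
  by apply: le_measure => //; rewrite inE//; exact: open_measurable_rV.
rewrite lB; elim/big_ind: _ => //=.
  by move=> a b a0 b0; rewrite mule_gt0.
by move=> i _; rewrite lte_fin mulr_gt0.
Qed.

Lemma integral_eq0_continuous (g : V -> R) : continuous g -> (forall x, 0 <= g x) ->
  (\int[mu]_x (g x)%:E = 0)%E -> forall x, g x = 0.
Proof.
move=> cg g0 ig x; apply: contrapT => /eqP gx.
have mg : measurable_fun setT (fun x => (g x)%:E).
  by apply/measurable_EFinP; exact: continuous_measurable_rV.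
have : (\int[mu]_x `|(g x)%:E| = 0)%E.
  by rewrite -ig; apply: eq_integral => y _; rewrite gee0_abs// lee_fin.
move=> /(ae_eq_integral_abs _ measurableT mg)[Z [mZ Z0 HZ]].
have oA : open [set y | 0 < g y].
  by apply: (open_comp (f := g)) (@open_gt R 0) => z _; exact: cg.
have Ax : [set y | 0 < g y] x by rewrite /= lt_neqAle g0 andbT eq_sym.
have := leb_open_gt0 oA Ax; rewrite ltNge => /negP; apply.
rewrite -Z0; apply: le_measure; rewrite ?inE//; first exact: open_measurable_rV.
move=> y /= yA; apply: HZ => /= /(_ I)/eqP; rewrite eqe => /eqP Ey.
by rewrite Ey ltxx in yA.
Qed.

Definition dint h : \bar R := (\int[(mu \x mu)%E]_z (h z)%:E)%E.

Lemma measurable_section h x : measurable_fun setT h -> measurable_fun setT (fun y => h (x, y)).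
Proof. by move=> mh; apply: (measurable_fun_pair2 x mh). Qed.

Lemma dintE h : measurable_fun setT h -> (forall z, 0 <= h z) ->
  dint h = (\int[mu]_x \int[mu]_y (h (x, y))%:E)%E.
Proof.
move=> mh h0; rewrite /dint (@fubini_tonelli1 _ _ _ _ _ mu mu (EFin \o h))//.
exact/measurable_EFinP.
Qed.

Lemma dint_ge0 h : (forall z, 0 <= h z) -> (0 <= dint h)%E.
Proof. by move=> h0; apply: integral_ge0 => z _; rewrite lee_fin. Qed.

Lemma dintD h g : measurable_fun setT h -> measurable_fun setT g ->
  (forall z, 0 <= h z) -> (forall z, 0 <= g z) -> dint (fun z => h z + g z) = (dint h + dint g)%E.
Proof.
move=> mh mg h0 g0; rewrite /dint.
under eq_integral do rewrite EFinD.
apply: ge0_integralD => //.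
- by move=> z _; rewrite lee_fin.
- exact/measurable_EFinP.
- by move=> z _; rewrite lee_fin.
- exact/measurable_EFinP.
Qed.

Lemma le_dint h g : measurable_fun setT h -> measurable_fun setT g ->
  (forall z, 0 <= h z) -> (forall z, h z <= g z) -> (dint h <= dint g)%E.
Proof.
move=> mh mg h0 hg; apply: ge0_le_integral => //.
- by move=> z _; rewrite lee_fin.
- exact/measurable_EFinP.
- exact/measurable_EFinP.
- by move=> z _; rewrite lee_fin.
Qed.

Lemma lt_dint h g (A B : set V) : measurable_fun setT h -> measurable_fun setT g ->
  (forall z, 0 <= h z) -> (forall z, h z <= g z) -> (dint h < +oo)%E ->
  open A -> A !=set0 -> open B -> B !=set0 ->
  (forall x y, A x -> B y -> h (x, y) < g (x, y)) -> (dint h < dint g)%E.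
Proof.
move=> mh mg h0 hg hoo oA [a Aa] oB [b Bb] hAB.
have mD : measurable_fun setT (fun z => g z - h z) by exact: measurable_funB.
have D0 z : 0 <= g z - h z by rewrite subr_ge0.
have -> : g = (fun z => h z + (g z - h z)) by apply/funext => z; rewrite addrC subrK.
rewrite dintD// lteDl ?ge0_fin_numE ?dint_ge0//.
rewrite lt_neqAle dint_ge0// andbT; apply/eqP => /esym H.
have mDE : measurable_fun setT (fun z => (g z - h z)%:E) by exact/measurable_EFinP.
have : (\int[(mu \x mu)%E]_z `|(g z - h z)%:E| = 0)%E.
  by rewrite -H; apply: eq_integral => z _; rewrite gee0_abs// lee_fin.
move=> /(ae_eq_integral_abs _ measurableT mDE)[Z [mZ Z0 HZ]].
have mA := open_measurable_rV oA; have mB := open_measurable_rV oB.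
have : (0 < (mu \x mu) (A `*` B))%E.
  rewrite product_measure1E// mule_gt0//; first exact: leb_open_gt0 oA Aa.
  exact: leb_open_gt0 oB Bb.
apply/negP; rewrite -leNgt -Z0; apply: le_measure; rewrite ?inE//; first exact: measurableX.
move=> [x y] [/= Ax By]; apply: HZ => /= /(_ I)/eqP; rewrite eqe subr_eq0 => /eqP E.
by have := hAB x y Ax By; rewrite E ltxx.
Qed.

Section reflect.
Variables (e : V) (e1 : enorm e = 1) (a : R).
Notation sg := (refl e a).

Lemma measurable_refl1 h : measurable_fun setT h ->
  measurable_fun setT (fun z : V * V => h (sg z.1, z.2)).
Proof.
move=> mh; apply: (measurableT_comp mh); apply: measurable_fun_pair => //.
by apply: measurableT_comp => //; exact: measurable_refl.
Qed.

Lemma measurable_refl2 h : measurable_fun setT h ->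
  measurable_fun setT (fun z : V * V => h (z.1, sg z.2)).
Proof.
move=> mh; apply: (measurableT_comp mh); apply: measurable_fun_pair => //.
by apply: measurableT_comp => //; exact: measurable_refl.
Qed.

Lemma dint_refl2 h : measurable_fun setT h -> (forall z, 0 <= h z) ->
  dint (fun z => h (z.1, sg z.2)) = dint h.
Proof.
move=> mh h0; rewrite !dintE//; last exact: measurable_refl2.
apply: eq_integral => x _ /=.
rewrite (integral_mpres (f := fun y => (h (x, y))%:E) (measurable_refl e a) (leb_refl e1 a))//.
by apply/measurable_EFinP; exact: measurable_section.
Qed.

Lemma dint_refl1 h : measurable_fun setT h -> (forall z, 0 <= h z) ->
  dint (fun z => h (sg z.1, z.2)) = dint h.
Proof.
move=> mh h0; rewrite !dintE//; last exact: measurable_refl1.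
rewrite /=.
have mF : measurable_fun setT (fun x => (\int[mu]_y (h (x, y))%:E)%E).
  apply: (@measurable_fun_fubini_tonelli_F _ _ _ _ _ mu (EFin \o h)) => //.
  exact/measurable_EFinP.
exact: (integral_mpres (measurable_refl e a) (leb_refl e1 a) mF).
Qed.

Definition orbit_sum h (z : V * V) : R :=
  (h z + h (sg z.1, z.2)) + (h (z.1, sg z.2) + h (sg z.1, sg z.2)).

Lemma measurable_orbit_sum h : measurable_fun setT h -> measurable_fun setT (orbit_sum h).
Proof.
move=> mh; have m1 := measurable_refl1 mh; have m2 := measurable_refl2 mh.
have m12 := measurable_refl1 m2.
by apply: measurable_funD; apply: measurable_funD.
Qed.

Lemma dint_orbit_sum h : measurable_fun setT h -> (forall z, 0 <= h z) ->
  dint (orbit_sum h) = ((dint h + dint h) + (dint h + dint h))%E.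
Proof.
move=> mh h0; have m1 := measurable_refl1 mh; have m2 := measurable_refl2 mh.
have m12 := measurable_refl1 m2.
rewrite /orbit_sum (dintD (h := fun z => h z + h (sg z.1, z.2))); last 4 first.
- exact: measurable_funD.
- exact: measurable_funD.
- by move=> z; rewrite addr_ge0.
- by move=> z; rewrite addr_ge0.
rewrite !dintD// (dint_refl1 mh h0) (dint_refl2 mh h0).
by rewrite (dint_refl1 m2)// (dint_refl2 mh h0).
Qed.

(** The reflections preserve the measure, so it is enough to compare orbit sums. *)
Lemma lt_dint_refl h g (A B : set V) : measurable_fun setT h -> measurable_fun setT g ->
  (forall z, 0 <= h z) -> (forall z, 0 <= g z) ->
  (forall z, orbit_sum h z <= orbit_sum g z) -> (dint h < +oo)%E ->
  open A -> A !=set0 -> open B -> B !=set0 ->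
  (forall x y, A x -> B y -> orbit_sum h (x, y) < orbit_sum g (x, y)) -> (dint h < dint g)%E.
Proof.
move=> mh mg h0 g0 hg hoo oA A0 oB B0 hAB.
have : (dint (orbit_sum h) < dint (orbit_sum g))%E.
  apply: (lt_dint _ _ _ _ _ oA A0 oB B0) => //; try exact: measurable_orbit_sum.
    by move=> z; rewrite !addr_ge0.
  rewrite dint_orbit_sum//; have h2 := lte_add_pinfty hoo hoo; exact: lte_add_pinfty.
rewrite !dint_orbit_sum//.
move: (dint_ge0 h0) (dint_ge0 g0) hoo; case: (dint h) => [s| |]//; case: (dint g) => [t| |]//.
  by rewrite -!EFinD !lte_fin => _ _ _; lra.
Qed.

End reflect.
End double_integral.

(** * The Riesz kernel and two-point rearrangement *)

Section kernel.
Context {R : realType} {n : nat}.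
Notation V := 'rV[R]_n.
Notation mu := (@leb R n).
Variable alpha : R.
Hypothesis alpha_lt : alpha < n%:R.
Notation k := (@riesz R n alpha).

Lemma Gamma_ge0 (s : R) : 0 <= Gamma s.
Proof.
by apply: Rintegral_ge0 => t _; rewrite mulr_ge0 ?powR_ge0 ?expR_ge0.
Qed.

Lemma riesz_const_ge0 : 0 <= riesz_const n alpha.
Proof. by rewrite divr_ge0 ?mulr_ge0 ?Gamma_ge0 ?powR_ge0. Qed.

Lemma riesz_ge0 (x : V) : 0 <= k x.
Proof. by rewrite mulr_ge0 ?riesz_const_ge0 ?powR_ge0. Qed.

Lemma measurable_riesz d (T : measurableType d) (g : T -> V) : measurable_fun setT g ->
  measurable_fun setT (fun x => k (g x)).
Proof.
move=> mg; apply: measurable_funM => //.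
apply: (@measurableT_comp _ _ _ _ _ _ (fun t : R => t `^ (- (n%:R - alpha)))).
  exact: measurable_powR.
exact: measurable_enorm.
Qed.

Lemma riesz_anti (x y : V) : 0 < enorm x -> enorm x <= enorm y -> k y <= k x.
Proof.
move=> x0 xy; apply: ler_wpM2l; first exact: riesz_const_ge0.
rewrite !powRN lef_pV2 ?posrE ?powR_gt0//; last exact: lt_le_trans xy.
by apply: ge0_ler_powR; rewrite ?nnegrE ?enorm_ge0// subr_ge0 ltW.
Qed.

Lemma riesz_lt (x y : V) : 0 < riesz_const n alpha -> 0 < enorm x -> enorm x < enorm y -> k y < k x.
Proof.
move=> c0 x0 xy; rewrite ltr_pM2l// !powRN ltf_pV2 ?posrE ?powR_gt0//; last exact: lt_trans xy.
by apply: gt0_ltr_powR; rewrite ?nnegrE ?enorm_ge0// subr_gt0.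
Qed.

Lemma riesz_eq_enorm (x y : V) : enorm x = enorm y -> k x = k y.
Proof. by rewrite /riesz => ->. Qed.

(** The integrand of [Falp] on the product space, for [g = |u|^p]. *)
Definition cross (g : V -> R) (z : V * V) : R := k (z.1 - z.2) * (g z.2 * g z.1).

Lemma cross_ge0 g z : (forall x, 0 <= g x) -> 0 <= cross g z.
Proof. by move=> g0; apply: mulr_ge0; [exact: riesz_ge0|exact: mulr_ge0]. Qed.

Lemma measurable_cross g : measurable_fun setT g -> measurable_fun setT (cross g).
Proof.
move=> mg; apply: measurable_funM.
  by apply: measurable_riesz; exact: measurable_rV_sub.
by apply: measurable_funM; exact: measurableT_comp.
Qed.

Lemma Falp_dint p (u : V -> R) : measurable_fun setT u ->
  Falp alpha p u = dint (cross (fun x => `|u x| `^ p)).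
Proof.
move=> mu'.
have mg : measurable_fun setT (fun x => `|u x| `^ p).
  apply: (@measurableT_comp _ _ _ _ _ _ (fun t : R => t `^ p)); first exact: measurable_powR.
  exact: measurableT_comp.
rewrite dintE; [|exact: measurable_cross|by move=> z; apply: cross_ge0 => x; exact: powR_ge0].
apply: eq_integral => x _; rewrite /riesz_conv muleC.
have mk : measurable_fun setT (fun y : V => (k (x - y) * `|u y| `^ p)%:E).
  apply/measurable_EFinP; apply: measurable_funM => //.
  by apply: measurable_riesz; apply: measurable_rV_sub => //; exact: measurable_cst.
have k0 (y : V) : setT y -> (0 <= (k (x - y) * `|u y| `^ p)%:E)%E.
  by move=> _; rewrite lee_fin; apply: mulr_ge0; [exact: riesz_ge0|exact: powR_ge0].
have u0 : (0 <= (`|u x| `^ p)%:E)%E by rewrite lee_fin powR_ge0.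
rewrite -(ge0_integralZl mu measurableT mk k0 u0).
by apply: eq_integral => y _; rewrite -EFinM /cross/=; congr EFin; rewrite mulrC mulrA.
Qed.

Section polarized.
Variables (e : V) (e1 : enorm e = 1) (a : R).
Implicit Types g : V -> R.
Notation sg := (refl e a).
Notation side := (side e a).

(** Two-point rearrangement: of the two values on an orbit the larger one goes
    to the positive side. *)
Definition polarized (g : V -> R) (x : V) : R :=
  2^-1 * (g x + g (sg x)) + 2^-1 * (side x * `|g x - g (sg x)|).

Lemma polarizedE g x : polarized g x =
  if a < dotv x e then Num.max (g x) (g (sg x)) else Num.min (g x) (g (sg x)).
Proof.
rewrite /polarized /side; case: ifP => _; first by rewrite maxr_absE; field.
by rewrite minr_absE; field.
Qed.

Lemma polarized_powR (f : V -> R) p x : 0 <= p -> (forall x, 0 <= f x) ->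
  polarized (fun x => f x `^ p) x = polarized f x `^ p.
Proof.
move=> p0 f0; rewrite !polarizedE.
have h (s t : R) : 0 <= s -> 0 <= t -> s <= t -> s `^ p <= t `^ p.
  by move=> s0 t0 st; apply: ge0_ler_powR; rewrite ?nnegrE.
case: ifP => _.
  have [l|/ltW l] := leP (f x) (f (sg x)); first exact/max_r/h.
  exact/max_l/h.
have [l|/ltW l] := leP (f x) (f (sg x)); first exact/min_l/h.
exact/min_r/h.
Qed.

Lemma measurable_polarized g : measurable_fun setT g -> measurable_fun setT (polarized g).
Proof.
move=> mg; have mgs : measurable_fun setT (fun x => g (sg x)).
  by apply: measurableT_comp => //; exact: measurable_refl.
apply: measurable_funD; apply: measurable_funM => //; first exact: measurable_funD.
apply: measurable_funM; first exact: measurable_side.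
by apply: measurableT_comp => //; exact: measurable_funB.
Qed.

Lemma polarized_ge0 g x : (forall x, 0 <= g x) -> 0 <= polarized g x.
Proof. by move=> g0; rewrite polarizedE; case: ifP => _; rewrite ?le_max ?le_min !g0. Qed.

Lemma side_refl x : dotv x e != a -> side (sg x) = - side x.
Proof.
move=> xa; rewrite /side dotv_refl//.
have [h|h|h] := ltgtP a (dotv x e).
- by rewrite ltNge (_ : _ <= a)//; lra.
- by rewrite opprK (_ : a < _)//; lra.
- by rewrite h eqxx in xa.
Qed.

Lemma polarized_refl g x : polarized g (sg x) = 2^-1 * (g x + g (sg x)) - 2^-1 * (side x * `|g x - g (sg x)|).
Proof.
rewrite /polarized reflK// [g (sg x) + _]addrC distrC.
have [xa|xa] := eqVneq (dotv x e) a.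
  by rewrite refl_fix// subrr normr0 !mulr0 addr0 subr0.
by rewrite side_refl// mulNr mulrN.
Qed.

(** With [m] the mean and [d] the half-difference over orbits, the orbit sum of
    [cross g] is [2 (k1 + k2) m m' + 2 (k1 - k2) d d'], where [k1], [k2] are the
    kernels at [x - y] and [x - sg y]. *)
Lemma orbit_sum_cross g x y : orbit_sum e a (cross g) (x, y) =
  2^-1 * (k (x - y) + k (x - sg y)) * ((g x + g (sg x)) * (g y + g (sg y))) +
  2^-1 * (k (x - y) - k (x - sg y)) * ((g x - g (sg x)) * (g y - g (sg y))).
Proof.
have k1 : k (sg x - sg y) = k (x - y) by apply: riesz_eq_enorm; exact: enorm_refl_sub.
have k2 : k (sg x - y) = k (x - sg y).
  by rewrite -{1}(reflK e1 a y); apply: riesz_eq_enorm; exact: enorm_refl_sub.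
rewrite /orbit_sum /cross /= k1 k2.
move: (k (x - y)) (k (x - sg y)) (g x) (g (sg x)) (g y) (g (sg y)) => s t p q p' q'.
by field.
Qed.

Lemma orbit_sum_polarized g x y :
  orbit_sum e a (cross (polarized g)) (x, y) - orbit_sum e a (cross g) (x, y) =
  2^-1 * (k (x - y) - k (x - sg y)) * (side x * side y * (`|g x - g (sg x)| * `|g y - g (sg y)|)
     - (g x - g (sg x)) * (g y - g (sg y))).
Proof.
rewrite !orbit_sum_cross !polarized_refl {1 2 3 4}/polarized.
move: (k _) (k _) (side x) (side y) (g x) (g (sg x)) (g y) (g (sg y)) => k1 k2 s s' p q p' q'.
move: `|p - q| `|p' - q'| => d d'; by field.
Qed.

(** Points on the same side of the mirror are closer to each other than to their
    mirror images, points on opposite sides are farther apart. *)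
Lemma riesz_side x y : dotv x e != a -> dotv y e != a -> x != y -> x != sg y ->
  (0 < side x * side y -> k (x - sg y) <= k (x - y)) /\
  (side x * side y < 0 -> k (x - y) <= k (x - sg y)).
Proof.
move=> xa ya xy xsy; have E := sqr_enorm_sub_refl e1 a x y.
have n1 : 0 < enorm (x - y) by rewrite lt_neqAle enorm_ge0 andbT eq_sym enorm_eq0 subr_eq0.
have n2 : 0 < enorm (x - sg y) by rewrite lt_neqAle enorm_ge0 andbT eq_sym enorm_eq0 subr_eq0.
have S z : dotv z e != a -> 0 < side z * (dotv z e - a).
  move=> za; rewrite /side; have [h|h|h] := ltgtP a (dotv z e).
  - by rewrite mul1r subr_gt0.
  - by rewrite mulN1r oppr_gt0 subr_lt0.
  - by rewrite h eqxx in za.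
have Sx := S x xa; have Sy := S y ya.
have sq (s t : R) : 0 <= s -> 0 <= t -> s ^+ 2 <= t ^+ 2 -> s <= t.
  by move=> s0 t0; rewrite ler_sqr.
have P := mulr_gt0 Sx Sy; rewrite mulrACA in P.
split=> s0; apply: riesz_anti => //; apply: sq; rewrite ?enorm_ge0// E.
  rewrite (pmulr_rgt0 _ s0) in P; lra.
rewrite (nmulr_rgt0 _ s0) in P; lra.
Qed.

(** At [x = y] and at [x = sg y] the monotonicity of the kernel fails, its value at
    the origin being zero, but there both orbit sums agree. *)
Lemma orbit_sum_le g z : orbit_sum e a (cross g) z <= orbit_sum e a (cross (polarized g)) z.
Proof.
case: z => x y; rewrite -subr_ge0 orbit_sum_polarized.
have [xa|xa] := eqVneq (dotv x e) a; first by rewrite (refl_fix xa) (subrr (g x)) normr0 !mul0r !mulr0 subr0 mulr0.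
have [ya|ya] := eqVneq (dotv y e) a; first by rewrite (refl_fix ya) (subrr (g y)) normr0 !mulr0 subr0 mulr0.
have ns := norm_side e a.
have nn z : side z * side z = 1 by rewrite -expr2 -(real_normK (num_real _)) ns expr1n.
have NN (t : R) : `|t| * `|t| = t * t by rewrite -normrM ger0_norm// -expr2 sqr_ge0.
have [->|xy] := eqVneq x y.
  by rewrite nn mul1r NN (subrr ((_ - _) * _)) mulr0.
have [E|xsy] := eqVneq x (sg y).
  rewrite E reflK// side_refl// mulNr nn -[g (sg y) - g y]opprB normrN.
  by rewrite mulN1r mulNr NN (subrr (- _)) mulr0.
have [h1 h2] := riesz_side xa ya xy xsy.
rewrite -normrM; move: ((g x - g (sg x)) * (g y - g (sg y))) => D.
have D1 := ler_norm D; have D2 := ler_norm (- D); rewrite normrN in D2.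
rewrite -mulrA pmulr_rge0 ?invr_gt0//.
move: h1 h2; rewrite /side; case: ifP => _; case: ifP => _; rewrite ?mulr1 ?mulrNN ?mulr1 ?mul1r ?mulN1r => h1 h2.
- by have h := h1 ltr01; apply: mulr_ge0; rewrite subr_ge0.
- have h := h2 (ltrN10 R); apply: mulr_le0; first by rewrite subr_le0.
  by rewrite subr_le0 lerNl.
- have h := h2 (ltrN10 R); apply: mulr_le0; first by rewrite subr_le0.
  by rewrite subr_le0 lerNl.
- by have h := h1 ltr01; apply: mulr_ge0; rewrite subr_ge0.
Qed.

Lemma orbit_sum_lt g x y : 0 < riesz_const n alpha -> a < dotv x e -> a < dotv y e ->
  g (sg x) < g x -> g y < g (sg y) ->
  orbit_sum e a (cross g) (x, y) < orbit_sum e a (cross (polarized g)) (x, y).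
Proof.
move=> c0 xa ya gx gy; rewrite -subr_gt0 orbit_sum_polarized /side xa ya !mul1r.
rewrite gtr0_norm ?subr_gt0// ltr0_norm ?subr_lt0//.
have xy : x != y by apply/eqP => E; move: gx; rewrite E ltNge (ltW gy).
have n1 : 0 < enorm (x - y) by rewrite lt_neqAle enorm_ge0 andbT eq_sym enorm_eq0 subr_eq0.
have kk : k (x - sg y) < k (x - y).
  apply: riesz_lt => //; rewrite -ltr_sqr ?nnegrE ?enorm_ge0// sqr_enorm_sub_refl//.
  by rewrite ltrDl -mulrA !mulr_gt0// subr_gt0.
move: (k (x - y)) (k (x - sg y)) kk (g x) (g (sg x)) (g y) (g (sg y)) gx gy => s t st p q p' q' pq pq'.
have -> : (p - q) * - (p' - q') - (p - q) * (p' - q') = 2 * ((p - q) * (q' - p')) by ring.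
by rewrite !mulr_gt0 ?subr_gt0 ?invr_gt0.
Qed.

(** The orbit sums never decrease, and they increase for pairs near two points of
    the positive side at which [g] and its reflection compare in opposite ways. *)
Lemma lt_dint_polarized g : 0 < riesz_const n alpha -> continuous g -> (forall x, 0 <= g x) ->
  (dint (cross g) < +oo)%E ->
  (exists x, a < dotv x e /\ g (sg x) < g x) -> (exists y, a < dotv y e /\ g y < g (sg y)) ->
  (dint (cross g) < dint (cross (polarized g)))%E.
Proof.
move=> c0 cg g0 goo [x [xa gx]] [y [ya gy]].
have mg := continuous_measurable_rV cg.
have csg : continuous (g \o sg) by move=> z; apply: continuous_comp; [exact: continuous_refl|exact: cg].
have cd : continuous (fun z : V => dotv z e) by exact: continuous_dotv.
have oH : open [set z : V | a < dotv z e].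
  by apply: (open_comp (f := fun z : V => dotv z e)) (@open_gt R a) => z _; exact: cd.
have o1 : open [set z : V | 0 < g z - g (sg z)].
  apply: (open_comp (f := fun z : V => g z - g (sg z))) (@open_gt R 0) => z _.
  by apply: continuousB; [exact: cg|exact: csg].
have o2 : open [set z : V | 0 < g (sg z) - g z].
  apply: (open_comp (f := fun z : V => g (sg z) - g z)) (@open_gt R 0) => z _.
  by apply: continuousB; [exact: csg|exact: cg].
apply: (lt_dint_refl e1 (a := a) _ _ _ _ _ goo (openI oH o1) _ (openI oH o2)).
- exact: measurable_cross.
- by apply: measurable_cross; exact: measurable_polarized.
- by move=> z; exact: cross_ge0.
- by move=> z; apply: cross_ge0 => z'; exact: polarized_ge0.
- exact: orbit_sum_le.
- by exists x; split => //=; rewrite subr_gt0.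
- by exists y; split => //=; rewrite subr_gt0.
- by move=> x' y' [/= h1]; rewrite subr_gt0 => h2 [/= h3]; rewrite subr_gt0 => h4; exact: orbit_sum_lt.
Qed.

End polarized.
End kernel.

(** * Finiteness, scaling and lower semicontinuity of the interaction *)

Section local_integrability.
Context {R : realType} {n : nat}.
Notation V := 'rV[R]_n.
Notation mu := (@leb R n).
Variable alpha : R.
Hypothesis alpha_lt : alpha < n%:R.
Notation k := (@riesz R n alpha).
Notation cross := (@cross R n alpha).
Implicit Types (u w g : V -> R).

Lemma continuous_normX (p : R) : 0 < p -> continuous (fun s : R => `|s| `^ p).
Proof.
move=> p0 s; have [->|s0] := eqVneq s 0.
  rewrite /continuous_at normr0 powR0 ?gt_eqF//; apply/cvgrPdist_lt => e e0.
  have d0 : 0 < e `^ p^-1 by exact: powR_gt0.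
  exists (e `^ p^-1) => //= t; rewrite /ball_/= !sub0r !normrN => ht.
  rewrite (ger0_norm (powR_ge0 _ _)).
  have := @gt0_ltr_powR R p p0 `|t| (e `^ p^-1); rewrite !nnegrE normr_ge0 powR_ge0 => /(_ isT isT ht).
  by rewrite -powRrM mulVf ?gt_eqF// powRr1 ?ltW.
have c1 : {for s, continuous (fun s : R => expR (p * ln `|s|))}.
  apply: continuous_comp; last exact: continuous_expR.
  apply: continuousM; first exact: cst_continuous.
  apply: continuous_comp; first exact: norm_continuous.
  by apply: continuous_ln; rewrite normr_gt0.
have E (t : R) : t != 0 -> `|t| `^ p = expR (p * ln `|t|) by move=> t0; rewrite /powR normr_eq0 (negbTE t0).
rewrite /continuous_at E//; apply: cvg_trans c1; apply: near_eq_cvg.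
have : \forall t \near s, t != 0.
  by apply: (@open_neq R 0 : open _).
by apply: filterS => t /E.
Qed.

Lemma continuous_absX (p : R) u : 0 < p -> continuous u -> continuous (fun x => `|u x| `^ p).
Proof.
move=> p0 cu x; apply: (@continuous_comp _ _ _ u (fun s : R => `|s| `^ p)); first exact: cu.
exact: continuous_normX.
Qed.

Lemma measurable_absX (p : R) u : measurable_fun setT u -> measurable_fun setT (fun x => `|u x| `^ p).
Proof.
move=> mu'; apply: (@measurableT_comp _ _ _ _ _ _ (fun t : R => t `^ p)); first exact: measurable_powR.
exact: measurableT_comp.
Qed.

Lemma dintZ (c : R) (h : V * V -> R) : 0 <= c -> measurable_fun setT h -> (forall z, 0 <= h z) ->
  dint (fun z => c * h z) = (c%:E * dint h)%E.
Proof.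
move=> c0 mh h0; rewrite /dint; under eq_integral do rewrite EFinM.
apply: ge0_integralZl => //; first exact/measurable_EFinP.
by move=> z _; rewrite lee_fin.
Qed.

Lemma Falp_ge0 p u : (0 <= Falp alpha p u)%E.
Proof.
apply: integral_ge0 => x _; apply: mule_ge0; last by rewrite lee_fin powR_ge0.
by apply: integral_ge0 => y _; rewrite lee_fin mulr_ge0 ?riesz_ge0 ?powR_ge0.
Qed.

Lemma Falp_scale p u (th : R) : measurable_fun setT u -> 0 <= th ->
  Falp alpha p (fun x => th * u x) = ((th `^ p * th `^ p)%:E * Falp alpha p u)%E.
Proof.
move=> mu' th0.
rewrite !Falp_dint//; last by exact: measurable_funM.
rewrite -dintZ; last 3 first.
- by rewrite mulr_ge0 ?powR_ge0.
- by apply: measurable_cross; exact: measurable_absX.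
- by move=> z; apply: cross_ge0 => x; exact: powR_ge0.
congr dint; apply/funext => z; rewrite /cross.
rewrite !normrM (ger0_norm th0) !powRM//; ring.
Qed.

Lemma Falp_const0 p u : riesz_const n alpha = 0 -> Falp alpha p u = 0%E.
Proof.
move=> c0; rewrite /Falp; apply: integral0_eq => x _.
rewrite /riesz_conv integral0_eq ?mul0e// => y _.
by rewrite /riesz c0 !mul0r.
Qed.

Lemma integral_sub_l (x : V) (h : V -> R) : measurable_fun setT h ->
  (\int[mu]_y (h (x - y)%R)%:E = \int[mu]_z (h z)%:E)%E.
Proof.
move=> mh; pose T (y : V) := x - y.
have mT : measurable_fun setT T by apply: measurable_rV_sub => //; exact: measurable_cst.
have HT B : measurable B -> mu (T @^-1` B) = mu B.
  apply: leb_involution => //; last by move=> y; rewrite /T opprB addrC subrK.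
  by move=> b; exists (- b) => y; rewrite /T opprD opprK addrA.
have mhE : measurable_fun setT (fun y => (h y)%:E) by exact/measurable_EFinP.
exact: (integral_mpres mT HT mhE).
Qed.

(** Where [|u|^p] exceeds a constant the finite inner integral bounds the integral
    of the kernel over a small ball. *)
Lemma riesz_loc_integrable p u : continuous u -> (exists x, u x != 0) -> 0 < p ->
  (Falp alpha p u < +oo)%E ->
  exists2 rho : R, 0 < rho & (\int[mu]_z (k z * \1_(cube rho) z)%:E < +oo)%E.
Proof.
move=> cu [x1 ux1] p0 Foo.
pose f x := `|u x| `^ p.
have cf : continuous f by exact: continuous_absX.
have mf := continuous_measurable_rV cf.
have f0 x : 0 <= f x by exact: powR_ge0.
pose c := f x1 / 2; have c0 : 0 < c by rewrite divr_gt0// powR_gt0// normr_gt0.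
have : \forall x \near x1, c < f x.
  have h : c < f x1 by rewrite /c ltr_pdivrMr// ltr_pMr ?ltr1n//; move: c0; rewrite /c pmulr_lgt0// invr_gt0.
  exact: (@cvgr_gt _ _ _ _ _ (f x1) (cf x1) c h).
move=> /nbhs_ballP[s /= s0 Hs].
pose rho := s / 3; have r0 : 0 < rho by rewrite divr_gt0.
exists rho => //.
pose A := ball x1 rho.
have oA : open A by exact: ball_open.
have Ax1 : A x1 by exact: ballxx.
have mkx x : measurable_fun setT (fun y : V => k (x - y)).
  by apply: measurable_riesz; apply: measurable_rV_sub => //; exact: measurable_cst.
have [x [Ax xfin]] : exists x : V, A x /\ (riesz_conv alpha p u x < +oo)%E.
  have mh : measurable_fun setT (fun x => riesz_conv alpha p u x * (f x)%:E)%E.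
    apply: emeasurable_funM; last exact/measurable_EFinP.
    apply: (@measurable_fun_fubini_tonelli_F _ _ _ _ _ mu (fun z : V * V => (k (z.1 - z.2) * f z.2)%:E)).
      apply/measurable_EFinP; apply: measurable_funM; last exact: measurableT_comp.
      by apply: measurable_riesz; exact: measurable_rV_sub.
    by move=> z; rewrite lee_fin mulr_ge0 ?riesz_ge0.
  have h0 x : (0 <= riesz_conv alpha p u x * (f x)%:E)%E.
    apply: mule_ge0; last by rewrite lee_fin.
    by apply: integral_ge0 => y _; rewrite lee_fin mulr_ge0 ?riesz_ge0 ?powR_ge0.
  have ih : mu.-integrable setT (fun x => riesz_conv alpha p u x * (f x)%:E)%E.
    apply/integrableP; split => //.
    by under eq_integral do rewrite gee0_abs//.
  have [Z [mZ Z0 HZ]] := integrable_ae measurableT ih.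
  have [x Ax nZ] : exists2 x, A x & ~ Z x.
    apply: contrapT => H.
    have AZ : A `<=` Z by move=> x Ax; apply: contrapT => nZ; apply: H; exists x.
    have := leb_open_gt0 oA Ax1; rewrite ltNge => /negP; apply.
    by rewrite -Z0; apply: le_measure; rewrite ?inE//; exact: open_measurable_rV.
  exists x; split => //; apply: contrapT => xoo; apply: nZ; apply: HZ => /= /(_ I).
  have -> : riesz_conv alpha p u x = +oo%E by apply/eqP; rewrite -leye_eq leNgt; apply/negP.
  rewrite gt0_mulye// lte_fin; apply: (lt_trans c0); apply: Hs.
  by apply: (le_ball _ Ax); rewrite /rho ler_pdivrMr// ler_peMr ?ltW// ltr1n.
pose h z := k z * f (x - z).
have mh : measurable_fun setT h.
  apply: measurable_funM; first exact: measurable_riesz.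
  by apply: (measurableT_comp mf); apply: measurable_rV_sub => //; exact: measurable_cst.
have h0 z : 0 <= h z by apply: mulr_ge0; [exact: riesz_ge0|exact: f0].
have E : (riesz_conv alpha p u x = \int[mu]_z (h z)%:E)%E.
  rewrite -(integral_sub_l x mh); apply: eq_integral => y _.
  by rewrite /h subKr.
rewrite E in xfin.
apply: (@le_lt_trans _ _ ((c^-1)%:E * \int[mu]_z (h z)%:E)%E); last first.
  by apply: lte_mul_pinfty => //; rewrite lee_fin invr_ge0 ltW.
have ci : (0 <= (c^-1)%:E)%E by rewrite lee_fin invr_ge0 ltW.
have mhE : measurable_fun setT (fun z => (h z)%:E) by exact/measurable_EFinP.
have h0E z : setT z -> (0 <= (h z)%:E)%E by move=> _; rewrite lee_fin.
rewrite -(ge0_integralZl mu measurableT mhE h0E ci).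
have mL : measurable_fun setT (fun z : V => (k z * \1_(cube rho) z)%:E).
  apply/measurable_EFinP; apply: measurable_funM; first exact: measurable_riesz.
  by apply: measurable_indic; exact: measurable_cube.
have L0 (z : V) : setT z -> (0 <= (k z * \1_(cube rho) z)%:E)%E.
  by move=> _; rewrite lee_fin mulr_ge0 ?riesz_ge0.
have mR : measurable_fun setT (fun z => (c^-1)%:E * (h z)%:E)%E by exact: emeasurable_funM.
apply: (ge0_le_integral mu measurableT L0 mL mR) => z _; rewrite -EFinM lee_fin /h mulrCA.
apply: ler_wpM2l; first exact: riesz_ge0.
rewrite indicE; case: (boolP (z \in _)) => [|_]; last by rewrite mulr_ge0// invr_ge0 ltW.
rewrite inE /cube/= => zr; rewrite mulrC ler_pdivlMr// mul1r ltW//; apply: Hs.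
apply/rV_ballE => // i; rewrite !mxE.
have h1 : `|x1 ord0 i - x ord0 i| < rho by move/rV_ballE: Ax; apply.
have h2 := le_trans (rV_coord_le z i) zr.
rewrite opprB addrCA; apply: (le_lt_trans (ler_normD _ _)); rewrite /rho in h1 h2 *; lra.
Qed.

(** The kernel is integrable near the origin and bounded elsewhere. *)
Lemma Falp_lty p w (rho C M : R) : 0 < rho -> 0 <= p -> 0 <= C ->
  (\int[mu]_z (k z * \1_(cube rho) z)%:E < +oo)%E ->
  measurable_fun setT w -> (forall x, `|w x| <= C) -> (forall x, M < `|x| -> w x = 0) ->
  0 < p -> (Falp alpha p w < +oo)%E.
Proof.
move=> r0 p0 C0 loc mw wC wM p1.
pose I0 := fine (\int[mu]_z (k z * \1_(cube rho) z)%:E)%E.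
have kb0 z : 0 <= k z * \1_(cube rho) z by rewrite mulr_ge0 ?riesz_ge0.
have I0E : (\int[mu]_z (k z * \1_(cube rho) z)%:E = I0%:E)%E.
  by rewrite fineK// ge0_fin_numE// integral_ge0// => z _; rewrite lee_fin.
pose K := riesz_const n alpha * rho `^ (- (n%:R - alpha)).
have K0 : 0 <= K by rewrite mulr_ge0 ?riesz_const_ge0 ?powR_ge0.
pose L := fine (mu (cube M)).
have mcM := @measurable_cube R n M; have mcr := @measurable_cube R n rho.
have LE : mu (cube M) = L%:E by rewrite fineK// ge0_fin_numE// leb_cube_lty.
have mi (B : set V) : measurable B -> measurable_fun setT (fun z : V => (\1_B z : R)) by exact: measurable_indic.
have iL : (\int[mu]_y (\1_(cube M) y)%:E = L%:E)%E by rewrite integral_indic// setIT.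
have mkb : measurable_fun setT (fun z : V => k z * \1_(cube rho) z).
  by apply: measurable_funM; [exact: measurable_riesz|exact: mi].
pose Cp := C `^ p; have Cp0 : 0 <= Cp by exact: powR_ge0.
have wb x : `|w x| `^ p <= Cp * \1_(cube M) x.
  rewrite indicE; case: (boolP (x \in _)) => [_|].
    by rewrite mulr1; apply: ge0_ler_powR; rewrite ?nnegrE.
  rewrite notin_setE /cube/= => /negP; rewrite -ltNge => /wM ->.
  by rewrite normr0 powR0 ?mulr0// gt_eqF.
(* [K] is the value of the kernel at distance [rho] *)
have kK z : k z <= k z * \1_(cube rho) z + K.
  rewrite indicE; case: (boolP (z \in _)) => [_|]; first by rewrite mulr1 lerDl.
  rewrite notin_setE /cube/= => /negP; rewrite -ltNge => zr; rewrite mulr0 add0r.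
  apply: ler_wpM2l; first exact: riesz_const_ge0.
  have rz : rho <= enorm z by apply: ltW; apply: lt_le_trans zr (norm_le_enorm z).
  rewrite !powRN lef_pV2 ?posrE ?powR_gt0//; last exact: lt_le_trans rz.
  by apply: ge0_ler_powR; rewrite ?nnegrE ?enorm_ge0// ?subr_ge0 ltW.
pose h (z : V * V) : R := (Cp * Cp) * ((k (z.1 - z.2) * \1_(cube rho) (z.1 - z.2) + K * \1_(cube M) z.2) * \1_(cube M) z.1).
have mh : measurable_fun setT h.
  apply: measurable_funM => //; apply: measurable_funM; last exact: measurableT_comp (mi _ mcM) _.
  apply: measurable_funD.
    by apply: (measurableT_comp mkb); exact: measurable_rV_sub.
  by apply: measurable_funM => //; exact: measurableT_comp (mi _ mcM) _.
have h0 z : 0 <= h z.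
  by rewrite !mulr_ge0// addr_ge0// mulr_ge0.
rewrite Falp_dint//; apply: (@le_lt_trans _ _ (dint h)).
  apply: le_dint => //.
  - by apply: measurable_cross; exact: measurable_absX.
  - by move=> z; apply: cross_ge0 => x; exact: powR_ge0.
  move=> [x y]; rewrite /cross /h /=.
  apply: (@le_trans _ _ (k (x - y) * ((Cp * \1_(cube M) y) * (Cp * \1_(cube M) x)))).
    apply: ler_wpM2l; first exact: riesz_ge0.
    by apply: ler_pM; rewrite ?powR_ge0.
  have := kK (x - y); rewrite !indicE.
  have i01 (b : bool) : 0 <= (b%:R : R) <= 1 by case: b; rewrite ?lexx ler01.
  have := riesz_ge0 alpha (x - y); have := i01 (x - y \in cube rho).
  have := mulr_ge0 Cp0 Cp0.
  case: (x \in cube M); case: (y \in cube M); rewrite ?mulr0 ?mulr1 ?mul0r; move: (k _) (_%:R) => t b.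
  - by move=> cc _ _ tb; rewrite mulrC ler_wpM2l.
  - by move=> cc /andP[b0 _] t0 _; rewrite mulr0 mulr_ge0// addr0 mulr_ge0.
  - by [].
  - by [].
rewrite dintE//.
have inner x : (\int[mu]_y (h (x, y))%:E = (Cp * Cp * (I0 + K * L) * \1_(cube M) x)%:E)%E.
  have mks : measurable_fun setT (fun y : V => k (x - y) * \1_(cube rho) (x - y)).
    by apply: (measurableT_comp mkb); apply: measurable_rV_sub => //; exact: measurable_cst.
  transitivity (\int[mu]_y ((Cp * Cp * \1_(cube M) x)%:E *
     ((k (x - y) * \1_(cube rho) (x - y))%:E + K%:E * (\1_(cube M) y)%:E)))%E.
    apply: eq_integral => y _; rewrite -[(K%:E * _)%E]EFinM -EFinD -EFinM /h/=; congr EFin; ring.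
  have m1 : measurable_fun setT (fun y : V => (k (x - y) * \1_(cube rho) (x - y))%:E) by exact/measurable_EFinP.
  have m2 : measurable_fun setT (fun y : V => K%:E * (\1_(cube M) y)%:E)%E.
    by apply/measurable_EFinP; apply: measurable_funM => //; exact: mi.
  have p1' (y : V) : setT y -> (0 <= (k (x - y) * \1_(cube rho) (x - y))%:E)%E by rewrite lee_fin.
  have p2 (y : V) : setT y -> (0 <= K%:E * (\1_(cube M) y)%:E)%E by move=> _; rewrite -EFinM lee_fin mulr_ge0.
  rewrite ge0_integralZl//; last 3 first.
  - exact: emeasurable_funD.
  - by move=> y _; apply: adde_ge0; [exact: p1'|exact: p2].
  - by rewrite lee_fin !mulr_ge0.
  rewrite (ge0_integralD mu measurableT p1' m1 p2 m2) (integral_sub_l x mkb) I0E.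
  rewrite ge0_integralZl//; last by apply/measurable_EFinP; exact: mi.
  by rewrite iL -[(K%:E * _)%E]EFinM -EFinD -EFinM; congr EFin; ring.
rewrite (eq_integral (fun x => (Cp * Cp * (I0 + K * L))%:E * (\1_(cube M) x)%:E)%E); last first.
  by move=> x _; rewrite inner EFinM.
have I00 : 0 <= I0 by rewrite fine_ge0// integral_ge0// => z _; rewrite lee_fin.
have L0 : 0 <= L by rewrite fine_ge0.
rewrite ge0_integralZl//; last 2 first.
- by apply/measurable_EFinP; exact: mi.
- by rewrite lee_fin !mulr_ge0// addr_ge0// mulr_ge0.
by rewrite iL -EFinM ltry.
Qed.

Lemma fatou_cross (g : V -> R) (gk : nat -> V -> R) (A : \bar R) :
  (forall i, measurable_fun setT (gk i)) -> (forall i x, 0 <= gk i x) ->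
  (forall x, gk i x @[i --> \oo] --> g x) ->
  (forall i, (dint (cross (gk i)) <= A)%E) -> (dint (cross g) <= A)%E.
Proof.
move=> mg g0 gc gA.
pose F (i : nat) (z : V * V) : \bar R := (cross (gk i) z)%:E.
have mF i : measurable_fun setT (F i) by apply/measurable_EFinP; exact: measurable_cross.
have F0 i z : setT z -> (0 <= F i z)%E by move=> _; rewrite lee_fin; exact: cross_ge0.
have lim z : limn_einf (F ^~ z) = (cross g z)%:E.
  have c : F i z @[i --> \oo] --> (cross g z)%:E.
    apply: cvg_EFin; first by apply: nearW.
    by apply: cvgMr; apply: cvgM; exact: gc.
  by have [-> _] := cvg_limn_einf_sup c.
have := fatou (mu \x mu)%E measurableT mF F0.
rewrite (eq_integral (fun z => (cross g z)%:E)); last by move=> z _; exact: lim.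
move=> h; apply: (le_trans h).
rewrite limn_einf_lim; apply: lime_le; first exact: is_cvg_einfs.
apply: nearW => i; apply: (@le_trans _ _ (\int[(mu \x mu)%E]_z F i z)%E); last exact: gA.
by apply: ereal_inf_lbound; exists i => /=.
Qed.

End local_integrability.

(** * Competitors below the ground state level *)

Section competitor.
Context {R : realType} {n : nat}.
Notation V := 'rV[R]_n.
Notation mu := (@leb R n).
Variables (r alpha p : R).
Hypotheses (r2 : 2 < r) (alpha0 : 0 < alpha) (p1 : 1 < p).

Let fin_real (x : \bar R) : (0 <= x)%E -> (x < +oo)%E -> exists f : R, x = f%:E.
Proof. by case: x => // f _ _; exists f. Qed.

Notation D := (n%:R + alpha + 2 * p).

Lemma born_le_sqr (v : V) : born v <= enorm v ^+ 2.
Proof.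
have [h|h] := leP (enorm v) 1; first by have /andP[] := born_itv h.
rewrite /born; apply: (@le_trans _ _ 1); first by rewrite gerBl sqrtr_ge0.
by rewrite ltW// expr_gt1// enorm_ge0.
Qed.

Let sqr_integrable (G : V -> V) : measurable_fun setT G ->
  (\int[mu]_x (enorm (G x) ^+ 2)%:E < +oo)%E ->
  mu.-integrable setT (fun x => (enorm (G x) ^+ 2)%:E).
Proof.
move=> mG Goo; apply/integrableP; split.
  by apply/measurable_EFinP; apply: measurable_funX; exact: measurable_enorm.
by under eq_integral => x _ do rewrite gee0_abs ?lee_fin ?sqr_ge0//.
Qed.

Lemma born_scale_integrable (G : V -> V) : measurable_fun setT G ->
  (\int[mu]_x (enorm (G x) ^+ 2)%:E < +oo)%E -> forall th : R,
  mu.-integrable setT (EFin \o (fun x => born (th *: G x))).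
Proof.
move=> mG Goo th.
have iG : mu.-integrable setT (EFin \o (fun x => th ^+ 2 * enorm (G x) ^+ 2)).
  exact: (integrableZl measurableT (th ^+ 2) (sqr_integrable mG Goo)).
apply: le_integrable iG => //.
  apply/measurable_EFinP; apply: measurable_born.
  by apply: (@measurable_rV_scale _ _ _ _ (cst th)).
move=> x _ /=; rewrite lee_fin (ger0_norm (born_ge0 _)) ger0_norm; last by rewrite mulr_ge0 ?sqr_ge0.
by apply: (le_trans (born_le_sqr _)); rewrite enormZ exprMn real_normK ?num_real.
Qed.

(** Dominated convergence with dominating function [4 |G|^2]. *)
Lemma born_scale_continuous (G : V -> V) : measurable_fun setT G ->
  (\int[mu]_x (enorm (G x) ^+ 2)%:E < +oo)%E ->
  {in `]-2, 2[%classic, continuous (fun th : R => \int[mu]_x born (th *: G x))}.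
Proof.
move=> mG Goo.
have iG : mu.-integrable setT (EFin \o (fun x => 4 * enorm (G x) ^+ 2)).
  exact: (integrableZl measurableT 4 (sqr_integrable mG Goo)).
apply: (continuity_under_integral (f := fun th x => born (th *: G x)) measurableT _ _ iG).
- by move=> th _; exact: born_scale_integrable.
- apply: aeW => x _ th _; rewrite /born; apply: cvgB; first exact: cvg_cst.
  apply: (@continuous_comp _ _ _ (fun th : R => 1 - enorm (th *: G x) ^+ 2) (@Num.sqrt R)); last exact: sqrt_continuous.
  rewrite (_ : (fun _ => _) = (fun th : R => 1 - th * th * enorm (G x) ^+ 2)); last first.
    by apply/funext => t; rewrite enormZ exprMn real_normK ?num_real.
  by apply: cvgB; [exact: cvg_cst|apply: cvgM; [apply: cvgM; exact: cvg_id|exact: cvg_cst]].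
- move=> th; rewrite /= in_itv/= => /andP[t1 t2]; apply: aeW => x _.
  rewrite (ger0_norm (born_ge0 _)); apply: (le_trans (born_le_sqr _)).
  rewrite enormZ exprMn real_normK ?num_real//; apply: ler_wpM2r; first exact: sqr_ge0.
  nra.
Qed.

Lemma P1_val (w : V -> R) (a b f : R) : Psi0 w = a%:E -> (\int[mu]_x (w x ^+ 2)%:E)%E = b%:E ->
  Falp alpha p w = f%:E ->
  P1 alpha p w = (n%:R * a + (n%:R + 2) / 2 * b - D / (2 * p) * f)%:E.
Proof. by move=> Ha Hb Hf; rewrite /P1 Ha sqr_Lnorm2 Hb Hf. Qed.

Lemma energy_val (w : V -> R) (a b f : R) : Psi0 w = a%:E -> (\int[mu]_x (w x ^+ 2)%:E)%E = b%:E ->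
  Falp alpha p w = f%:E ->
  energy alpha p w = (a + 2^-1 * b - (2 * p)^-1 * f)%:E.
Proof. by move=> Ha Hb Hf; rewrite /energy Ha sqr_Lnorm2 Hb Hf. Qed.

(** On the constraint the interaction term can be eliminated from the energy. *)
Let energy_on_M1 (a b f : R) : n%:R * a + (n%:R + 2) / 2 * b - D / (2 * p) * f = 0 ->
  a + 2^-1 * b - (2 * p)^-1 * f = (1 - n%:R / D) * a + 2^-1 * (1 - (n%:R + 2) / D) * b.
Proof.
move=> H; have q1 := p1; have qa := alpha0.
have D0 : D != 0 by rewrite gt_eqF//; have := ler0n R n; lra.
have p0 : p != 0 by rewrite gt_eqF//; lra.
have -> : (2 * p)^-1 * f = (n%:R * a + (n%:R + 2) / 2 * b) / D.
  have -> : n%:R * a + (n%:R + 2) / 2 * b = D / (2 * p) * f by lra.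
  by field; rewrite D0 p0.
by field.
Qed.

(** As [2 p > 2], the quadratic term dominates near zero. *)
Let pos_small (b f : R) : 0 < b -> exists2 t : R, 0 < t < 1 &
   0 <= b * t ^+ 2 - f * (t `^ p * t `^ p).
Proof.
move=> b0; have q1 := p1; have p0 : 0 < p - 1 by lra.
have [f0|f0] := leP f 0.
  exists 2^-1; first by rewrite invr_gt0 invf_lt1 ?ltr0n// ltr1n.
  by rewrite subr_ge0 (@le_trans _ _ 0)// ?mulr_le0_ge0 ?mulr_ge0 ?powR_ge0// ?sqr_ge0// ltW.
pose s := Num.min (b / f) 2^-1.
have s0 : 0 < s by rewrite lt_min divr_gt0//= invr_gt0.
have s1 : s < 1 by rewrite gt_min orbC invf_lt1 ?ltr0n// ltr1n.
pose t := s `^ (p - 1)^-1.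
have t0 : 0 < t by exact: powR_gt0.
have t1 : t < 1.
  have := @gt0_ltr_powR R (p - 1)^-1 _ s 1; rewrite powR1 !nnegrE; apply => //.
    by rewrite invr_gt0.
  exact: ltW.
exists t; first by rewrite t0.
have tp : t `^ p = t * s.
  have -> : p = 1 + (p - 1) by lra.
  rewrite powRD ?powRr1 ?ltW//; last by apply/implyP => _; rewrite gt_eqF.
  by rewrite /t -powRrM mulVf ?gt_eqF// powRr1 ?ltW.
rewrite tp.
have -> : b * t ^+ 2 - f * (t * s * (t * s)) = t ^+ 2 * (b - f * s * s) by ring.
rewrite mulr_ge0 ?sqr_ge0// subr_ge0.
have h : f * s <= b by rewrite mulrC -ler_pdivlMr// ge_min lexx.
apply: (le_trans _ h); rewrite ler_piMr ?ltW// mulr_gt0//.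
Qed.

(** A function with no larger Born-Infeld and [L^2] parts but a larger
    interaction has [P1 < 0]; scaling it down meets the constraint with an
    energy below that of [u]. *)
Lemma no_better_competitor (u w : V -> R) (G Gw : V -> V) :
  lipX1 r u G -> lipX1 r w Gw ->
  M1 r alpha p u -> energy alpha p u = c1 n r alpha p ->
  (\int[mu]_x (born (Gw x))%:E <= \int[mu]_x (born (G x))%:E)%E ->
  (\int[mu]_x (w x ^+ 2)%:E <= \int[mu]_x (u x ^+ 2)%:E)%E ->
  (Falp alpha p w < +oo)%E -> ~ (Falp alpha p u < Falp alpha p w)%E.
Proof.
have q1 := p1; have qa := alpha0.
move=> Lu Lw [Du u0 Pu] Eu Aw Bw Fwoo Fuw.
have [cu mG G1 _] := Lu; have [cw mGw Gw1 _] := Lw.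
have mw := continuous_measurable_rV cw.
have fin (f : V -> R) (b : \bar R) : (forall x, 0 <= f x) -> (b < +oo)%E ->
   (\int[mu]_x (f x)%:E <= b)%E -> exists t : R, 0 <= t /\ (\int[mu]_x (f x)%:E)%E = t%:E.
  move=> f0 boo fb.
  have i0 : (0 <= \int[mu]_x (f x)%:E)%E by apply: integral_ge0 => x _; rewrite lee_fin.
  exists (fine (\int[mu]_x (f x)%:E)%E); split; first exact: fine_ge0.
  by rewrite fineK// ge0_fin_numE//; exact: le_lt_trans boo.
have Goo := lipX1_grad_lty Lu; have Gwoo := lipX1_grad_lty Lw.
have bornle (H : V -> V) : measurable_fun setT H -> (\int[mu]_x (born (H x))%:E <= \int[mu]_x (enorm (H x) ^+ 2)%:E)%E.
  move=> mH; have m1 : measurable_fun setT (fun x => (born (H x))%:E) by apply/measurable_EFinP; exact: measurable_born.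
  have m2 : measurable_fun setT (fun x => (enorm (H x) ^+ 2)%:E).
    by apply/measurable_EFinP; apply: measurable_funX; exact: measurable_enorm.
  have b0 x : setT x -> (0 <= (born (H x))%:E)%E by move=> _; rewrite lee_fin born_ge0.
  by apply: (ge0_le_integral mu measurableT b0 m1 m2) => x _; rewrite lee_fin born_le_sqr.
have [a [a0 Ea]] := fin _ _ (fun x => born_ge0 (G x)) Goo (bornle _ mG).
have [b [b0 Eb]] := fin _ _ (fun x => sqr_ge0 (u x)) (lipX1_sqr_lty Lu) (lexx _).
have [aw [aw0 Eaw]] := fin _ _ (fun x => born_ge0 (Gw x)) Gwoo (bornle _ mGw).
have [bw [bw0 Ebw]] := fin _ _ (fun x => sqr_ge0 (w x)) (lipX1_sqr_lty Lw) (lexx _).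
rewrite Ea Eaw lee_fin in Aw; rewrite Eb Ebw lee_fin in Bw.
have F0 := Falp_ge0 alpha p u.
have [f Ef] : exists f : R, Falp alpha p u = f%:E.
  exact: fin_real F0 (lt_trans Fuw Fwoo).
have [fw Efw] : exists f : R, Falp alpha p w = f%:E.
  exact: fin_real (Falp_ge0 alpha p w) Fwoo.
rewrite Ef Efw lte_fin in Fuw; rewrite Ef lee_fin in F0.
have Psiu : Psi0 u = a%:E by rewrite (lipX1_Psi0 Lu).
rewrite (P1_val Psiu Eb Ef) in Pu; case: Pu => Pu.
have p0 : 0 < p by lra.
have n0 : 0 <= n%:R :> R by exact: ler0n.
have D0 : 0 < D by lra.
pose c := D / (2 * p); have c0 : 0 < c by rewrite divr_gt0// mulr_gt0.
(* otherwise [w = 0], and its interaction would not exceed that of [u] *)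
have bw1 : 0 < bw.
  rewrite lt_neqAle bw0 andbT; apply/eqP => bE.
  have : (Falp alpha p w = 0)%E.
    rewrite /Falp; apply: integral0_eq => x _.
    have -> : w x = 0; last by rewrite normr0 powR0 ?mule0// gt_eqF.
    apply: contrapT => /eqP wx.
    have cw2 : continuous (fun x => w x ^+ 2).
      by move=> y; exact: (continuousM (cw y) (cw y)).
    have := integral_eq0_continuous cw2 (fun x => sqr_ge0 (w x)); rewrite Ebw -bE => /(_ erefl x)/eqP.
    by rewrite sqrf_eq0 (negbTE wx).
  by rewrite Efw => -[E]; move: Fuw; rewrite E ltNge F0.
pose aT (th : R) := \int[mu]_x born (th *: Gw x).
have iT th := born_scale_integrable mGw Gwoo th.
have aTE th : (\int[mu]_x (born (th *: Gw x))%:E)%E = (aT th)%:E.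
  by rewrite /aT /Rintegral fineK//; apply: integrable_fin_num (iT th).
have aT0 th : 0 <= aT th by apply: Rintegral_ge0 => x _; exact: born_ge0.
have aT1 th : 0 <= th <= 1 -> aT th <= aw.
  move=> /andP[t0 t1]; rewrite -lee_fin -aTE -Eaw.
  have m1 : measurable_fun setT (fun x => (born (th *: Gw x))%:E) by apply: measurable_int (iT th).
  have m2 : measurable_fun setT (fun x => (born (Gw x))%:E) by apply/measurable_EFinP; exact: measurable_born.
  have b0' x : setT x -> (0 <= (born (th *: Gw x))%:E)%E by move=> _; rewrite lee_fin born_ge0.
  apply: (ge0_le_integral mu measurableT b0' m1 m2) => x _; rewrite lee_fin.
  by apply: born_mono; rewrite enormZ ger0_norm// ler_piMl ?enorm_ge0.
pose P (th : R) := n%:R * aT th + (n%:R + 2) / 2 * (th ^+ 2 * bw) - c * (`|th| `^ p * `|th| `^ p * fw).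
have [t0 /andP[t00 t01] Pt0] : exists2 t : R, 0 < t < 1 & 0 <= P t.
  have b1 : 0 < (n%:R + 2) / 2 * bw by rewrite mulr_gt0// divr_gt0//; lra.
  have [t t01 ht] := pos_small (c * fw) b1; exists t => //.
  move/andP: t01 => [t0' _]; rewrite /P (gtr0_norm t0').
  have := mulr_ge0 n0 (aT0 t); move: ht.
  have -> : (n%:R + 2) / 2 * bw * t ^+ 2 = (n%:R + 2) / 2 * (t ^+ 2 * bw) by ring.
  have -> : c * fw * (t `^ p * t `^ p) = c * (t `^ p * t `^ p * fw) by ring.
  lra.
have P1lt : P 1 < 0.
  rewrite /P normr1 powR1 expr1n !mul1r.
  have h1 := ler_wpM2l n0 (le_trans (aT1 1 _) Aw); rewrite ler01 lexx in h1; have {}h1 := h1 isT.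
  have h2 : (n%:R + 2) / 2 * bw <= (n%:R + 2) / 2 * b by rewrite ler_wpM2l// divr_ge0//; lra.
  have h3 : c * f < c * fw by rewrite ltr_pM2l.
  move: Pu; rewrite -/c; lra.
have cP : {in `]-2, 2[%classic, continuous P}.
  move=> th hth; apply: cvgB; last first.
    apply: cvgMr; apply: cvgMl; apply: cvgM; exact: (continuous_normX p0).
  apply: cvgD; first by apply: cvgMr; exact: born_scale_continuous.
  by apply: cvgMr; apply: cvgMl; apply: cvgM; exact: cvg_id.
have [th /[!in_itv]/= /andP[tt0 tt1] Pth] : exists2 c, c \in `[t0, 1] & P c = 0.
  apply: IVT; first exact: ltW.
    apply: continuous_in_subspaceT => x; rewrite inE/= in_itv/= => /andP[x1 x2]; apply: cP.
    by rewrite inE/= in_itv/=; apply/andP; split; lra.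
  by rewrite ge_min le_max Pt0 (ltW P1lt) orbT.
have th1 : th < 1 by rewrite lt_neqAle tt1 andbT; apply/eqP => E; move: P1lt; rewrite -E Pth ltxx.
have th0 : 0 < th by exact: lt_le_trans tt0.
have th01 : 0 <= th <= 1 by rewrite (ltW th0) tt1.
pose v x := th * w x.
have Lv : lipX1 r v (fun x => th *: Gw x) by apply: lipX1_scale => //; exact: ltW.
have Psiv : Psi0 v = (aT th)%:E by rewrite (lipX1_Psi0 Lv) -aTE.
have Ebv : (\int[mu]_x (v x ^+ 2)%:E)%E = (th ^+ 2 * bw)%:E.
  rewrite EFinM -Ebw -ge0_integralZl//.
  - by apply: eq_integral => x _; rewrite /v exprMn.
  - by apply/measurable_EFinP; exact: measurable_funX.
  - by move=> x _; rewrite lee_fin sqr_ge0.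
  - by rewrite lee_fin sqr_ge0.
have Efv : Falp alpha p v = (`|th| `^ p * `|th| `^ p * fw)%:E.
  by rewrite (Falp_scale _ _ mw (ltW th0)) Efw (gtr0_norm th0).
have Mv : M1 r alpha p v.
  split; first exact: lipX1_DPsi0 Lv.
    move=> v0; have : bw = 0; last by apply/eqP; rewrite gt_eqF.
    suff : (th ^+ 2 * bw)%:E = 0%:E.
      by move=> [/eqP]; rewrite mulf_eq0 expf_eq0/= (gt_eqF th0) => /eqP.
    by rewrite -Ebv v0 integral0_eq// => x _; rewrite expr0n.
  by rewrite (P1_val Psiv Ebv Efv); congr EFin.
have : (c1 n r alpha p <= energy alpha p v)%E by apply: ereal_inf_lbound; exists v.
rewrite -Eu (energy_val Psiu Eb Ef) (energy_val Psiv Ebv Efv) lee_fin.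
rewrite (energy_on_M1 Pu) (energy_on_M1 Pth).
apply/negP; rewrite -ltNge.
have k1 : 0 <= 1 - n%:R / D by rewrite subr_ge0 ler_pdivrMr// mul1r; lra.
have k2 : 0 < 2^-1 * (1 - (n%:R + 2) / D).
  by rewrite mulr_gt0 ?invr_gt0// subr_gt0 ltr_pdivrMr// mul1r; lra.
apply: ler_ltD; first by apply: ler_wpM2l => //; exact: le_trans (aT1 _ th01) Aw.
rewrite ltr_pM2l//; apply: lt_le_trans Bw.
by rewrite gtr_pMl// expr_lt1// ltW.
Qed.

End competitor.

(** * Ground states and reflections in arbitrary hyperplanes *)

Section alternative.
Context {R : realType} {n : nat}.
Notation V := 'rV[R]_n.
Notation mu := (@leb R n).

Lemma bounded_of_vanishing (u : V -> R) : continuous u -> vanishes_at_infinity u ->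
  exists2 C, 0 <= C & forall x, `|u x| <= C.
Proof.
move=> cu /(_ 1 ltr01)[M HM].
have [C C0 HC] := bounded_on_cube M cu.
exists (C + 1); first by rewrite addr_ge0.
move=> x; have [h|h] := leP (enorm x) M.
  by rewrite (le_trans (HC x _)) ?lerDl//; exact: le_trans (norm_le_enorm x) h.
by rewrite (le_trans (ltW (HM x h)))// lerDr.
Qed.

Section with_e.
Variables (e : V) (e1 : enorm e = 1) (a : R).
Notation sg := (refl e a).

Lemma refl_far (M : R) : exists C : R, forall x, C < `|x| -> M < `|sg x|.
Proof.
have cn : continuous (fun x => `|sg x|).
  move=> x; apply: (@continuous_comp _ _ _ sg (fun v : V => `|v|)); first exact: continuous_refl.
  exact: norm_continuous.
have [C C0 HC] := bounded_on_cube M cn.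
exists C => x xC; rewrite ltNge; apply/negP => /HC.
by rewrite normr_id reflK// leNgt xC.
Qed.

(** The smooth stand-in for the polarization of [|u|], which is its limit as [d]
    tends to zero. *)
Definition competitor (d : R) (u : V -> R) : V -> R := polar e a d (fun x => softabs d (u x)).

(** Each of the three smoothed absolute values is off by at most [2 d], and the
    differences inside the outer one by another [4 d]; all are halved or averaged. *)
Lemma competitor_close d (u : V -> R) x : 0 < d ->
  `|competitor d u x - polarized e a (fun x => `|u x|) x| <= 5 * d.
Proof.
move=> d0; rewrite /competitor /polar /polarized.
have close (s : R) : `|softabs d s - `|s| | <= 2 * d.
  have /andP[h1 h2] := softabs_bounds d0 s.
  by rewrite ler_norml; apply/andP; split; lra.
set v := softabs d (u x); set v' := softabs d (u (sg x)).
have hv : `|v - `|u x| | <= 2 * d := close _.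
have hv' : `|v' - `|u (sg x)| | <= 2 * d := close _.
have hs := close (v - v').
have ns := norm_side e a x.
have hd : `|side e a x * softabs d (v - v') - side e a x * `| `|u x| - `|u (sg x)| | | <= 6 * d.
  rewrite -mulrBr normrM ns mul1r.
  have -> : softabs d (v - v') - `| `|u x| - `|u (sg x)| | =
    (softabs d (v - v') - `|v - v'|) + (`|v - v'| - `| `|u x| - `|u (sg x)| |) by ring.
  apply: (le_trans (ler_normD _ _)).
  have h := ler_dist_dist (v - v') (`|u x| - `|u (sg x)|).
  have h' : `|(v - v') - (`|u x| - `|u (sg x)|)| <= 2 * d + 2 * d.
    have -> : (v - v') - (`|u x| - `|u (sg x)|) = (v - `|u x|) - (v' - `|u (sg x)|) by ring.
    by apply: (le_trans (ler_normB _ _)); exact: lerD.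
  apply: (le_trans (lerD hs (le_trans h h'))); lra.
move: (side e a x * _) (side e a x * _) hd => s t.
clear hs; move: v v' `|u x| `|u (sg x)| hv hv' => v v' f f'.
rewrite !ler_norml => /andP[h1 h2] /andP[h3 h4] /andP[h5 h6].
by apply/andP; split; lra.
Qed.

Lemma competitor_bounded d (u : V -> R) C : 0 < d -> (forall x, `|u x| <= C) ->
  forall x, `|competitor d u x| <= 2 * C.
Proof.
move=> d0 uC x; rewrite /competitor /polar.
have b y : `|softabs d (u y)| <= C.
  have /andP[_ h] := softabs_bounds d0 (u y).
  by rewrite ger0_norm ?softabs_ge0//; exact: le_trans (uC y).
set v := softabs d (u x); set v' := softabs d (u (sg x)).
have hv : `|v| <= C := b _; have hv' : `|v'| <= C := b _.
have hs : `|side e a x * softabs d (v - v')| <= 2 * C.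
  rewrite normrM norm_side mul1r ger0_norm ?softabs_ge0//.
  have /andP[_ h] := softabs_bounds d0 (v - v').
  by apply: (le_trans h); apply: (le_trans (ler_normB _ _)); lra.
move: (side e a x * _) hs => s; move: v v' hv hv' => v v'.
rewrite !ler_norml => /andP[h1 h2] /andP[h3 h4] /andP[h5 h6].
by apply/andP; split; lra.
Qed.

Lemma competitor_support d (u : V -> R) : 0 < d -> vanishes_at_infinity u ->
  exists M, forall x, M < `|x| -> competitor d u x = 0.
Proof.
move=> d0 /(_ d d0)[M HM]; have [C HC] := refl_far M.
exists (Num.max M C) => x; rewrite gt_max => /andP[xM xC].
have z y : M < `|y| -> softabs d (u y) = 0.
  by move=> yM; apply: softabs_eq0 => //; apply/ltW/HM/(lt_le_trans yM)/norm_le_enorm.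
rewrite /competitor /polar !z//; last exact: HC.
by rewrite subrr softabs_eq0 ?normr0 ?(ltW d0)// !(mulr0, addr0).
Qed.

Lemma continuous_competitor d (u : V -> R) : 0 < d -> continuous u -> continuous (competitor d u).
Proof.
move=> d0 cu; apply: continuous_polar => // x.
apply: (@continuous_comp _ _ _ u (softabs d)); first exact: cu.
exact: (C1k_continuous (C1k_softabs d 1)).
Qed.

(** As [d] tends to zero the competitors tend to the polarization of [|u|]; by
    Fatou's lemma some of them inherit its strictly larger interaction. *)
Lemma exists_better_interaction (alpha p : R) (u : V -> R) : alpha < n%:R -> 0 < p ->
  0 < riesz_const n alpha -> continuous u -> (Falp alpha p u < +oo)%E ->
  (exists x, a < dotv x e /\ `|u (sg x)| < `|u x|) ->
  (exists y, a < dotv y e /\ `|u y| < `|u (sg y)|) ->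
  exists2 d, 0 < d & (Falp alpha p u < Falp alpha p (competitor d u))%E.
Proof.
move=> alpha_lt p0 c0 cu Foo [x [xa ux]] [y [ya uy]].
have mu' := continuous_measurable_rV cu.
have pw (s t : R) : 0 <= s -> s < t -> s `^ p < t `^ p.
  by move=> s0 st; apply: gt0_ltr_powR; rewrite ?nnegrE// ltW// (le_lt_trans s0).
pose f (z : V) := `|u z|; pose g z := f z `^ p.
have f0 z : 0 <= f z by exact: normr_ge0.
have Fu := Falp_dint alpha p mu'; rewrite Fu in Foo *.
have lt := @lt_dint_polarized _ _ _ alpha_lt _ e1 a g c0 (continuous_absX p0 cu) (fun z => powR_ge0 _ _) Foo.
have {}lt := lt (ex_intro _ x (conj xa (pw _ _ (normr_ge0 _) ux))) (ex_intro _ y (conj ya (pw _ _ (normr_ge0 _) uy))).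
apply: contrapT => H.
pose d (k : nat) : R := k.+1%:R^-1; have d0 k : 0 < d k by rewrite invr_gt0.
have : (dint (cross alpha (polarized e a g)) <= dint (cross alpha g))%E.
  apply: (fatou_cross (gk := fun k z => `|competitor (d k) u z| `^ p)).
  - by move=> k; apply: measurable_absX; apply: continuous_measurable_rV; exact: continuous_competitor.
  - by move=> k z; exact: powR_ge0.
  - move=> z; rewrite polarized_powR ?(ltW p0)//.
    rewrite -[polarized e a f z]ger0_norm; last exact: polarized_ge0.
    have cw : competitor (d k) u z @[k --> \oo] --> polarized e a f z.
      apply/cvgrPdist_le => eps eps0.
      have : \forall k \near \oo, d k < eps / 5.
        have e5 : 0 < eps / 5 by rewrite divr_gt0.
        exact: (near_infty_natSinv_lt (PosNum e5)).
      apply: filterS => k hk; rewrite distrC; apply: (le_trans (competitor_close u z (d0 k))).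
      by rewrite mulrC -ler_pdivlMr// ltW.
    exact: (cvg_comp (fun k => competitor (d k) u z) (fun s : R => `|s| `^ p) cw (@continuous_normX R p p0 (polarized e a f z))).
  - move=> k; rewrite leNgt; apply/negP => h; apply: H; exists (d k) => //.
    by rewrite Falp_dint//; apply: continuous_measurable_rV; exact: continuous_competitor.
by rewrite leNgt lt.
Qed.

End with_e.

(** Otherwise polarization would produce a competitor with larger interaction. *)
Lemma ground_state_polarized (r alpha p : R) (u : V -> R) : 2 < r -> 0 < alpha ->
  alpha < n%:R -> 1 < p -> M1 r alpha p u -> energy alpha p u = c1 n r alpha p ->
  vanishes_at_infinity u -> forall (e : V) (a : R), enorm e = 1 ->
  (forall x, a < dotv x e -> `|u (refl e a x)| <= `|u x|) \/
  (forall x, a < dotv x e -> `|u x| <= `|u (refl e a x)|).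
Proof.
move=> r2 alpha0 alpha_lt p1 Mu Eu u0 e a e1.
have p0 : 0 < p by lra.
have [Du unz Pu] := Mu; have [G Lu] := DPsi0_lipX1 r2 Du; have [cu mG G1 _] := Lu.
have mu' := continuous_measurable_rV cu.
have [x1 ux1] : exists x, u x != 0.
  apply: contrapT => H; apply: unz; apply/funext => x; apply: contrapT => /eqP h.
  by apply: H; exists x.
have Psi0oo : exists2 t : R, 0 <= t & Psi0 u = t%:E.
  have i0 := born_scale_integrable mG (lipX1_grad_lty Lu) 1.
  rewrite (lipX1_Psi0 Lu).
  have E : (\int[mu]_x (1 - Num.sqrt (1 - enorm (G x) ^+ 2))%:E)%E = (\int[mu]_x (EFin \o (fun x => born (1 *: G x))) x)%E.
    by apply: eq_integral => x _ /=; rewrite scale1r.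
  rewrite E; exists (\int[mu]_x (born (1 *: G x))); first by apply: Rintegral_ge0 => x _; exact: born_ge0.
  by rewrite /Rintegral fineK//; exact: integrable_fin_num.
have [t t0 Et] := Psi0oo.
have L2 : exists2 b : R, 0 < b & (\int[mu]_x (u x ^+ 2)%:E)%E = b%:E.
  have i0 : (0 <= \int[mu]_x (u x ^+ 2)%:E)%E by apply: integral_ge0 => x _; rewrite lee_fin sqr_ge0.
  have := lipX1_sqr_lty Lu; move: i0; case E : (\int[mu]_x (u x ^+ 2)%:E)%E => [b| |]// b0 _.
  exists b => //; rewrite lt_neqAle; rewrite lee_fin in b0; rewrite b0 andbT; apply/eqP => b00.
  have cu2 : continuous (fun x => u x ^+ 2).
    by move=> y; exact: (continuousM (cu y) (cu y)).
  have := integral_eq0_continuous cu2 (fun x => sqr_ge0 (u x)); rewrite E -b00 => /(_ erefl x1)/eqP.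
  by rewrite sqrf_eq0 (negbTE ux1).
have [b b0 Eb] := L2.
have n0 : 0 <= n%:R :> R by exact: ler0n.
have D0 : 0 < (n%:R + alpha + 2 * p) / (2 * p) by rewrite divr_gt0//; lra.
have Foo : (Falp alpha p u < +oo)%E.
  rewrite ltey; apply/eqP => FE; move: Pu; rewrite /P1 Et sqr_Lnorm2 Eb FE.
  by rewrite gt0_muley ?lte_fin// -!EFinM -EFinD.
(* otherwise [P1 u = 0] would be a sum of nonnegative terms, one of them positive *)
have c0 : 0 < riesz_const n alpha.
  rewrite lt_neqAle riesz_const_ge0 andbT; apply/eqP => /esym c0.
  have F0 := Falp_const0 p u c0.
  move: Pu; rewrite (P1_val Et Eb F0) => -[]; rewrite mulr0 subr0.
  have := mulr_ge0 n0 t0; have : 0 < (n%:R + 2) / 2 * b by rewrite mulr_gt0// divr_gt0//; lra.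
  lra.
have [h|h] := pselect (forall x, a < dotv x e -> `|u (refl e a x)| <= `|u x|); first by left.
right => x xa; rewrite leNgt; apply/negP => uy; apply: h => y ya; rewrite leNgt; apply/negP => ux.
have [d d0 Fd] := exists_better_interaction e1 alpha_lt p0 c0 cu Foo
  (ex_intro _ x (conj xa uy)) (ex_intro _ y (conj ya ux)).
have r2' : 2 <= r by exact: ltW.
have Ls := lipX1_softabs d0 r2' Lu.
have Lw := lipX1_polar d0 e1 a r2' Ls; have [cs mGs Gs1 _] := Ls.
apply: (no_better_competitor r2 alpha0 p1 Lu Lw Mu Eu _ _ _ Fd).
- apply: (le_trans (born_polar_le d0 e1 a cs mGs Gs1)).
  apply: ge0_le_integral => //.
  + by move=> z _; rewrite lee_fin born_ge0.
  + by apply/measurable_EFinP; exact: measurable_born.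
  + by apply/measurable_EFinP; exact: measurable_born.
  + move=> z _; rewrite lee_fin; apply: born_mono.
    by rewrite enormZ ler_piMl ?enorm_ge0// derive1_softabs_le1.
- apply: (le_trans (sqr_polar_le d0 e1 a cs)).
  apply: ge0_le_integral => //.
  + by move=> z _; rewrite lee_fin sqr_ge0.
  + by apply/measurable_EFinP; apply: measurable_funX; exact: continuous_measurable_rV.
  + by apply/measurable_EFinP; exact: measurable_funX.
  + move=> z _; rewrite lee_fin -[u z ^+ 2]real_normK ?num_real//.
    have /andP[_ h] := softabs_bounds d0 (u z).
    by rewrite ler_sqr ?nnegrE ?softabs_ge0.
- have [rho rho0 loc] := riesz_loc_integrable cu (ex_intro _ x1 ux1) p0 Foo.
  have [C C0 HC] := bounded_of_vanishing cu u0.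
  have [M HM] := competitor_support e1 a d0 u0.
  apply: (@Falp_lty R n alpha alpha_lt p _ rho (2 * C) M) => //.
  + exact: ltW.
  + by rewrite mulr_ge0.
  + by apply: continuous_measurable_rV; exact: continuous_competitor.
  + exact: competitor_bounded.
Qed.

End alternative.

(** * Radial symmetry from two-sided comparison with all reflections *)

Section radial.
Context {R : realType} {n : nat}.
Notation V := 'rV[R]_n.
Variable f : V -> R.
Hypotheses (cf : continuous f) (f0 : forall x, 0 <= f x) (f_inf : vanishes_at_infinity f).
Variable x1 : V.
Hypothesis fx1 : 0 < f x1.
Hypothesis alt : forall (e : V) (a : R), enorm e = 1 ->
  (forall x, a < dotv x e -> f (refl e a x) <= f x) \/
  (forall x, a < dotv x e -> f x <= f (refl e a x)).

Lemma dotv_le_enorm (e x : V) : enorm e = 1 -> `|dotv x e| <= enorm x.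
Proof.
move=> e1; have ee : dotv e e = 1 by rewrite dotvv e1 expr1n.
rewrite -ler_sqr ?nnegrE ?enorm_ge0// real_normK ?num_real//.
have := sqr_ge0 (enorm (x - dotv x e *: e)).
rewrite sqr_enormB enormZ e1 mulr1 dotvZr real_normK ?num_real//; lra.
Qed.

Let continuous_refl_a (e x : V) : continuous (fun b : R => f (refl e b x)).
Proof.
move=> b; apply: (@continuous_comp _ _ _ (fun b => refl e b x) f); last exact: cf.
apply: (@continuousB _ _ _ (fun=> x) (fun b => (2 * (dotv x e - b)) *: e) b); first exact: cvg_cst.
apply: (@continuousZl _ _ _ (fun b : R => 2 * (dotv x e - b)) e).
apply: cvgM; first exact: cvg_cst.
by apply: cvgB; [exact: cvg_cst|exact: cvg_id].
Qed.

Let gt_near (g : R -> R) (s c : R) : continuous g -> c < g s ->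
  exists2 d, 0 < d & forall b, `|s - b| < d -> c < g b.
Proof.
move=> cg cs.
have h : nbhs s [set b | c < g b] by exact: (@cvgr_gt _ _ _ _ _ (g s) (cg s) c cs).
by move/nbhs_ballP: h => [d /= d0 H]; exists d => // b hb; apply: H.
Qed.

Let lt_near (g : R -> R) (s c : R) : continuous g -> g s < c ->
  exists2 d, 0 < d & forall b, `|s - b| < d -> g b < c.
Proof.
move=> cg cs.
have h : nbhs s [set b | g b < c] by exact: (@cvgr_lt _ _ _ _ _ (g s) (cg s) c cs).
by move/nbhs_ballP: h => [d /= d0 H]; exists d => // b hb; apply: H.
Qed.

(** Take the supremum [s] of the positions for which [f] dominates its reflection on
    the positive side.  There are such positions near [-oo] and none near [+oo],
    because [f] vanishes at infinity.  By continuity both alternatives hold at [s],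
    and beyond [s] only the second one is left. *)
Lemma symmetry_plane (e : V) : enorm e = 1 -> exists s,
  (forall x, f (refl e s x) = f x) /\
  (forall a x, s < a -> a < dotv x e -> f x <= f (refl e a x)).
Proof.
move=> e1; have [M HM] := f_inf fx1.
have far x : M < `|dotv x e| -> f x < f x1.
  move=> h; have := HM x (lt_le_trans h (dotv_le_enorm x e1)).
  by rewrite ger0_norm.
pose Pp := [set a | forall x, a < dotv x e -> f (refl e a x) <= f x].
have bound a : Pp a -> a <= Num.max (dotv x1 e) ((M + dotv x1 e) / 2).
  move=> Pa; rewrite leNgt; apply/negP; rewrite gt_max => /andP[h1 h2].
  have xa : a < dotv (refl e a x1) e by rewrite dotv_refl//; lra.
  have := Pa _ xa; rewrite reflK// leNgt => /negP; apply; apply: far.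
  rewrite dotv_refl//; apply: lt_le_trans (ler_norm _).
  by rewrite ltrBrDr mulrC -ltr_pdivrMr.
have nonempty : Pp (Num.min (dotv x1 e) ((dotv x1 e - M) / 2) - 1).
  set a := _ - 1.
  have h1 : a < dotv x1 e by rewrite ltrBlDr gt_min ltrDl ltr01.
  have h2 : a < (dotv x1 e - M) / 2 by rewrite ltrBlDr gt_min ltrDl ltr01 orbT.
  have [//|P2] := alt a e1.
  exfalso; have := P2 x1 h1; rewrite leNgt => /negP; apply; apply: far.
  rewrite dotv_refl// -normrN; apply: lt_le_trans (ler_norm _).
  by rewrite opprB ltrBrDr addrC -ltrBrDr mulrC -ltr_pdivlMr.
have hs : has_sup Pp by split; [exists (Num.min (dotv x1 e) ((dotv x1 e - M) / 2) - 1)|exists (Num.max (dotv x1 e) ((M + dotv x1 e) / 2))].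
pose s := sup Pp; exists s.
have above a x : s < a -> a < dotv x e -> f x <= f (refl e a x).
  move=> sa; have [Pa|] := alt a e1; last by apply.
  by move: sa; rewrite ltNge => /negP; case; apply: ub_le_sup => //; case: hs.
split=> [x|//].
have ge z : s < dotv z e -> f (refl e s z) <= f z.
  move=> sz; rewrite leNgt; apply/negP => h.
  have [d d0 Hd] := gt_near (@continuous_refl_a e z) h.
  have [b Pb bs] := sup_adherent d0 hs.
  have bs' : b <= s by apply: ub_le_sup => //; case: hs.
  have := Pb z (le_lt_trans bs' sz); rewrite leNgt => /negP; apply; apply: Hd.
  by rewrite ger0_norm ?subr_ge0// ltrBlDr addrC -ltrBlDr.
have le z : s < dotv z e -> f z <= f (refl e s z).
  move=> sz; rewrite leNgt; apply/negP => h.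
  have [d d0 Hd] := lt_near (@continuous_refl_a e z) h.
  pose b := s + Num.min d (dotv z e - s) / 2.
  have m0 : 0 < Num.min d (dotv z e - s) by rewrite lt_min d0 subr_gt0.
  have sb : s < b by rewrite ltrDl divr_gt0.
  have m1 : Num.min d (dotv z e - s) <= d by rewrite ge_min lexx.
  have m2 : Num.min d (dotv z e - s) <= dotv z e - s by rewrite ge_min lexx orbT.
  have bz : b < dotv z e by rewrite /b; lra.
  have := above b z sb bz; rewrite leNgt => /negP; apply; apply: Hd.
  by rewrite distrC ger0_norm ?subr_ge0 ?ltW// /b; lra.
have [h|h|h] := ltgtP s (dotv x e).
- by apply/eqP; rewrite eq_le ge//= le.
- have h' : s < dotv (refl e s x) e by rewrite dotv_refl//; lra.
  have := ge _ h'; have := le _ h'; rewrite reflK// => h1 h2.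
  by apply/eqP; rewrite eq_le h1 h2.
- by rewrite refl_fix.
Qed.

(** A nonzero period would carry the value at [x1] to infinity. *)
Lemma no_period (t : V) : (forall x, f (x + t) = f x) -> t = 0.
Proof.
move=> ft; apply: contrapT => /eqP t0.
have [M HM] := f_inf fx1.
have it k x : f (x + t *+ k) = f x.
  by elim: k => [|k IH]; rewrite ?mulr0n ?addr0// mulrS [t + _]addrC addrA ft.
have tt : 0 < enorm t by rewrite lt_neqAle enorm_ge0 andbT eq_sym enorm_eq0.
pose k := Num.bound (2 * (`|M| + enorm x1) / enorm t).
have hk : 2 * (`|M| + enorm x1) / enorm t < k%:R.
  by apply: archi_boundP; rewrite divr_ge0 ?mulr_ge0 ?addr_ge0 ?enorm_ge0.
rewrite ltr_pdivrMr// in hk.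
have : M < enorm (x1 + t *+ k).
  have h := enormD_max (x1 + t *+ k) (- x1).
  rewrite addrC addKr enormN -scaler_nat enormZ normr_nat in h.
  have hM := ler_norm M; have h1 := enorm_ge0 x1.
  rewrite ltNge; apply/negP => h2; rewrite scaler_nat in h.
  have h3 : Num.max (enorm (x1 + t *+ k)) (enorm x1) <= `|M| + enorm x1.
    by rewrite ge_max; apply/andP; split; [apply: (le_trans h2); lra|rewrite lerDr].
  by have := lt_le_trans hk h; rewrite ltr_pM2l// ltNge h3.
by move/HM; rewrite it ger0_norm// ltxx.
Qed.

Let sym (e : V) (a : R) := forall x, f (refl e a x) = f x.

(** The composition of two parallel reflections is a translation. *)
Lemma sym_uniq e a b : enorm e = 1 -> sym e a -> sym e b -> a = b.
Proof.
move=> e1 sa sb.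
have : (2 * (a - b)) *: e = 0.
  apply: no_period => x; rewrite -[RHS]sb -[RHS]sa; congr f.
  rewrite /refl dotvBl dotvZl dotvv e1 expr1n; apply/rowP => i; rewrite !mxE; ring.
move=> /(congr1 enorm); rewrite enorm0 enormZ e1 mulr1 => /eqP.
by rewrite normr_eq0 mulf_eq0 pnatr_eq0/= subr_eq0 => /eqP.
Qed.

Lemma enorm_delta i : enorm (delta_mx ord0 i : V) = 1.
Proof. by apply/eqP; rewrite -(@eqrXn2 _ 2)// ?enorm_ge0// expr1n -dotvv dotv_delta mxE !eqxx. Qed.

(** The reflections in the coordinate directions compose to the point reflection
    about [x0].  Conjugating a plane of symmetry by it gives a parallel one, which
    must be the same plane, so [x0] lies on it. *)
Lemma radial_center : exists x0 : V, forall e, enorm e = 1 ->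
  sym e (dotv x0 e) /\ (forall a x, dotv x0 e < a -> a < dotv x e -> f x <= f (refl e a x)).
Proof.
pose c i := sval (cid (symmetry_plane (enorm_delta i))).
have cP i : sym (delta_mx ord0 i) (c i).
  by rewrite /c; case: (cid _) => s []/=.
pose x0 : V := \row_i c i; exists x0 => e e1.
have point x : f (2 *: x0 - x) = f x.
  pose part (s : seq 'I_n) : V := \row_i (if i \in s then 2 * c i - x ord0 i else x ord0 i).
  have H s : uniq s -> f (part s) = f x.
    elim: s => [_|i s IH /= /andP[ni us]].
      by congr f; apply/rowP => i; rewrite mxE.
    rewrite -IH// -(cP i (part s)); congr f; apply/rowP => j.
    rewrite /refl dotvC dotv_delta !mxE inE (negbTE ni) eqxx/=.
    have [->|ji] := eqVneq j i; first by rewrite (negbTE ni) mulr1; ring.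
    by rewrite mulr0 subr0.
  rewrite -(H _ (index_enum_uniq 'I_n)); congr f; apply/rowP => i.
  by rewrite !mxE mem_index_enum.
have [s [ss above]] := symmetry_plane e1.
suff <- : s = dotv x0 e by [].
have s2 : sym e (2 * dotv x0 e - s).
  move=> x; rewrite -[RHS]point -[RHS]ss -[RHS]point; congr f.
  rewrite /refl dotvBl dotvZl; apply/rowP => i; rewrite !mxE; ring.
by have := sym_uniq e1 ss s2; lra.
Qed.

(** Points at equal distance from [x0] are exchanged by a reflection whose mirror
    contains [x0]; a point moves closer to [x0] along its ray by reflection in a
    plane not containing [x0]. *)
Lemma radially_decreasing : exists x0 : V, forall x y, enorm (x - x0) <= enorm (y - x0) -> f y <= f x.
Proof.
have [x0 H] := radial_center; exists x0.
have rad x y : enorm (x - x0) = enorm (y - x0) -> f x = f y.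
  move=> xy; have [->//|nxy] := eqVneq x y.
  have d0 : enorm (x - y) != 0 by rewrite enorm_eq0 subr_eq0.
  pose e := (enorm (x - y))^-1 *: (x - y).
  have e1 : enorm e = 1 by rewrite enormZ ger0_norm ?invr_ge0 ?enorm_ge0// mulVf.
  have [se _] := H e e1; rewrite -(se x); congr f.
  rewrite /refl -dotvBl.
  have xyE : x - y = (x - x0) - (y - x0) by apply/rowP => i; rewrite !mxE; ring.
  have E : 2 * dotv (x - x0) (x - y) = enorm (x - y) ^+ 2.
    by rewrite {2}xyE sqr_enormB -xy {1}xyE dotvBr dotvv; ring.
  rewrite /e dotvZr scalerA.
  have -> : 2 * ((enorm (x - y))^-1 * dotv (x - x0) (x - y)) / enorm (x - y) = 1.
    have -> : dotv (x - x0) (x - y) = enorm (x - y) ^+ 2 / 2 by rewrite -E; field.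
    by field; rewrite d0.
  by rewrite scale1r; apply/rowP => i; rewrite !mxE; ring.
move=> x y; rewrite le_eqVlt => /orP[/eqP/rad->//|xy].
have y0 : 0 < enorm (y - x0) by apply: le_lt_trans xy; exact: enorm_ge0.
pose e := (enorm (y - x0))^-1 *: (y - x0).
have e1 : enorm e = 1 by rewrite enormZ ger0_norm ?invr_ge0 ?enorm_ge0// mulVf ?gt_eqF.
have yE : y = x0 + enorm (y - x0) *: e.
  by rewrite /e scalerA mulfV ?gt_eqF// scale1r addrC subrK.
have [_ mono] := H e e1.
clearbody e.
have ee : dotv e e = 1 by rewrite dotvv e1 expr1n.
have x0' := enorm_ge0 (x - x0).
rewrite (rad x (x0 + enorm (x - x0) *: e)); last first.
  by rewrite [x0 + _]addrC addrK enormZ e1 mulr1 ger0_norm.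
set t := enorm (y - x0) in xy y0 yE *; set s := enorm (x - x0) in xy x0' *.
rewrite yE.
have := mono (dotv x0 e + (s + t) / 2) (x0 + t *: e).
have -> : refl e (dotv x0 e + (s + t) / 2) (x0 + t *: e) = x0 + s *: e.
  rewrite /refl dotvDl dotvZl ee; by apply/rowP => i; rewrite !mxE; field.
by apply; rewrite ?dotvDl ?dotvZl ?ee; lra.
Qed.

End radial.

(** * Exclusion of bounded support *)

Section positivity.
Context {R : realType} {n : nat}.
Notation V := 'rV[R]_n.
Notation mu := (@leb R n).
Notation e_ i := (delta_mx ord0 i : V).

Lemma partial_near0 (g : V -> R) i x : (\forall y \near x, g y = 0) -> partial i g x = 0.
Proof.
move=> h; rewrite (@partial_local _ _ g (cst 0)) //.
by rewrite /partial derive_cst.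
Qed.

Section weak_derivative.
Variables (u : V -> R) (G : V -> V).
Hypotheses (cu : continuous u) (mG : measurable_fun setT G) (G1 : forall x, enorm (G x) <= 1)
  (wG : is_weak_grad u G).

Let L1loc_grad_test i (psi : V -> R) : test_fun psi -> L1loc (fun x => G x ord0 i * psi x).
Proof.
move=> tp; have [C C0 HC] := test_bounded tp; apply: (L1loc_bounded (C := C)).
  apply: measurable_funM; last exact: test_measurable.
  exact: (measurableT_comp (measurable_coord i) mG).
move=> x; rewrite normrM -[C]mul1r; apply: ler_pM => //.
exact: le_trans (enorm_coord_le _ _) (G1 x).
Qed.

(** Write the weak derivative as a limit of difference quotients and move the
    translation from the test function to [u]. *)
Lemma weak_derivative_le0 (s h0 : R) i (psi : V -> R) : 0 < h0 -> test_fun psi -> (forall x, 0 <= psi x) ->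
  (forall x h, 0 < h <= h0 -> psi x != 0 -> s * u x <= s * u (x - h *: e_ i)) ->
  {ae mu, forall x, s * G x ord0 i * psi x <= 0}.
Proof.
move=> h00 tp p0 dec.
have L : L1loc (fun x => - (s * G x ord0 i * psi x)).
  have [m _] := L1loc_grad_test i (testZ (- s) tp).
  have := L1loc_grad_test i (testZ (- s) tp).
  by congr L1loc; apply/funext => x; ring.
suff H : {ae mu, forall x, 0 <= - (s * G x ord0 i * psi x)}.
  by apply: filterS H => x; rewrite oppr_ge0.
apply: ae_ge0_of_test L _ => phi tphi phi0.
have tz : test_fun (fun x => psi x * phi x) by apply: testM => //; exact: test_smooth.
set zeta := (fun x => psi x * phi x) in tz.
have z0 x : 0 <= zeta x by exact: mulr_ge0.
have mz := test_measurable tz.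
have csu : continuous (fun x => s * u x) by exact: (@CkZ R n 0 s u cu).
have -> : \int[mu]_x (- (s * G x ord0 i * psi x) * phi x) = \int[mu]_x ((s * u x) * partial i zeta x).
  have [_ _ W] := wG; have := W _ i (testZ s tz).
  rewrite (_ : (fun x => u x * _) = (fun x => (s * u x) * partial i zeta x)); last first.
    by apply/funext => x; rewrite (partialZ _ _ _ (test_smooth tz)); ring.
  move=> ->; rewrite -mulN1r -RintegralZl//; last first.
    have := integrable_L1loc_test (L1loc_grad_test i tp) (testZ s tphi).
    by apply: eq_integrable => // x _ /=; congr EFin; rewrite /zeta; ring.
  by apply: eq_Rintegral => x _; rewrite /zeta; ring.
have c := @diffquot_cvg R n _ _ i csu tz.
apply: (cvgr_to_ge c).
exists (Num.truncn h0^-1) => // k /= hk.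
have k0 : 0 < (k.+1%:R : R) by exact: ltr0n.
pose h : R := k.+1%:R^-1; pose v : V := h *: e_ i.
have hh : 0 < h <= h0.
  rewrite invr_gt0 k0/= -[h0]invrK lef_pV2 ?posrE ?invr_gt0//.
  by apply: (le_trans (ltW (truncnS_gt _))); rewrite ler_nat.
have tzv : test_fun (fun x => zeta (x + v)) by exact: test_shift.
have i1 := integrable_continuous_test csu tzv.
have i2 := integrable_continuous_test csu tz.
have csuv : continuous (fun x : V => s * u (x - v)).
  have cv : continuous (fun x : V => x - v).
    by move=> x; exact: (@continuousD _ _ _ id (cst (- v)) x (@cvg_id _ _) (@cst_continuous _ _ (- v) x)).
  apply: (@CkZ R n 0 s (fun x => u (x - v))) => x.
  by apply: (@continuous_comp _ _ _ (fun x : V => x - v) u); [exact: cv|exact: cu].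
have i3 := integrable_continuous_test csuv tz.
have -> : \int[mu]_x (s * u x * (k.+1%:R * (zeta (v + x) - zeta x))) =
    k.+1%:R * (\int[mu]_x (s * u x * zeta (x + v)) - \int[mu]_x (s * u x * zeta x)).
  rewrite -RintegralB// -RintegralZl//; last exact: (integrableB measurableT i1 i2).
  by apply: eq_Rintegral => x _; rewrite [v + x]addrC; ring.
apply: mulr_ge0; first exact: ltW.
rewrite -(Rintegral_shift (- v) (f := fun x => s * u x * zeta (x + v))); last first.
  by apply: measurable_funM; [exact: continuous_measurable_rV|exact: test_measurable].
rewrite subr_ge0; apply: le_Rintegral => //.
  apply: eq_integrable i3 => // x _ /=; by rewrite subrK.
move=> x _; rewrite subrK; have [->|z] := eqVneq (zeta x) 0; first by rewrite !mulr0.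
apply: ler_wpM2r => //; apply: dec => //.
by apply: contra_neq z => z; rewrite /zeta z mul0r.
Qed.

(** In [\int u d_i(psi phi)] the two factors have disjoint supports. *)
Lemma weak_derivative_eq0 i (psi : V -> R) : test_fun psi ->
  (forall x, u x != 0 -> \forall y \near x, psi y = 0) ->
  {ae mu, forall x, G x ord0 i * psi x = 0}.
Proof.
move=> tp up; apply: ae_eq0_of_test (L1loc_grad_test i tp) _ => phi tphi.
have tz : test_fun (fun x => psi x * phi x) by apply: testM => //; exact: test_smooth.
have [_ _ W] := wG; have := W _ i tz.
have -> : \int[mu]_x (u x * partial i (fun x => psi x * phi x) x) = 0.
  rewrite /Rintegral integral0_eq// => x _; have [->|ux] := eqVneq (u x) 0; first by rewrite mul0r.
  rewrite partial_near0 ?mulr0//; have := up x ux.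
  by apply: filterS => y ->; rewrite mul0r.
move=> /esym /eqP; rewrite oppr_eq0 => /eqP E; rewrite -[RHS]E.
by apply: eq_Rintegral => x _; rewrite mulrA.
Qed.

End weak_derivative.

Lemma ae_le_Rintegral (g h : V -> R) : mu.-integrable setT (EFin \o g) -> mu.-integrable setT (EFin \o h) ->
  {ae mu, forall x, g x <= h x} -> \int[mu]_x g x <= \int[mu]_x h x.
Proof.
move=> ig ih gh; rewrite -subr_ge0 -RintegralB//.
have iD := integrableB measurableT ih ig.
suff -> : \int[mu]_x (h x - g x) = \int[mu]_x `|h x - g x| by apply: Rintegral_ge0.
congr fine; apply: ae_eq_integral => //.
- by apply: measurable_int iD.
- have := measurable_int _ iD => /measurable_EFinP mD.
  by apply/measurable_EFinP; apply: measurableT_comp mD.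
- by apply: filterS gh => x ghx _; rewrite ger0_norm// subr_ge0.
Qed.

(** For [g = flat 0] this says [g < g'']; the latter is [(y^4 - 2 y^3) exp(-y)] with
    [y = 1/t >= 4]. *)
Lemma flat4_gt (t : R) : 0 < t <= 4^-1 -> flat 0 t < flat 4 t - 2 * flat 3 t.
Proof.
move=> /andP[t0 t4]; rewrite /flat t0 expr0 mul1r.
have e0 : 0 < expR (- t^-1) by exact: expR_gt0.
have i4 : 4 <= t^-1 by rewrite -[4]invrK lef_pV2 ?posrE ?invr_gt0.
rewrite mulrA -mulrBl ltr_pMl//.
move: t^-1 i4 => y y4.
have h : 1 <= y ^+ 3 by apply: exprn_ege1; lra.
by rewrite (_ : y ^+ 4 - 2 * y ^+ 3 = y ^+ 3 * (y - 2)); [nra|ring].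
Qed.

Section no_compact_support.
Variables (r alpha p : R) (u : V -> R) (s : R) (x0 : V) (i : 'I_n) (rho : R).
Hypotheses (r2 : 2 < r) (u_ws : weak_solution r alpha p u) (s1 : s * s = 1)
  (su_ge0 : forall x, 0 <= s * u x)
  (su_dec : forall x y, enorm (x - x0) <= enorm (y - x0) -> s * u y <= s * u x)
  (rho0 : 0 < rho) (u_in : forall x, rho <= enorm (x - x0) -> u x = 0)
  (u_near : forall t, 0 <= t < rho -> exists x, t < enorm (x - x0) /\ u x != 0).

Notation e_ := (delta_mx ord0 i : V).
Let sigma := Num.max (rho / 2) (rho - 4^-1).
Let ti (x : V) : R := x ord0 i + - (x0 ord0 i + sigma).
Let T m (x : V) : R := flat m (ti x).

Let smooth_ti : smooth ti.
Proof. exact: (smoothD (smooth_coord i) (smooth_cst _)). Qed.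

Let smooth_T m : smooth (T m).
Proof. exact: (smooth_comp (fun k => C1k_flat k m) smooth_ti). Qed.

Let partial_T m j x : partial j (T m) x = (i == j)%:R * (T m.+2 x - m%:R * T m.+1 x).
Proof.
have d : derivable (flat m) (ti x) 1 by have [] := is_derive_flat m (ti x).
rewrite (partial_comp j d smooth_ti) derive1_flat mulrC; congr (_ * _).
rewrite (partialD _ _ (smooth_coord i) (smooth_cst _)) partial_coord.
by rewrite [X in _ + X](_ : _ = 0) ?addr0// /partial derive_cst.
Qed.

Let sigma_gt0 : 0 < sigma.
Proof. by rewrite lt_max divr_gt0. Qed.

Let sigma_lt : sigma < rho.
Proof. by rewrite gt_max ltr_pdivrMr// ltr_pMr// ltr1n/= gtrBl invr_gt0. Qed.

(** As a function of [h] the distance to [x0] is symmetric about its minimum at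
    [h = x_i - x0_i], which exceeds [sigma]. *)
Let closer (x : V) (h : R) : 0 < h <= 2 * sigma -> 0 < ti x -> enorm (x - h *: e_ - x0) <= enorm (x - x0).
Proof.
move=> /andP[h0 hs] tx; rewrite -ler_sqr ?nnegrE ?enorm_ge0//.
have -> : x - h *: e_ - x0 = (x - x0) - h *: e_ by apply/rowP => k; rewrite !mxE; ring.
rewrite sqr_enormB dotvZr dotvC dotv_delta enormZ enorm_delta mulr1 real_normK ?num_real//.
rewrite !mxE; move: tx; rewrite /ti; set y := x ord0 i; set y0 := x0 ord0 i => tx.
have : h * h <= h * (2 * sigma) by rewrite ler_pM2l.
have : 0 < h * (y - y0 - sigma) by rewrite mulr_gt0//; lra.
rewrite expr2; nra.
Qed.

(** The equation is tested with [s g(x_i - x0_i - sigma)], [g = flat 0], cut off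
    outside the support of [u].  The choice of [sigma] keeps the half space
    [x_i - x0_i > sigma] away from the centre, makes it meet the support of [u], and
    ensures [x_i - x0_i - sigma <= 1/4] on that intersection, where [g'' > g]. *)
Lemma no_compact_support : False.
Proof.
have [Du nlt1 Lflux weak] := u_ws.
have [G L] := DPsi0_lipX1 r2 Du; have [cu mG G1 _] := L.
have wG := lipX1_is_weak_grad L; have aeG := lipX1_nabla L.
have s_norm : `|s| = 1.
  by apply/eqP; rewrite -(@eqrXn2 _ 2)// expr1n real_normK ?num_real// expr2 s1.
have u0E x : u x = s * (s * u x) by rewrite mulrA s1 mul1r.
pose M := `|x0| + rho.
have M0 : 0 <= M by rewrite addr_ge0// ltW.
have uM x : M < `|x| -> u x = 0.
  move=> h; apply: u_in; apply: (le_trans _ (norm_le_enorm _)).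
  by have := lerB_dist x x0; move: h; rewrite /M; lra.
have [chi [tchi chi01 chi1]] := @plateau R n (M + 1) (addr_ge0 M0 ler01).
have schi := test_smooth tchi.
have uM1 x : u x != 0 -> `|x| < M + 1.
  move=> ux; apply: (@le_lt_trans _ _ M); last by rewrite ltrDl.
  by rewrite leNgt; apply: contraNN ux => /uM ->.
have oB : open [set y : V | `|y| < M + 1].
  by apply: (open_comp (f := fun y : V => `|y|)) (@open_lt R (M + 1)) => z _; exact: norm_continuous.
(* hence the derivatives of [chi] do not meet the support of [u] *)
have dchi0 k x : u x != 0 -> \forall y \near x, partial k chi y = 0.
  move=> /uM1 xM; apply: filterS (open_nbhs_nbhs (conj oB xM)) => y yM.
  rewrite (@partial_local _ _ chi (cst 1)); first by rewrite /partial derive_cst.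
  by apply: filterS (open_nbhs_nbhs (conj oB yM)) => z zM; rewrite chi1//; exact: ltW.
have chi_u x : u x * chi x = u x.
  have [->|ux] := eqVneq (u x) 0; first by rewrite mul0r.
  by rewrite chi1 ?mulr1//; exact/ltW/uM1.
have tT m : test_fun (fun x => T m x * chi x) by exact: testM.
pose phi x := s * (T 0 x * chi x).
have tphi : test_fun phi by exact: testZ.
(* where [T 2] is positive, moving back along the axis approaches [x0] *)
have dec : {ae mu, forall x, s * G x ord0 i * (T 2 x * chi x) <= 0}.
  apply: (weak_derivative_le0 cu mG G1 wG (s := s) (h0 := 2 * sigma)) => //.
  - by rewrite mulr_gt0.
  - by move=> x; rewrite mulr_ge0 ?flat_ge0//; have /andP[] := chi01 x.
  move=> x h hh; rewrite mulf_eq0 negb_or => /andP[Tx _]; apply: su_dec; apply: closer => //.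
  by rewrite ltNge; apply: contraNN Tx => /flat_le0 h0; rewrite /T h0.
have flat_chi : {ae mu, forall x k, G x ord0 k * partial k chi x = 0}.
  have H k : {ae mu, forall x, G x ord0 k * partial k chi x = 0}.
    have h := @weak_derivative_eq0 u G mG G1 wG k _ (test_partial k tchi); apply: h => x; exact: dchi0.
  have H2 (m : nat) : {ae mu, forall x (k : 'I_n), k = m :> nat -> G x ord0 k * partial k chi x = 0}.
    have [mn|nm] := ltnP m n.
      apply: filterS (H (Ordinal mn)) => x E k km.
      by rewrite (_ : k = Ordinal mn)//; exact: val_inj.
    by apply: aeW => x k km; have := ltn_ord k; rewrite km ltnNge nm.
  by apply: filterS (ae_foralln H2) => x E k; exact: E.
have gphi k x : partial k phi x = s * ((i == k)%:R * T 2 x * chi x + T 0 x * partial k chi x).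
  rewrite (partialZ _ _ _ (test_smooth (tT 0))) (partialM _ _ (smooth_T 0) schi) partial_T.
  by rewrite mul0r subr0; ring.
pose DD x := dotv (flux u x) (grad phi x).
pose EE x := s * G x ord0 i * (T 2 x * chi x).
(* a factor [1 / sqrt (1 - |G|^2) >= 1] multiplies a nonpositive number *)
have leDE : {ae mu, forall x, DD x <= EE x}.
  apply: filterS3 dec flat_chi (filterI nlt1 aeG) => x hdec hchi [hlt hG].
  rewrite /DD /EE /flux hG; rewrite hG in hlt.
  have sq1 : Num.sqrt (1 - enorm (G x) ^+ 2) <= 1.
    by rewrite -[X in _ <= X]sqrtr1 ler_wsqrtr// gerBl sqr_ge0.
  have sq0 : 0 < Num.sqrt (1 - enorm (G x) ^+ 2).
    by rewrite sqrtr_gt0 subr_gt0 expr_lt1 ?enorm_ge0.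
  rewrite dotvZl.
  have -> : dotv (G x) (grad phi x) = s * G x ord0 i * (T 2 x * chi x).
    rewrite /dotv (bigD1 i)//= big1 ?addr0 => [|k ki].
      rewrite mxE gphi eqxx.
      have := hchi i; move: (partial i chi x) => dc hc.
      have -> : G x ord0 i * (s * (1%:R * T 2 x * chi x + T 0 x * dc)) =
         s * G x ord0 i * (T 2 x * chi x) + s * T 0 x * (G x ord0 i * dc) by ring.
      by rewrite hc mulr0 addr0.
    rewrite mxE gphi eq_sym (negbTE ki) !mul0r add0r.
    have -> : G x ord0 k * (s * (T 0 x * partial k chi x)) = s * T 0 x * (G x ord0 k * partial k chi x) by ring.
    by rewrite hchi mulr0.
  rewrite -[leRHS]mul1r; apply: ler_wnM2r => //.
  by rewrite invf_ge1.
have iD : mu.-integrable setT (EFin \o DD).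
  have i3 k := integrable_L1loc_test (Lflux k) (test_partial k tphi).
  have := @integrable_sum _ _ _ mu setT measurableT _ (index_enum 'I_n) xpredT
    (fun k x => (flux u x ord0 k * partial k phi x)%:E) (fun k _ => i3 k).
  apply: eq_integrable => // x _ /=; rewrite sumEFin; congr EFin.
  by apply: eq_bigr => k _; congr (_ * _); rewrite mxE.
have iE : mu.-integrable setT (EFin \o EE).
  have [_ LG _] := wG; have := integrable_L1loc_test (LG i) (testZ s (tT 2)).
  by apply: eq_integrable => // x _ /=; congr EFin; rewrite /EE; ring.
have EEint : \int[mu]_x EE x = - \int[mu]_x (s * u x * (T 4 x - 2 * T 3 x)).
  have [_ _ W] := wG; have W2 := W _ i (testZ s (tT 2)).
  rewrite -[LHS]opprK; congr (- _); transitivity (- \int[mu]_x (G x ord0 i * (s * (T 2 x * chi x)))).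
    by congr (- _); apply: eq_Rintegral => x _; rewrite /EE; ring.
  rewrite -W2; apply: eq_Rintegral => x _.
  rewrite (partialZ _ _ _ (test_smooth (tT 2))) (partialM _ _ (smooth_T 2) schi) partial_T eqxx mul1r.
  have [->|ux] := eqVneq (u x) 0; first by rewrite !(mulr0, mul0r).
  rewrite (nbhs_singleton (dchi0 i x ux)) -[in RHS](chi_u x); ring.
have iU : mu.-integrable setT (EFin \o (fun x => u x * phi x)) by exact: integrable_continuous_test.
have rhs : (0 <= \int[mu]_x (riesz_conv alpha p u x * (`|u x| `^ (p - 2) * u x * phi x)%:E))%E.
  apply: integral_ge0 => x _; apply: mule_ge0.
    by apply: integral_ge0 => y _; rewrite lee_fin mulr_ge0 ?riesz_ge0 ?powR_ge0.
  rewrite lee_fin -mulrA mulr_ge0 ?powR_ge0// /phi mulrCA mulrA mulr_ge0//.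
  by rewrite mulr_ge0 ?flat_ge0//; have /andP[] := chi01 x.
have := weak phi tphi.
have Eint (g : V -> R) : mu.-integrable setT (EFin \o g) -> (\int[mu]_x (g x)%:E = (\int[mu]_x g x)%:E)%E.
  by move=> ig; rewrite /Rintegral fineK//; exact: integrable_fin_num.
rewrite (Eint _ iD) (Eint _ iU) -EFinD => E; rewrite -E lee_fin in rhs.
have hDE := ae_le_Rintegral iD iE leDE.
have UE : \int[mu]_x (u x * phi x) = \int[mu]_x (s * u x * T 0 x).
  by apply: eq_Rintegral => x _; rewrite -[in RHS](chi_u x) /phi; ring.
pose h x := s * u x * (T 4 x - 2 * T 3 x - T 0 x).
have csu : continuous (fun x => s * u x) by exact: (@CkZ R n 0 s u cu).
have iT m : mu.-integrable setT (EFin \o (fun x => s * u x * T m x)).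
  have := integrable_continuous_test csu (tT m).
  by apply: eq_integrable => // x _ /=; congr EFin; rewrite -[in RHS](chi_u x); ring.
have cT m := smooth_continuous (smooth_T m).
have ch : continuous h.
  move=> x; apply: (continuousM (csu x)).
  by apply: continuousB; [apply: continuousB; [exact: cT|apply: (continuousM (cvg_cst _)); exact: cT]|exact: cT].
have pos x : 0 < ti x -> u x != 0 -> 0 < T 4 x - 2 * T 3 x - T 0 x.
  move=> tx ux; rewrite subr_gt0; apply: flat4_gt; rewrite tx/=.
  have xr : enorm (x - x0) < rho by rewrite ltNge; apply: contraNN ux => /u_in ->.
  have h1 : x ord0 i - x0 ord0 i <= enorm (x - x0).
    by have := enorm_coord_le (x - x0) i; rewrite !mxE; apply: le_trans; exact: ler_norm.
  have h2 : rho - 4^-1 <= sigma by rewrite le_max lexx orbT.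
  by rewrite /ti; lra.
have h0 x : 0 <= h x.
  rewrite /h; have [->|ux] := eqVneq (u x) 0; first by rewrite mulr0 mul0r.
  have [tx|tx] := leP (ti x) 0; first by rewrite /T !flat_le0// mulr0 !subr0 mulr0.
  by rewrite mulr_ge0// ltW// pos.
have s43 := smoothD (smooth_T 4) (smoothN (smoothZ 2 (smooth_T 3))).
have ih : mu.-integrable setT (EFin \o h).
  have := integrable_continuous_test csu (testM (smoothD s43 (smoothN (smooth_T 0))) tchi).
  by apply: eq_integrable => // x _ /=; congr EFin; rewrite /h -[in RHS](chi_u x); ring.
have hint : (\int[mu]_x (h x)%:E = 0)%E.
  rewrite (Eint _ ih); congr EFin; apply/eqP; rewrite eq_le Rintegral_ge0 ?andbT; last by move=> x _; exact: h0.
  have i43 : mu.-integrable setT (EFin \o (fun x => s * u x * (T 4 x - 2 * T 3 x))).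
    have := integrable_continuous_test csu (testM s43 tchi).
    by apply: eq_integrable => // x _ /=; congr EFin; rewrite -[in RHS](chi_u x); ring.
  have -> : \int[mu]_x h x = \int[mu]_x (s * u x * (T 4 x - 2 * T 3 x)) - \int[mu]_x (s * u x * T 0 x).
    by rewrite -RintegralB//; apply: eq_Rintegral => x _; rewrite /h; ring.
  move: rhs hDE; rewrite UE EEint -/DD; lra.
have [x [xs ux]] := u_near (introT andP (conj (ltW sigma_gt0) sigma_lt)).
pose y := x0 + enorm (x - x0) *: e_.
have yE : enorm (y - x0) = enorm (x - x0).
  by rewrite /y [x0 + _]addrC addrK enormZ enorm_delta mulr1 ger0_norm ?enorm_ge0.
have uyx : s * u y = s * u x by apply/eqP; rewrite eq_le !su_dec// yE.
have sux : 0 < s * u x.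
  rewrite lt_neqAle su_ge0 andbT eq_sym mulf_eq0 negb_or ux andbT.
  by rewrite -normr_eq0 s_norm oner_eq0.
have uy : u y != 0 by apply: contraTneq sux => uy; rewrite -uyx uy mulr0 ltxx.
have ty : 0 < ti y.
  have -> : ti y = enorm (x - x0) - sigma by rewrite /ti /y !mxE !eqxx/= mulr1; ring.
  by rewrite subr_gt0.
have := integral_eq0_continuous ch h0 hint y => /eqP; rewrite gt_eqF//.
by rewrite /h mulr_gt0 ?uyx// pos.
Qed.

End no_compact_support.
End positivity.

(** * Constant sign and conclusion *)

Section conclusion.
Context {R : realType} {n : nat}.
Notation V := 'rV[R]_n.
Variables (u : V -> R) (x0 x1 : V) (i : 'I_n).
Hypotheses (cu : continuous u) (u_inf : vanishes_at_infinity u) (ux1 : u x1 != 0)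
  (dec : forall x y, enorm (x - x0) <= enorm (y - x0) -> `|u y| <= `|u x|).
Notation e := (delta_mx ord0 i : V).

Let ray (t : R) : V := x0 + t *: e.

Let enorm_ray t : 0 <= t -> enorm (ray t - x0) = t.
Proof. by move=> t0; rewrite /ray addrC addKr enormZ enorm_delta mulr1 ger0_norm. Qed.

Let continuous_line (v : V) : continuous (fun t : R => u (x0 + t *: v)).
Proof.
move=> t; apply: (@continuous_comp _ _ _ (fun t : R => x0 + t *: v) u); last exact: cu.
apply: (@continuousD _ _ _ (cst x0) (fun t : R => t *: v) t); first exact: cst_continuous.
exact: (@continuousZl _ _ _ (fun t : R => t) v t (@cvg_id _ _)).
Qed.

(** Along the segment from [x0] to [x] the modulus stays above [|u x|], so [u]
    cannot change sign on the way. *)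
Lemma constant_sign : exists s : R, s * s = 1 /\ forall x, 0 <= s * u x.
Proof.
have u0 : u x0 != 0.
  rewrite -normr_gt0; apply: (@lt_le_trans _ _ `|u x1|); first by rewrite normr_gt0.
  by apply: dec; rewrite subrr enorm0 enorm_ge0.
pose s := Num.sg (u x0); have ss : s * s = 1 by rewrite -expr2 sqr_sg u0.
have s0 : 0 < s * u x0 by rewrite -normrEsg normr_gt0.
exists s; split => // x; rewrite leNgt; apply/negP => sx.
pose g (t : R) := s * u (x0 + t *: (x - x0)).
have g0 : g 0 = s * u x0 by rewrite /g scale0r addr0.
have g1 : g 1 = s * u x by rewrite /g scale1r addrC subrK.
have cg : continuous g.
  by move=> t; apply: (continuousM (@cst_continuous _ _ s t)); exact: continuous_line.
have [t tI gt] : exists2 t, t \in `[0, 1] & g t = 0.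
  apply: IVT => //; first exact: continuous_subspaceT.
  by rewrite g0 g1 ge_min le_max (ltW s0) (ltW sx) orbT.
move: tI; rewrite in_itv/= => /andP[t0 t1].
have : `|u x| <= `|u (x0 + t *: (x - x0))|.
  apply: dec; rewrite [x0 + _]addrC addrK enormZ ger0_norm// ler_piMl ?enorm_ge0//.
have -> : u (x0 + t *: (x - x0)) = s * g t by rewrite /g mulrA ss mul1r.
rewrite gt mulr0 normr0 normr_le0 => /eqP ux.
by rewrite ux mulr0 ltxx in sx.
Qed.

Let radial x : `|u x| = `|u (ray (enorm (x - x0)))|.
Proof. by apply/eqP; rewrite eq_le !dec// enorm_ray ?enorm_ge0. Qed.

(** The set where [u] does not vanish is open and a union of spheres about [x0]. *)
Let further x : u x != 0 -> exists y, enorm (x - x0) < enorm (y - x0) /\ u y != 0.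
Proof.
rewrite -normr_gt0 radial; set t := enorm (x - x0) => h.
have t0 : 0 <= t by exact: enorm_ge0.
have cl : continuous (fun t : R => `|u (ray t)|).
  move=> b; apply: (@continuous_comp _ _ _ (fun t : R => u (ray t)) (fun a : R => `|a|)).
    exact: continuous_line.
  exact: norm_continuous.
have : nbhs t [set b | 0 < `|u (ray b)|] by exact: (@cvgr_gt _ _ _ _ _ _ (cl t) 0 h).
move=> /nbhs_ballP[d /= d0 Hd]; exists (ray (t + d / 2)).
have d2 : 0 < d / 2 by rewrite divr_gt0.
rewrite enorm_ray ?addr_ge0 ?(ltW d2)// ltrDl d2; split => //.
rewrite -normr_gt0; apply: Hd; rewrite /ball/= opprD addrA subrr sub0r normrN gtr0_norm//.
by rewrite ltr_pdivrMr// ltr_pMr// ltr1n.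
Qed.

(** A zero of [u] bounds the support, whose radius is then excluded by
    [no_compact_support]. *)
Lemma no_zero (r alpha p : R) : 2 < r -> weak_solution r alpha p u -> forall z, u z != 0.
Proof.
move=> r2 ws z; apply/negP => /eqP uz.
have [s [ss s0]] := constant_sign.
have sn x : s * u x = `|u x|.
  rewrite -[LHS]ger0_norm// normrM (_ : `|s| = 1) ?mul1r//.
  by apply/eqP; rewrite -(@eqrXn2 _ 2)// expr1n real_normK ?num_real// expr2 ss.
pose S := [set t | exists2 x, t = enorm (x - x0) & u x != 0].
have Sub t : S t -> t <= enorm (z - x0).
  move=> [x -> ux]; rewrite leNgt; apply/negP => /ltW/dec.
  by rewrite uz normr0 normr_le0 (negbTE ux).
have S1 : S (enorm (x1 - x0)) by exists x1.
have hs : has_sup S by split; [exists (enorm (x1 - x0))|exists (enorm (z - x0))].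
pose rho := sup S.
have Sr t : S t -> t <= rho by move=> St; apply: ub_le_sup => //; case: hs.
have out x : rho <= enorm (x - x0) -> u x = 0.
  move=> rx; apply: contrapT => /eqP/further[y [xy uy]].
  have := Sr _ (ex_intro2 _ _ y erefl uy); rewrite leNgt => /negP; apply.
  exact: le_lt_trans xy.
have rho0 : 0 < rho.
  rewrite ltNge; apply/negP => h; move: ux1; rewrite out ?eqxx//.
  exact: le_trans h (enorm_ge0 _).
apply: (@no_compact_support R n r alpha p u s x0 i rho) => //.
- by move=> x y xy; rewrite !sn; exact: dec.
- move=> t /andP[t0 tr].
  have d0 : 0 < rho - t by rewrite subr_gt0.
  have [b [x -> ux]] := sup_adherent d0 hs; rewrite subKr => tb.
  by exists x.
Qed.

Lemma radial_conclusion : (forall z, u z != 0) ->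
  ((forall x, 0 < u x) \/ (forall x, u x < 0)) /\
  exists (x0 : V) (v : R -> R),
    [/\ {in `]0, +oo[ &, {homo v : s t / s <= t}} \/
        {in `]0, +oo[ &, {homo v : s t / s <= t >-> t <= s}},
        v rho @[rho --> +oo] --> 0 &
        forall x, x != x0 -> u x = v (enorm (x - x0))].
Proof.
move=> nz; have [s [ss s0]] := constant_sign.
have s1 : s = 1 \/ s = -1.
  have : (s - 1) * (s + 1) = 0 by rewrite mulrDr mulrDl !mulrBl ss; ring.
  by move=> /eqP; rewrite mulf_eq0 subr_eq0 addr_eq0 => /orP[/eqP|/eqP]; [left|right].
have sn x : s * u x = `|u x|.
  by rewrite -[LHS]ger0_norm// normrM; case: s1 => ->; rewrite ?normrN normr1 mul1r.
have uE x : u x = s * `|u x| by rewrite -sn mulrA ss mul1r.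
have up x : 0 < `|u x| by rewrite normr_gt0.
have mono a b : a \in `]0, +oo[ -> b \in `]0, +oo[ -> a <= b -> `|u (ray b)| <= `|u (ray a)|.
  rewrite !in_itv/= !andbT => a0 b0 ab; apply: dec.
  by rewrite !enorm_ray// ltW.
split.
  by case: s1 => sE; [left|right] => x; rewrite uE sE ?mul1r// mulN1r oppr_lt0.
exists x0, (fun t => u (ray t)); split.
- case: s1 => sE; [right|left] => a b aI bI ab; rewrite [u (ray a)]uE [u (ray b)]uE sE ?mul1r.
    exact: mono.
  by rewrite !mulN1r lerN2; exact: mono.
- apply/cvgrPdist_lt => eps eps0; have [M HM] := u_inf eps0.
  exists (M - dotv x0 e); split; first exact: num_real.
  move=> t ht; rewrite sub0r normrN; apply: HM.
  apply: lt_le_trans (dotv_le_enorm (ray t) (enorm_delta i)).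
  apply: lt_le_trans (ler_norm _).
  by rewrite /ray dotvDl dotvZl dotvv enorm_delta expr1n mulr1 addrC -ltrBlDr.
- by move=> x _; rewrite uE [RHS]uE -radial.
Qed.

End conclusion.

Unset Implicit Arguments.

Theorem theorem1p2 (R : realType) (N : nat) (r alpha p : R)
    (N_ge3 : (3 <= N)%N)
    (r_gt : Num.max (2 * N%:R / (N%:R - 2)) N%:R < r)
    (alpha_gt0 : 0 < alpha) (alpha_ltN : alpha < N%:R)
    (p_gt : (N%:R + alpha) / N%:R < p)
    (u : 'rV[R]_N -> R)
    (u_gs : ground_state r alpha p u)
    (u_to0 : vanishes_at_infinity u) :
  ((forall x, 0 < u x) \/ (forall x, u x < 0)) /\
  exists (x0 : 'rV[R]_N) (v : R -> R),
    [/\ {in `]0, +oo[ &, {homo v : s t / s <= t}} \/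
        {in `]0, +oo[ &, {homo v : s t / s <= t >-> t <= s}},
        v rho @[rho --> +oo] --> 0 &
        forall x, x != x0 -> u x = v (enorm (x - x0))].
Proof.
have N3 : (3 : R) <= N%:R by rewrite ler_nat.
have r2 : 2 < r.
  by move: r_gt; rewrite gt_max => /andP[_]; lra.
have p1 : 1 < p.
  apply: lt_trans p_gt; rewrite ltr_pdivlMr; last by lra.
  by rewrite mul1r ltrDl.
have [ws Mu Eu] := u_gs; have [Du unz _] := Mu; have [[cu _ _] _] := Du.
have [x1 ux1] : exists x, u x != 0.
  apply: contrapT => H; apply: unz; apply/funext => x; apply: contrapT => /eqP h.
  by apply: H; exists x.
have ca : continuous (fun x => `|u x|).
  move=> x; apply: (@continuous_comp _ _ _ u (fun a : R => `|a|)); first exact: cu.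
  exact: norm_continuous.
have va : vanishes_at_infinity (fun x => `|u x|).
  by move=> eps /u_to0[M HM]; exists M => x /HM; rewrite normr_id.
have fx1 : 0 < `|u x1| by rewrite normr_gt0.
have [x0 dec] := radially_decreasing ca (fun x => normr_ge0 (u x)) va fx1
  (ground_state_polarized r2 alpha_gt0 alpha_ltN p1 Mu Eu u_to0).
pose i : 'I_N := Ordinal (leq_trans (isT : (0 < 3)%N) N_ge3).
apply: (radial_conclusion i cu u_to0 ux1 dec).
exact: (no_zero i cu ux1 dec r2 ws).
Qed.
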